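(* There exists a homogeneous $G_{29}$-invariant polynomial $F\in\mathbb{C}[x,y,z,t]$ of degree $12$ whose zero set in $\mathbb{P}^3(\mathbb{C})$ is a surface with exactly $320$ cusps (singularities of type $A_2$), and these cusps form a single $G_{29}$-orbit.
   Context: Let $V=\mathbb{C}^4$, let $(x,y,z,t)$ be the dual basis of the canonical basis, and identify the algebra $\mathbb{C}[V]$ of polynomial functions on $V$ with $\mathbb{C}[x,y,z,t]$, and $\mathbb{P}(V)$ with $\mathbb{P}^3(\mathbb{C})$. A subgroup of $\mathbf{GL}_4(\mathbb{C})$ acts naturally on $V$, on $\mathbb{P}^3(\mathbb{C})$ and on $\mathbb{C}[V]$. $G_{29}$ denotes the complex reflection group with that name in the Shephard-Todd classification, realized as the finite subgroup $G_{29}=\langle s_1,s_2,s_3,s_4\rangle\subset\mathbf{GL}_4(\mathbb{C})$ (of order $7680$), where, with $i^2=-1$, $$s_1=\begin{pmatrix}0&1&0&0\\1&0&0&0\\0&0&1&0\\0&0&0&1\end{pmatrix},\quad s_2=\begin{pmatrix}1&0&0&0\\0&0&1&0\\0&1&0&0\\0&0&0&1\end{pmatrix},\quad s_3=\begin{pmatrix}0&-i&0&0\\i&0&0&0\\0&0&1&0\\0&0&0&1\end{pmatrix},\quad s_4=\frac12\begin{pmatrix}1&-1&-1&-1\\-1&1&-1&-1\\-1&-1&1&-1\\-1&-1&-1&1\end{pmatrix}.$$ A cusp of a surface means an isolated surface singularity of type $A_2$, i.e. a singular point at which the surface is locally analytically equivalent to $\{(a,b,c)\in\mathbb{C}^3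 : a^2+b^2+c^3=0\}$ at the origin. *)

(* Defs.v *)
From HB Require Import structures.
From mathcomp Require Import all_boot all_order all_algebra.
From mathcomp Require Import all_classical all_reals.
From mathcomp Require Import topology normedtype derive.
From mathcomp Require Import complex.
(* The notations of mpoly clash with those of the analysis library. *)
From mathcomp Require Import -(notations) mpoly.
Set Implicit Arguments.
Unset Strict Implicit.
Unset Printing Implicit Defensive.
Import Order.TTheory GRing.Theory Num.Theory.
Import numFieldNormedType.Exports.
Local Open Scope classical_set_scope.
Local Open Scope ring_scope.

Definition mx_of_rows (C : numClosedFieldType) (rows : seq (seq C)) : 'M[C]_4 :=
  \matrix_(i, j) nth 0 (nth [::] rows i) j.

Definition s1 (C : numClosedFieldType) : 'M[C]_4 := mx_of_rows
  [:: [:: 0; 1; 0; 0];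
      [:: 1; 0; 0; 0];
      [:: 0; 0; 1; 0];
      [:: 0; 0; 0; 1]].

Definition s2 (C : numClosedFieldType) : 'M[C]_4 := mx_of_rows
  [:: [:: 1; 0; 0; 0];
      [:: 0; 0; 1; 0];
      [:: 0; 1; 0; 0];
      [:: 0; 0; 0; 1]].

Definition s3 (C : numClosedFieldType) : 'M[C]_4 := mx_of_rows
  [:: [:: 0; - 'i; 0; 0];
      [:: 'i; 0; 0; 0];
      [:: 0; 0; 1; 0];
      [:: 0; 0; 0; 1]].

Definition s4 (C : numClosedFieldType) : 'M[C]_4 := 2^-1 *: mx_of_rows
  [:: [:: 1; -1; -1; -1];
      [:: -1; 1; -1; -1];
      [:: -1; -1; 1; -1];
      [:: -1; -1; -1; 1]].

Inductive generated (C : numClosedFieldType) (S : set 'M[C]_4) : set 'M[C]_4 :=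
| generated_gen g : S g -> generated S g
| generated_one : generated S 1%:M
| generated_mul g h : generated S g -> generated S h -> generated S (g *m h)
| generated_inv g : generated S g -> generated S (invmx g).

Definition G29 (C : numClosedFieldType) : set 'M[C]_4 :=
  generated [set g | g \in [:: s1 C; s2 C; s3 C; s4 C]].
Arguments G29 C _ : clear implicits.

Definition evalp (C : numClosedFieldType) (F : mpoly 4 C) (v : 'cV[C]_4) : C :=
  meval (fun j => v j 0) F.

(* (g . F)(v) = F (g^-1 v) *)
Definition poly_act (C : numClosedFieldType) (g : 'M[C]_4) (F : mpoly 4 C) :
    mpoly 4 C :=
  comp_mpoly [tuple \sum_j invmx g k j *: mpolyX C (mnm1 j) | k < 4] F.

Definition poly_invariant (C : numClosedFieldType) (G : set 'M[C]_4)
    (F : mpoly 4 C) : Prop :=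
  forall g, G g -> poly_act g F = F.

(* The points of P(V) are the lines of V. *)
Definition proj_space (C : numClosedFieldType) : set {vspace 'cV[C]_4} :=
  [set L : {vspace 'cV[C]_4} | \dim L = 1%N].
Arguments proj_space C _ : clear implicits.

Definition zero_locus (C : numClosedFieldType) (F : mpoly 4 C) :
    set {vspace 'cV[C]_4} :=
  proj_space C `&` [set L : {vspace 'cV[C]_4} | forall v, v \in L -> evalp F v = 0].

Definition proj_act (C : numClosedFieldType) (g : 'M[C]_4)
    (L : {vspace 'cV[C]_4}) : {vspace 'cV[C]_4} :=
  (linfun (mulmx g) @: L)%VS.

Definition proj_orbit (C : numClosedFieldType) (G : set 'M[C]_4)
    (L : {vspace 'cV[C]_4}) : set {vspace 'cV[C]_4} :=
  [set proj_act g L | g in G].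

(* The inverse of the standard affine chart x_i <> 0 of P(V): the point of C^3
   is completed by a coordinate 1 at position i. *)
Definition chart_vec (C : numClosedFieldType) (i : 'I_4) (a : 'cV[C]_3) :
    'cV[C]_4 :=
  \col_j if unlift i j is Some k then a k 0 else 1.

Definition chart (C : numClosedFieldType) (i : 'I_4) (a : 'cV[C]_3) :
    {vspace 'cV[C]_4} :=
  <[chart_vec i a]>%VS.

(* Analytic equivalence of the germs (X, a) and (Y, b): a biholomorphism
   between open neighbourhoods of a and b that takes a to b and X to Y. Here
   differentiability is over C, so on an open set it means holomorphy. *)
Definition analytically_equivalent (C : numClosedFieldType)
    (X : set 'cV[C]_3) (a : 'cV[C]_3) (Y : set 'cV[C]_3) (b : 'cV[C]_3) : Prop :=
  exists (U W : set 'cV[C]_3) (phi psi : 'cV[C]_3 -> 'cV[C]_3),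
    [/\ [/\ open U, open W, U a, W b & phi a = b],
        forall u, U u -> W (phi u) /\ psi (phi u) = u,
        forall w, W w -> U (psi w) /\ phi (psi w) = w,
        (forall u, U u -> differentiable phi u) /\
        (forall w, W w -> differentiable psi w) &
        forall u, U u -> (X u <-> Y (phi u))].

Definition A2_surface (C : numClosedFieldType) : set 'cV[C]_3 :=
  [set a | a 0 0 ^+ 2 + a 1 0 ^+ 2 + a 2 0 ^+ 3 = 0].
Arguments A2_surface C _ : clear implicits.

Definition singular_locus (C : numClosedFieldType) (F : mpoly 4 C) :
    set {vspace 'cV[C]_4} :=
  zero_locus F `&`
  [set L : {vspace 'cV[C]_4} | forall v, v \in L -> forall j, evalp (mderiv j F) v = 0].

Definition cusps (C : numClosedFieldType) (F : mpoly 4 C) :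
    set {vspace 'cV[C]_4} :=
  singular_locus F `&`
  [set L : {vspace 'cV[C]_4} | exists (i : 'I_4) (a : 'cV[C]_3), L = chart i a /\
     analytically_equivalent (chart i @^-1` zero_locus F) a (A2_surface C) 0].

(* Main.v *)
(* The form F is a polynomial in the elementary symmetric functions of x^4, y^4, z^4, t^4 and
   in xyzt, with coefficients in Q(sqrt 3), invariant under G29. By Euler's identity its
   singular points are the common zeros of the partial derivatives. At such a point the fourth
   powers of the coordinates are roots of one cubic polynomial, hence two of them coincide, and
   the group moves the point to a point (1 : 1 : z : t) or (0 : 0 : z : t). Elimination then
   leaves one orbit of singular points, that of (1 : 1 : 1 : c) with c^2 = (3 + r) c + r, where
   r = sqrt 3.

   That point is a cusp because of its stabilizer S_3. In the affine chart t = 1 let m be the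
   mean of the coordinates and xi, eta the eigencoordinates of the cyclic permutation. The
   equation is a function of m, u = xi eta and w = xi^3 + eta^3 only, of the form
   (m - 1/c)^3 e + u g1 + w g2 with e and g1 invertible at the cusp. The sum u g1 + w g2
   factors as h (xi + a eta^2) (eta + a xi^2), where a is given by a square root, and the
   inverse function theorem turns the factors and m - 1/c into coordinates of an A_2
   singularity. The other points of the orbit are cusps since the group acts by projective
   transformations, which are biholomorphic in the affine charts.

   The orbit is counted by an enumeration in exact arithmetic over Z[r, c, i]; distinct elements
   of this ring have distinct complex values since r is irrational and the norm of
   (3 + r)^2 + 4 r is negative. *)
Require Import Defs.
From HB Require Import structures.
From Stdlib Require Import BinInt.
From mathcomp Require Import all_boot all_order all_algebra ring lra zify ssrZ.
From mathcomp Require Import all_classical all_reals.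
From mathcomp Require Import interval_inference topology normedtype sequences derive landau.
From mathcomp Require Import complex.
From mathcomp Require Import -(notations) mpoly.
Set Implicit Arguments.
Unset Strict Implicit.
Unset Printing Implicit Defensive.
Import Order.TTheory GRing.Theory Num.Theory.
Import numFieldNormedType.Exports.
Local Open Scope classical_set_scope.
Local Open Scope ring_scope.

(** * The invariant forms of degree 12 *)

(** The group has order 7680 and contains four scalars, and 320 = 7680 / (4 * 6), whence a
    stabilizer of order 6 modulo scalars. The basic invariants have degrees 4, 8, 12, 20, so the
    invariants of degree 12 form a space of dimension 3. On the line of the points (1 : 1 : 1 : t),
    fixed by the permutations of x, y, z, the derivatives in x, y, z agree. By Euler's identity a
    double root of the restricted form is therefore already a singular point, and a triple root
    makes it degenerate along the line. A triple root at an unknown t puts three conditions on two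
    projective parameters and t, which explains the quadratic irrationalities r and c. A cusp is
    defined by a biholomorphism and not by a condition on jets, so the normal form has to be exact
    on a neighbourhood. The symmetry in xi and eta makes an explicit one possible, with one square
    root as its only transcendental ingredient beyond the inverse function theorem. *)

Section Form.
Variable K : comNzRingType.
Implicit Types r x y z t A B E D : K.

(* The value r = sqrt 3 is the one for which the restriction of form12 to the line of the
   points (1 : 1 : 1 : t) contains the cube of a quadratic polynomial (form12_111t). *)
Definition Phi r A B E D : K :=
  3456 * E - 72 * (3 + r) * A * B + 864 * (r - 1) * B * D
  + (5 - 3 * r) * A ^+ 3 + 36 * (7 - r) * A ^+ 2 * D
  + 288 * (12 + r) * A * D ^+ 2 + 3456 * (1 + 2 * r) * D ^+ 3.

(** [PhiA], [PhiB], [PhiD] are the partial derivatives of [Phi]; the one in E is the constant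
    3456. *)
Definition PhiA r A B D : K :=
  - 72 * (3 + r) * B + 3 * (5 - 3 * r) * A ^+ 2 + 72 * (7 - r) * A * D
  + 288 * (12 + r) * D ^+ 2.

Definition PhiB r A D : K := - 72 * (3 + r) * A + 864 * (r - 1) * D.

Definition PhiD r A B D : K :=
  864 * (r - 1) * B + 36 * (7 - r) * A ^+ 2 + 576 * (12 + r) * A * D
  + 10368 * (1 + 2 * r) * D ^+ 2.

Definition esym1 x y z t : K := x + y + z + t.
Definition esym2 x y z t : K :=
  x * y + x * z + x * t + y * z + y * t + z * t.
Definition esym3 x y z t : K :=
  x * y * z + x * y * t + x * z * t + y * z * t.

Definition form12 r x y z t : K :=
  Phi r (esym1 (x ^+ 4) (y ^+ 4) (z ^+ 4) (t ^+ 4))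
        (esym2 (x ^+ 4) (y ^+ 4) (z ^+ 4) (t ^+ 4))
        (esym3 (x ^+ 4) (y ^+ 4) (z ^+ 4) (t ^+ 4)) (x * y * z * t).

(* The partial derivative in x; the other ones are obtained by permuting the variables. *)
Definition dform12 r x y z t : K :=
  let A := esym1 (x ^+ 4) (y ^+ 4) (z ^+ 4) (t ^+ 4) in
  let B := esym2 (x ^+ 4) (y ^+ 4) (z ^+ 4) (t ^+ 4) in
  let D := x * y * z * t in
  4 * x ^+ 3 * (PhiA r A B D + PhiB r A D * (y ^+ 4 + z ^+ 4 + t ^+ 4)
     + 3456 * (y ^+ 4 * z ^+ 4 + y ^+ 4 * t ^+ 4 + z ^+ 4 * t ^+ 4))
  + PhiD r A B D * (y * z * t).

Lemma form12_swap12 r x y z t : form12 r y x z t = form12 r x y z t.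
Proof. rewrite /form12 /Phi /esym1 /esym2 /esym3; ring. Qed.

Lemma form12_swap23 r x y z t : form12 r x z y t = form12 r x y z t.
Proof. rewrite /form12 /Phi /esym1 /esym2 /esym3; ring. Qed.

Lemma form12_s3 i r x y z t : i ^+ 2 = -1 ->
  form12 r (- i * y) (i * x) z t = form12 r x y z t.
Proof.
move=> hi; have hi4 : i ^+ 4 = 1 by ring: hi.
rewrite /form12 !exprMn (_ : (- i) ^+ 4 = 1) ?hi4 ?mul1r; last by ring: hi.
rewrite (_ : _ * z * t = x * y * z * t); last by ring: hi.
rewrite /Phi /esym1 /esym2 /esym3; ring.
Qed.

(** The identity holds for every [r], so the invariant forms come in a pencil. All coordinates are
    doubled to avoid dividing by 2 in an arbitrary ring. *)
Lemma form12_s4 r x y z t : let s := x + y + z + t in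
  form12 r (2 * x - s) (2 * y - s) (2 * z - s) (2 * t - s) =
  form12 r (2 * x) (2 * y) (2 * z) (2 * t).
Proof. by move=> s; rewrite /s /form12 /Phi /esym1 /esym2 /esym3; ring. Qed.

Lemma form12_scale r l x y z t :
  form12 r (l * x) (l * y) (l * z) (l * t) = l ^+ 12 * form12 r x y z t.
Proof. rewrite /form12 /Phi /esym1 /esym2 /esym3; ring. Qed.

Lemma dform12_scale r l x y z t :
  dform12 r (l * x) (l * y) (l * z) (l * t) = l ^+ 11 * dform12 r x y z t.
Proof. rewrite /dform12 /PhiA /PhiB /PhiD /esym1 /esym2; ring. Qed.

Lemma dform12_swap34 r x y z t : dform12 r x y t z = dform12 r x y z t.
Proof. rewrite /dform12 /PhiA /PhiB /PhiD /esym1 /esym2; ring. Qed.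

Lemma form12_euler r x y z t :
  12 * form12 r x y z t =
  x * dform12 r x y z t + y * dform12 r y x z t + z * dform12 r z x y t
  + t * dform12 r t x y z.
Proof.
rewrite /form12 /dform12 /Phi /PhiA /PhiB /PhiD /esym1 /esym2 /esym3; ring.
Qed.

Definition critical r x y z t :=
  [/\ dform12 r x y z t = 0, dform12 r y x z t = 0,
      dform12 r z x y t = 0 & dform12 r t x y z = 0].

End Form.

(** The form over a polynomial ring is the polynomial itself, and evaluation and substitution are
    ring morphisms; hence the definition over all commutative rings. *)
Lemma rmorph_form12 (K K' : comNzRingType) (f : {rmorphism K -> K'}) r x y z t :
  f (form12 r x y z t) = form12 (f r) (f x) (f y) (f z) (f t).
Proof. rewrite /form12 /Phi /esym1 /esym2 /esym3; ring. Qed.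

Lemma rmorph_dform12 (K K' : comNzRingType) (f : {rmorphism K -> K'}) r x y z t :
  f (dform12 r x y z t) = dform12 (f r) (f x) (f y) (f z) (f t).
Proof. rewrite /dform12 /PhiA /PhiB /PhiD /esym1 /esym2; ring. Qed.

(** * Partial derivatives by abstract derivations *)

Section Derivation.
Variables (K : comNzRingType) (d : K -> K).
Hypothesis dD : {morph d : a b / a + b}.
Hypothesis dM : forall a b, d (a * b) = d a * b + a * d b.

Lemma derivation0 : d 0 = 0.
Proof. by apply: (addIr (d 0)); rewrite -dD !add0r. Qed.

Lemma derivationN a : d (- a) = - d a.
Proof. by apply: (addIr (d a)); rewrite -dD !addNr derivation0. Qed.

Lemma derivation_nat n : d n%:R = 0.
Proof.
have d1 : d 1 = 0.
  by apply: (addIr (d 1)); rewrite add0r -{3}(mulr1 1) dM mulr1 mul1r.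
by elim: n => [|n IHn]; rewrite ?derivation0 // -natr1 dD IHn d1 addr0.
Qed.

Lemma derivationX a n : d (a ^+ n) = n%:R * a ^+ n.-1 * d a.
Proof.
elim: n => [|n IHn]; first by rewrite expr0 (derivation_nat 1) !mul0r.
rewrite exprS dM IHn -natr1 /=; case: n {IHn} => [|n]; rewrite ?expr0 /=.
  by ring.
rewrite exprS; ring.
Qed.

Let d_simp := (dD, derivationN, dM, derivationX).

Lemma derivation_Phi r A B E D : d r = 0 ->
  d (Phi r A B E D) =
  PhiA r A B D * d A + PhiB r A D * d B + 3456 * d E + PhiD r A B D * d D.
Proof.
(* The coefficients of [Phi] are abstracted to constants of [d], so that the Leibniz rule is not
   unfolded inside them. *)
have gen a1 a2 a3 a4 a5 a6 a7 :
    d a1 = 0 -> d a2 = 0 -> d a3 = 0 -> d a4 = 0 -> d a5 = 0 -> d a6 = 0 ->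
    d a7 = 0 ->
    d (a7 * E - a5 * A * B + a6 * B * D + a1 * A ^+ 3 + a2 * A ^+ 2 * D
       + a3 * A * D ^+ 2 + a4 * D ^+ 3) =
    (- a5 * B + 3 * a1 * A ^+ 2 + 2 * a2 * A * D + a3 * D ^+ 2) * d A
    + (- a5 * A + a6 * D) * d B + a7 * d E
    + (a6 * B + a2 * A ^+ 2 + 2 * a3 * A * D + 3 * a4 * D ^+ 2) * d D.
  move=> k1 k2 k3 k4 k5 k6 k7.
  by rewrite !d_simp k1 k2 k3 k4 k5 k6 k7 /=; ring.
move=> dr; have dn := derivation_nat.
have dr1 n : d (n%:R + r) = 0 by rewrite dD dn dr addr0.
have dr2 n : d (r - n%:R) = 0 by rewrite dD derivationN dn dr oppr0 addr0.
have dr3 n : d (n%:R - r) = 0 by rewrite dD derivationN dn dr oppr0 addr0.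
have dr4 n : d (n%:R * r) = 0 by rewrite dM dn dr mul0r mulr0 addr0.
have dr5 m n : d (m%:R - n%:R * r) = 0.
  by rewrite dD derivationN dn dr4 oppr0 addr0.
have dr6 m n : d (m%:R + n%:R * r) = 0 by rewrite dD dn dr4 addr0.
have dnM n a : d a = 0 -> d (n%:R * a) = 0.
  by move=> da; rewrite dM dn da mul0r mulr0 addr0.
rewrite /Phi gen.
- rewrite /PhiA /PhiB /PhiD; ring.
- exact: dr5.
- exact/dnM/dr3.
- exact/dnM/dr1.
- exact/dnM/(dr6 1).
- exact/dnM/dr1.
- exact/dnM/(dr2 1).
- exact: dn.
Qed.

Lemma derivation_form12 r x y z t : d r = 0 ->
  d (form12 r x y z t) =
  dform12 r x y z t * d x + dform12 r y x z t * d y + dform12 r z x y t * d z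
  + dform12 r t x y z * d t.
Proof.
move=> dr; rewrite /form12 derivation_Phi // /esym1 /esym2 /esym3 !d_simp /=.
rewrite /dform12 /PhiA /PhiB /PhiD /esym1 /esym2; ring.
Qed.

End Derivation.

(** * The group and its action on polynomials *)

Section Group.
Variable C : numClosedFieldType.
Implicit Types (g h : 'M[C]_4) (v w : 'cV[C]_4).

Definition vec (x y z t : C) : 'cV[C]_4 := \col_j nth 0 [:: x; y; z; t] j.

Lemma vecE v : v = vec (v 0 0) (v 1 0) (v 2 0) (v 3 0).
Proof.
apply/colP => j; rewrite mxE.
by case: j => [] [|[|[|[|//]]]] Hj /=; congr (v _ _); apply: val_inj.
Qed.

Lemma scale_vec l x y z t :
  l *: vec x y z t = vec (l * x) (l * y) (l * z) (l * t).
Proof. by apply/colP=> j; rewrite !mxE; case: j => [] [|[|[|[|//]]]]. Qed.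

Lemma vec_inj x y z t x' y' z' t' :
  vec x y z t = vec x' y' z' t' -> [/\ x = x', y = y', z = z' & t = t'].
Proof.
move=> /colP e; split.
- by have := e 0; rewrite !mxE.
- by have := e 1; rewrite !mxE.
- by have := e 2; rewrite !mxE.
- by have := e 3; rewrite !mxE.
Qed.

Lemma s1_vec x y z t : s1 C *m vec x y z t = vec y x z t.
Proof.
apply/colP=> j; rewrite !mxE !big_ord_recl big_ord0 !mxE /=.
by case: j => [] [|[|[|[|//]]]] Hj /=; ring.
Qed.

Lemma s2_vec x y z t : s2 C *m vec x y z t = vec x z y t.
Proof.
apply/colP=> j; rewrite !mxE !big_ord_recl big_ord0 !mxE /=.
by case: j => [] [|[|[|[|//]]]] Hj /=; ring.
Qed.

Lemma s3_vec x y z t : s3 C *m vec x y z t = vec (- 'i * y) ('i * x) z t.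
Proof.
apply/colP=> j; rewrite !mxE !big_ord_recl big_ord0 !mxE /=.
by case: j => [] [|[|[|[|//]]]] Hj /=; ring.
Qed.

Lemma s4_vec x y z t : let s := (x + y + z + t) / 2 in
  s4 C *m vec x y z t = vec (x - s) (y - s) (z - s) (t - s).
Proof.
move=> s; apply/colP=> j; rewrite !mxE !big_ord_recl big_ord0 !mxE /=.
by case: j => [] [|[|[|[|//]]]] Hj /=; rewrite /s; field.
Qed.

Lemma mx_vec_eq g h :
  (forall x y z t, g *m vec x y z t = h *m vec x y z t) -> g = h.
Proof.
move=> e; apply/matrixP => i j; have {e} e v : g *m v = h *m v.
  by rewrite (vecE v).
by have /colP/(_ i) := e (delta_mx j 0); rewrite -!colE !mxE.
Qed.

Lemma s1_invol : s1 C *m s1 C = 1%:M.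
Proof. by apply: mx_vec_eq => x y z t; rewrite -mulmxA !s1_vec mul1mx. Qed.

Lemma s2_invol : s2 C *m s2 C = 1%:M.
Proof. by apply: mx_vec_eq => x y z t; rewrite -mulmxA !s2_vec mul1mx. Qed.

Lemma s3_invol : s3 C *m s3 C = 1%:M.
Proof.
have hi := sqrCi C.
apply: mx_vec_eq => x y z t; rewrite -mulmxA !s3_vec mul1mx.
by congr vec; ring: hi.
Qed.

Lemma s4_invol : s4 C *m s4 C = 1%:M.
Proof.
apply: mx_vec_eq => x y z t; rewrite -mulmxA !s4_vec mul1mx.
by congr vec; field.
Qed.

(** Invertibility is carried along because the composition rules of [poly_act] and [invmx] are
    stated for invertible matrices. *)
Lemma G29_ind (P : 'M[C]_4 -> Prop) :
    P 1%:M ->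
    (forall g h, g \in unitmx -> h \in unitmx -> P g -> P h -> P (g *m h)) ->
    (forall g, g \in unitmx -> P g -> P (invmx g)) ->
    P (s1 C) -> P (s2 C) -> P (s3 C) -> P (s4 C) ->
  forall g, G29 C g -> g \in unitmx /\ P g.
Proof.
move=> P1 PM PV p1 p2 p3 p4 g; elim=> {g} [g /=|| g h _ [ug Pg] _ [uh Ph]|g _ [ug Pg]].
- rewrite !inE => /or4P[] /eqP->; split=> //.
  + by case/mulmx1_unit: s1_invol.
  + by case/mulmx1_unit: s2_invol.
  + by case/mulmx1_unit: s3_invol.
  + by case/mulmx1_unit: s4_invol.
- by split=> //; exact: unitmx1.
- by rewrite unitmx_mul ug uh; split=> //; exact: PM.
- by rewrite unitmx_inv ug; split=> //; exact: PV.
Qed.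

Lemma G29_unit g : G29 C g -> g \in unitmx.
Proof. by move=> gG; case: (@G29_ind (fun=> True) I _ _ I I I I g gG). Qed.

Lemma invmx_invol g : g *m g = 1%:M -> invmx g = g.
Proof.
move=> gg; have [ug _] := mulmx1_unit gg.
by rewrite -[LHS]mulmx1 -gg mulmxA mulVmx // mul1mx.
Qed.

Lemma invmx_mul g h : g \in unitmx -> h \in unitmx ->
  invmx (g *m h) = invmx h *m invmx g.
Proof.
move=> ug uh; have ugh : g *m h \in unitmx by rewrite unitmx_mul ug.
apply: (can_inj (mulmxK ugh)).
by rewrite mulVmx // -mulmxA (mulmxA _ g) mulVmx // mul1mx mulVmx.
Qed.

Lemma G29_s1 : G29 C (s1 C). Proof. by apply: generated_gen; rewrite /= !inE eqxx. Qed.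
Lemma G29_s2 : G29 C (s2 C). Proof. by apply: generated_gen; rewrite /= !inE eqxx !orbT. Qed.
Lemma G29_s3 : G29 C (s3 C). Proof. by apply: generated_gen; rewrite /= !inE eqxx !orbT. Qed.
Lemma G29_s4 : G29 C (s4 C). Proof. by apply: generated_gen; rewrite /= !inE eqxx !orbT. Qed.

(* v and w span lines in the same orbit of the projective space *)
Definition pconj v w := exists g l, [/\ G29 C g, l != 0 & w = l *: (g *m v)].

Lemma pconj_refl v : pconj v v.
Proof. by exists 1%:M, 1; rewrite oner_neq0 mul1mx scale1r; split=> //; apply: generated_one. Qed.

Lemma pconj_sym v w : pconj v w -> pconj w v.
Proof.
move=> [g [l [gG l0 ->]]]; exists (invmx g), l^-1; rewrite invr_eq0.
split=> //; first exact: generated_inv.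
by rewrite -scalemxAr scalerA mulVf // scale1r mulmxA mulVmx ?mul1mx ?scale1r // G29_unit.
Qed.

Lemma pconj_trans u v w : pconj u v -> pconj v w -> pconj u w.
Proof.
move=> [g [l [gG l0 ->]]] [h [m [hG m0 ->]]]; exists (h *m g), (m * l).
rewrite mulf_neq0 //; split=> //; first exact: generated_mul.
by rewrite -scalemxAr scalerA mulmxA.
Qed.

Lemma pconj_scale l v : l != 0 -> pconj v (l *: v).
Proof. by move=> l0; exists 1%:M, l; rewrite mul1mx; split=> //; apply: generated_one. Qed.

Lemma pconj_act g v : G29 C g -> pconj v (g *m v).
Proof. by move=> gG; exists g, 1; rewrite scale1r oner_neq0. Qed.

End Group.

Section MPoly.
Variable C : numClosedFieldType.
Implicit Types (g h : 'M[C]_4) (v w : 'cV[C]_4) (F : mpoly 4 C).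

Lemma mpoly_closed_ind n (P : mpoly n C -> Prop) :
  (forall c, P (mpolyC n c)) -> (forall i, P (mpolyX C (mnm1 i))) ->
  (forall p q, P p -> P q -> P (p + q)) ->
  (forall p q, P p -> P q -> P (p * q)) -> forall p, P p.
Proof.
move=> PC PX PD PM; have PXn p k : P p -> P (p ^+ k).
  by move=> Pp; elim: k => [|k IHk]; rewrite ?exprS; [exact: (PC 1)|exact: PM].
elim/mpolyind => [|c m p _ _ IHp]; first exact: (PC 0).
apply: PD => //; rewrite -mul_mpolyC; apply: (PM) => //.
rewrite mpolyXE_id; apply: (big_ind P) => [||i _]; [exact: (PC 1)|exact: PM|].
exact/PXn/PX.
Qed.

Lemma mderivXU n (i j : 'I_n) :
  mderiv j (mpolyX C (mnm1 i)) = (i == j)%:R.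
Proof.
rewrite mderivX mnm1E; case: eqP => [->|_]; last by rewrite scale0r.
have := addmK (mnm1 j) mnm0; rewrite add0m => ->.
by rewrite mpolyX0 scale1r.
Qed.

Lemma mderiv_comp_mpoly (lq : 4.-tuple (mpoly 4 C)) F j :
  mderiv j (comp_mpoly lq F) =
  \sum_(k < 4) comp_mpoly lq (mderiv k F) * mderiv j (tnth lq k).
Proof.
elim/mpoly_closed_ind: F => [c|i|p q IHp IHq|p q IHp IHq].
- rewrite comp_mpolyC mderivC big1 // => k _.
  by rewrite mderivC raddf0 mul0r.
- rewrite comp_mpolyXU -tnth_nth (bigD1 i) //= big1 => [|k ki].
    by rewrite mderivXU eqxx rmorph1 mul1r addr0.
  by rewrite mderivXU eq_sym (negbTE ki) raddf0 mul0r.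
- rewrite !raddfD /= IHp IHq -big_split; apply: eq_bigr => k _.
  by rewrite !raddfD mulrDl.
- rewrite rmorphM /= mderivM IHp IHq mulr_suml mulr_sumr -big_split /=.
  by apply: eq_bigr => k _; rewrite mderivM raddfD /= !rmorphM /=; ring.
Qed.

Lemma comp_mpoly_comp (lp lq : 4.-tuple (mpoly 4 C)) F :
  comp_mpoly lp (comp_mpoly lq F) =
  comp_mpoly [tuple comp_mpoly lp (tnth lq k) | k < 4] F.
Proof.
elim/mpoly_closed_ind: F => [c|i|p q IHp IHq|p q IHp IHq].
- by rewrite !comp_mpolyC.
- by rewrite !comp_mpolyXU -!tnth_nth tnth_mktuple.
- by rewrite !raddfD /= IHp IHq.
- by rewrite !rmorphM /= IHp IHq.
Qed.

Lemma poly_act1 F : poly_act 1%:M F = F.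
Proof.
rewrite /poly_act -[RHS](comp_mpoly_id F); congr comp_mpoly.
apply: eq_from_tnth => k; rewrite !tnth_mktuple (bigD1 k) //= big1.
  by rewrite invmx1 mxE eqxx scale1r addr0.
by move=> j jk; rewrite invmx1 mxE eq_sym (negbTE jk) scale0r.
Qed.

Lemma poly_actM g h F : g \in unitmx -> h \in unitmx ->
  poly_act (g *m h) F = poly_act g (poly_act h F).
Proof.
move=> ug uh; rewrite /poly_act comp_mpoly_comp; congr comp_mpoly.
apply: eq_from_tnth => k; rewrite !tnth_mktuple.
rewrite invmx_mul // raddf_sum /=.
under [RHS]eq_bigr do rewrite linearZ /= comp_mpolyXU -tnth_nth tnth_mktuple scaler_sumr.
rewrite exchange_big /=; apply: eq_bigr => j _.
rewrite mxE scaler_suml; apply: eq_bigr => l _.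
by rewrite scalerA.
Qed.

(** The chain rule applied to F = F o g^-1 expresses each derivative at [g *m v] as a combination of
    the derivatives at [v]. *)
Lemma poly_act_grad g F v j : g \in unitmx -> poly_act g F = F ->
  (forall k, evalp (mderiv k F) v = 0) -> evalp (mderiv j F) (g *m v) = 0.
Proof.
move=> ug Fg Fv; rewrite -Fg mderiv_comp_mpoly /evalp rmorph_sum big1 //= => k _.
rewrite rmorphM /= comp_mpoly_meval.
rewrite (_ : meval _ (mderiv k F) = 0) ?mul0r // -[RHS](Fv k).
apply: meval_eq => l; rewrite tnth_mktuple rmorph_sum /=.
under eq_bigr do rewrite mevalZ mevalXU.
by have /colP/(_ l) := mulKmx ug v; rewrite [in LHS]mxE.
Qed.

Lemma evalp_poly_act g F v : g \in unitmx ->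
  evalp (poly_act g F) (g *m v) = evalp F v.
Proof.
move=> ug; rewrite /evalp comp_mpoly_meval.
apply: meval_eq => l; rewrite tnth_mktuple rmorph_sum /=.
under eq_bigr do rewrite mevalZ mevalXU.
by have /colP/(_ l) := mulKmx ug v; rewrite [in LHS]mxE.
Qed.

Local Notation "''x_' i" := (mpolyX C (mnm1 (i : 'I_4))) (at level 8, i at level 2).

Definition form12_mpoly (r : C) : mpoly 4 C :=
  form12 (mpolyC 4 r) 'x_0 'x_1 'x_2 'x_3.

Lemma evalp_form12 r x y z t :
  evalp (form12_mpoly r) (vec x y z t) = form12 r x y z t.
Proof.
rewrite /evalp /form12_mpoly (rmorph_form12 (meval _)) /= mevalC !mevalXU.
by rewrite !mxE.
Qed.

Lemma evalp_mderiv_form12 r j x y z t :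
  evalp (mderiv j (form12_mpoly r)) (vec x y z t) =
  nth 0 [:: dform12 r x y z t; dform12 r y x z t; dform12 r z x y t;
            dform12 r t x y z] j.
Proof.
rewrite /evalp /form12_mpoly (derivation_form12 (d := mderiv j)); last first.
- exact: mderivC.
- by move=> a b; rewrite mderivM.
- exact: raddfD.
rewrite !rmorphD !rmorphM /= !(rmorph_dform12 (meval _)) /= mevalC !mevalXU.
have dX k : meval (fun j => vec x y z t j 0) (mderiv j 'x_k) = (k == j)%:R.
  by rewrite mderivXU rmorph_nat.
rewrite !dX !mxE /=.
by case: j {dX} => [] [|[|[|[|//]]]] Hj /=; rewrite /eq_op /=; ring.
Qed.

Lemma form12_mpoly_homog r : form12_mpoly r \is ishomog1 12 mdeg.
Proof.
pose H d (p : mpoly 4 C) := p \is ishomog1 d mdeg.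
have HM d e p q : H d p -> H e q -> H (d + e)%N (p * q) by exact: dhomogM.
have HX d k p : H d p -> H (d * k)%N (p ^+ k) by move=> ?; exact: dhomogMn.
have HD d p q : H d p -> H d q -> H d (p + q) by move=> ? ?; exact: rpredD.
have HN d p : H d p -> H d (- p) by move=> ?; rewrite /H rpredN.
have Hc c : H 0%N (mpolyC 4 c).
  by rewrite /H -[mpolyC 4 c]mulr1 mul_mpolyC; apply/rpredZ/dhomog1.
have Hn n : H 0%N n%:R by rewrite -(rmorph_nat (@mpolyC 4 C)); exact: Hc.
have HU i : H 4 ('x_i ^+ 4).
  by apply: (HX 1%N); rewrite /H dhomogX; apply/eqP/mdeg1.
have HU1 i : H 1%N 'x_i by rewrite /H dhomogX; apply/eqP/mdeg1.
rewrite /form12_mpoly /form12.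
have HA : H 4 (esym1 ('x_0 ^+ 4) ('x_1 ^+ 4) ('x_2 ^+ 4) ('x_3 ^+ 4)).
  by do !apply: (HD) => //.
have HB : H 8 (esym2 ('x_0 ^+ 4) ('x_1 ^+ 4) ('x_2 ^+ 4) ('x_3 ^+ 4)).
  by rewrite /esym2; do !apply: (HD); apply: (HM 4 4).
have HE : H 12 (esym3 ('x_0 ^+ 4) ('x_1 ^+ 4) ('x_2 ^+ 4) ('x_3 ^+ 4)).
  by rewrite /esym3; do !apply: (HD); apply: (HM 8 4) => //; apply: (HM 4 4).
have HDD : H 4 ('x_0 * 'x_1 * 'x_2 * 'x_3).
  by apply: (HM 3 1%N) => //; apply: (HM 2 1%N) => //; apply: (HM 1%N 1%N).
(* From here on only the degrees 4, 8, 12, 4 of the arguments of [Phi] matter. *)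
move: HA HB HE HDD; move: (esym1 _ _ _ _) (esym2 _ _ _ _) (esym3 _ _ _ _).
move: (_ * 'x_3) => D A B E HA HB HE HDD.
have HM0 d p q : H 0%N p -> H d q -> H d (p * q) by exact: (HM 0%N).
have Hr : H 0%N (mpolyC 4 r) by exact: Hc.
move: (mpolyC 4 r) Hr => R Hr; rewrite /Phi; do !apply: (HD).
- exact: HM0 (Hn _) HE.
- exact/HN/(HM 4 8 _ _ _ HB)/(HM0 _ _ _ _ HA)/(HM0 _ _ _ (Hn _))/(HD _ _ _ (Hn _)).
- apply: (HM 8 4 _ _ _ HDD); apply: (HM0 _ _ _ _ HB).
  exact/(HM0 _ _ _ (Hn _))/(HD _ _ _ Hr)/HN/(Hn 1).
- apply: (HM0 _ _ _ _ (HX 4 3 _ HA)).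
  exact/(HD _ _ _ (Hn _))/HN/(HM0 _ _ _ (Hn _)).
- apply: (HM 8 4 _ _ _ HDD); apply: (HM0 _ _ _ _ (HX 4 2 _ HA)).
  exact/(HM0 _ _ _ (Hn _))/(HD _ _ _ (Hn _))/HN.
- apply: (HM 4 8 _ _ _ (HX 4 2 _ HDD)); apply: (HM0 _ _ _ _ HA).
  exact/(HM0 _ _ _ (Hn _))/(HD _ _ _ (Hn _)).
- apply: (HM0 _ _ _ _ (HX 4 3 _ HDD)).
  exact/(HM0 _ _ _ (Hn _))/(HD _ _ _ (Hn 1))/(HM0 _ _ _ (Hn _)).
Qed.

Lemma poly_act_form12 r g a b c d :
  invmx g = g ->
  (forall k, (\sum_j g k j *: 'x_j) = nth 0 [:: a; b; c; d] k) ->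
  poly_act g (form12_mpoly r) = form12 (mpolyC 4 r) a b c d.
Proof.
move=> gi gE; rewrite /poly_act /form12_mpoly gi (rmorph_form12 (comp_mpoly _)) /=.
by rewrite comp_mpolyC !comp_mpolyXU -!tnth_nth !tnth_mktuple !gE.
Qed.

Lemma poly_act_fixM F g h : g \in unitmx -> h \in unitmx ->
  poly_act g F = F -> poly_act h F = F -> poly_act (g *m h) F = F.
Proof. by move=> ug uh Pg Ph; rewrite (poly_actM F ug uh) Ph Pg. Qed.

Lemma poly_act_fixV F g : g \in unitmx ->
  poly_act g F = F -> poly_act (invmx g) F = F.
Proof.
move=> ug Pg; have uV : invmx g \in unitmx by rewrite unitmx_inv.
have := poly_actM F uV ug; rewrite (mulVmx ug) poly_act1 => {2}->.
by rewrite Pg.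
Qed.

Lemma poly_invariant_gens F :
  poly_act (s1 C) F = F -> poly_act (s2 C) F = F -> poly_act (s3 C) F = F ->
  poly_act (s4 C) F = F -> poly_invariant (G29 C) F.
Proof.
move=> F1 F2 F3 F4 g gG.
exact: (G29_ind (P := fun g => poly_act g F = F) (poly_act1 F)
  (@poly_act_fixM F) (@poly_act_fixV F) F1 F2 F3 F4 gG).2.
Qed.

Lemma form12_mpoly_invariant r : poly_invariant (G29 C) (form12_mpoly r).
Proof.
apply: poly_invariant_gens.
- have gE k : \sum_j s1 C k j *: 'x_j = nth 0 [:: 'x_1; 'x_0; 'x_2; 'x_3] k.
    rewrite !big_ord_recl big_ord0 !mxE.
    by case: k => [] [|[|[|[|//]]]] Hk /=;
      rewrite !(scale1r, scale0r, addr0, add0r);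
      congr (mpolyX C (mnm1 _)); apply: val_inj.
  rewrite (poly_act_form12 r (invmx_invol (s1_invol C)) gE).
  exact: form12_swap12.
- have gE k : \sum_j s2 C k j *: 'x_j = nth 0 [:: 'x_0; 'x_2; 'x_1; 'x_3] k.
    rewrite !big_ord_recl big_ord0 !mxE.
    by case: k => [] [|[|[|[|//]]]] Hk /=;
      rewrite !(scale1r, scale0r, addr0, add0r);
      congr (mpolyX C (mnm1 _)); apply: val_inj.
  rewrite (poly_act_form12 r (invmx_invol (s2_invol C)) gE).
  exact: form12_swap23.
- pose I := mpolyC 4 ('i : C).
  have gE k : \sum_j s3 C k j *: 'x_j =
      nth 0 [:: - I * 'x_1; I * 'x_0; 'x_2; 'x_3] k.
    rewrite !big_ord_recl big_ord0 !mxE.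
    case: k => [] [|[|[|[|//]]]] Hk /=;
      rewrite !(scale1r, scale0r, addr0, add0r).
    + rewrite -mpolyCN mul_mpolyC; congr (_ *: mpolyX C (mnm1 _)).
      exact: val_inj.
    + by rewrite mul_mpolyC; congr (_ *: mpolyX C (mnm1 _)); apply: val_inj.
    + by congr (mpolyX C (mnm1 _)); apply: val_inj.
    + by congr (mpolyX C (mnm1 _)); apply: val_inj.
  rewrite (poly_act_form12 r (invmx_invol (s3_invol C)) gE).
  by apply: form12_s3; rewrite -rmorphXn /= sqrCi mpolyCN.
(* [form12_s4] is free of division; writing each variable as 2 (h x) with h = 1/2 brings the
   substitution into its shape. *)
- pose h := mpolyC 4 (2^-1 : C).
  pose s := h * 'x_0 + h * 'x_1 + h * 'x_2 + h * 'x_3.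
  have h2 p : p = 2 * (h * p).
    have := rmorph_nat (@mpolyC 4 C) 2 => <-.
    by rewrite mulrA -rmorphM /= divff ?pnatr_eq0 // mul1r.
  have gE k : \sum_j s4 C k j *: 'x_j =
      nth 0 [:: 2 * (h * 'x_0) - s; 2 * (h * 'x_1) - s; 2 * (h * 'x_2) - s;
                2 * (h * 'x_3) - s] k.
    rewrite !big_ord_recl big_ord0 !mxE.
    have -> : lift ord0 (lift ord0 (lift ord0 ord0)) = 3 :> 'I_4 by apply: val_inj.
    have -> : lift ord0 (lift ord0 ord0) = 2 :> 'I_4 by apply: val_inj.
    have -> : lift ord0 ord0 = 1 :> 'I_4 by apply: val_inj.
    by case: k => [] [|[|[|[|//]]]] Hk /=;
      rewrite !mulrN1 !mulr1 !scaleNr -!mul_mpolyC -/h /s; ring.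
  rewrite (poly_act_form12 r (invmx_invol (s4_invol C)) gE) form12_s4.
  by rewrite -!h2.
Qed.

Lemma form12_mpoly_neq0 r : 5 - 3 * r != 0 -> form12_mpoly r != 0.
Proof.
move=> r0; apply/eqP => F0; have := evalp_form12 r 1 0 0 0.
rewrite F0 /evalp raddf0 => /esym/eqP; apply/negP.
rewrite (_ : form12 _ _ _ _ _ = 5 - 3 * r) //.
by rewrite /form12 /Phi /esym1 /esym2 /esym3; ring.
Qed.

End MPoly.

(** * Critical points of the form *)

Section Moves.
Variable C : numClosedFieldType.
Implicit Types (x y z t : C).
Let hi := sqrCi C.

Lemma pconj_word (v w : 'cV[C]_4) (s : seq 'M[C]_4) :
  {subset s <= [:: s1 C; s2 C; s3 C; s4 C]} ->
  foldl (fun u g => g *m u) v s = w -> pconj v w.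
Proof.
elim: s v => [|g s IHs] v ss /= => [->|e]; first exact: pconj_refl.
apply: pconj_trans (IHs _ _ e) => [|h hs]; last by apply: ss; rewrite inE hs orbT.
by apply/pconj_act/generated_gen/ss; rewrite inE eqxx.
Qed.

Lemma pconj12 x y z t : pconj (vec x y z t) (vec y x z t).
Proof. by rewrite -(s1_vec x y z t); exact/pconj_act/G29_s1. Qed.

Lemma pconj23 x y z t : pconj (vec x y z t) (vec x z y t).
Proof. by rewrite -(s2_vec x y z t); exact/pconj_act/G29_s2. Qed.

(** This transposition is not a generator; it is the product of the word below, whose letters act
    from left to right. *)
Lemma pconj34 x y z t : pconj (vec x y z t) (vec x y t z).
Proof.
apply: (@pconj_word _ _ [:: s2 C; s1 C; s3 C; s1 C; s3 C; s2 C; s4 C; s3 C; s1 C;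
  s3 C; s2 C; s1 C; s4 C; s3 C; s1 C; s3 C; s2 C]).
  move=> g; rewrite !inE => /or4P[]; last move=> /or4P[]; last move=> /or4P[];
  last move=> /or4P[]; last move=> /or4P[]; last move=> /orP[]; move=> /eqP->; rewrite eqxx ?orbT //.
rewrite /= !(s1_vec, s2_vec, s3_vec, s4_vec).
by congr vec; field: hi.
Qed.

Lemma pconj_diag12 x y z t : pconj (vec x y z t) (vec ('i * x) (- 'i * y) z t).
Proof.
apply: pconj_trans (pconj_act _ (G29_s3 C)) _; rewrite s3_vec.
exact: pconj12.
Qed.

(** Since (-i)^n is the inverse of i^n, one coordinate can be multiplied by any fourth root of unity
    at the cost of its inverse on another one. *)
Lemma pconj_diag12n n x y z t :
  pconj (vec x y z t) (vec ('i ^+ n * x) ((- 'i) ^+ n * y) z t).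
Proof.
elim: n => [|n IHn]; first by rewrite !expr0 !mul1r; exact: pconj_refl.
apply: (pconj_trans IHn); rewrite !exprS -!mulrA; exact: pconj_diag12.
Qed.

Lemma pconj1324 x y z t : pconj (vec x y z t) (vec z t x y).
Proof.
apply: pconj_trans (pconj23 _ _ _ _) _.
apply: pconj_trans (pconj12 _ _ _ _) _.
apply: pconj_trans (pconj34 _ _ _ _) _.
exact: pconj23.
Qed.

Lemma pconj_diag34n n x y z t :
  pconj (vec x y z t) (vec x y ('i ^+ n * z) ((- 'i) ^+ n * t)).
Proof.
apply: pconj_trans (pconj1324 _ _ _ _) _.
apply: pconj_trans (pconj_diag12n n _ _ _ _) _.
exact: pconj1324.
Qed.

Lemma pconj_diag23n n x y z t :
  pconj (vec x y z t) (vec x ('i ^+ n * y) ((- 'i) ^+ n * z) t).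
Proof.
apply: pconj_trans (pconj34 _ _ _ _) _; apply: pconj_trans (pconj23 _ _ _ _) _.
apply: pconj_trans (pconj_diag34n n _ _ _ _) _.
apply: pconj_trans (pconj23 _ _ _ _) _; exact: pconj34.
Qed.

Lemma eq_expr4 x y : x ^+ 4 = y ^+ 4 -> exists n, x = 'i ^+ n * y.
Proof.
move=> e; have : (x - y) * (x + y) * (x - 'i * y) * (x + 'i * y) = 0.
  transitivity (x ^+ 4 - y ^+ 4); first by ring: hi.
  by rewrite e subrr.
move=> /eqP; rewrite !mulf_eq0 -!orbA => /or4P[] /eqP h.
- by exists 0%N; rewrite mul1r; apply/subr0_eq.
- by exists 2; rewrite hi mulN1r; apply/eqP; rewrite -addr_eq0 h.
- by exists 1%N; apply/subr0_eq.
- by exists 3; rewrite exprS hi; apply/subr0_eq; rewrite -[RHS]h; ring.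
Qed.

End Moves.

(** * Elimination on the loci with coinciding coordinates *)

Section Certificates.
Variables (C : numClosedFieldType) (r : C).
Hypothesis hr : r ^+ 2 = 3.

Lemma neq0_23 a b : 2 ^+ a * 3 ^+ b != 0 :> C.
Proof. by rewrite mulf_neq0 // expf_neq0 // pnatr_eq0. Qed.

(** The norm from Q(sqrt 3) reduces such inequalities to nonzero integers. *)
Lemma r_lin_neq0 (a b : C) : a ^+ 2 - 3 * b ^+ 2 != 0 -> a + b * r != 0.
Proof.
apply: contraNneq => e; rewrite (_ : _ - _ = (a + b * r) * (a - b * r)).
  by rewrite e mul0r.
ring: hr.
Qed.

Lemma cubic_four_roots (a b c d q1 q2 q3 q4 : C) : a != 0 ->
  (forall q, q \in [:: q1; q2; q3; q4] ->
    a * q ^+ 3 + b * q ^+ 2 + c * q + d = 0) -> ~~ uniq [:: q1; q2; q3; q4].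
Proof.
move=> a0 e; apply/negP => u; pose p : {poly C} := Poly [:: d; c; b; a].
have p0 : p != 0.
  apply/eqP => /(congr1 (fun q : {poly C} => q`_3)).
  by rewrite coef_Poly coef0 /=; apply/eqP.
have := max_poly_roots p0 _ u; rewrite ltnNge (leq_trans (size_Poly _)) //.
suff -> : all (root p) [:: q1; q2; q3; q4] by move=> /(_ isT).
apply/allP => q /e eq; apply/rootP; rewrite horner_Poly /= -[RHS]eq; ring.
Qed.

(* x dF/dx is a cubic polynomial in x^4 whose coefficients are symmetric in the variables,
   so the fourth powers of the coordinates of a critical point are roots of the same cubic. *)
Lemma critical_eq_expr4 x y z t : critical r x y z t ->
  ~~ uniq [:: x ^+ 4; y ^+ 4; z ^+ 4; t ^+ 4].
Proof.
case=> ex ey ez et.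
pose A := esym1 (x ^+ 4) (y ^+ 4) (z ^+ 4) (t ^+ 4).
pose B := esym2 (x ^+ 4) (y ^+ 4) (z ^+ 4) (t ^+ 4).
pose D := x * y * z * t.
have n0 : 13824 != 0 :> C.
  rewrite (_ : 13824 = 2 ^+ 9 * 3 ^+ 3); last by ring.
  exact: neq0_23.
apply: (@cubic_four_roots 13824
  (- 4 * (PhiB r A D + 3456 * A)) (4 * (PhiA r A B D + PhiB r A D * A + 3456 * B))
  (PhiD r A B D * D) _ _ _ _ n0) => q.
rewrite !inE => /or4P[] /eqP ->.
- rewrite -(mulr0 x) -ex /dform12 /A /B /D /esym1 /esym2.
  rewrite /PhiA /PhiB /PhiD; ring.
- rewrite -(mulr0 y) -ey /dform12 /A /B /D /esym1 /esym2.
  rewrite /PhiA /PhiB /PhiD; ring.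
- rewrite -(mulr0 z) -ez /dform12 /A /B /D /esym1 /esym2.
  rewrite /PhiA /PhiB /PhiD; ring.
- rewrite -(mulr0 t) -et /dform12 /A /B /D /esym1 /esym2.
  rewrite /PhiA /PhiB /PhiD; ring.
Qed.

Lemma critical_form12_eq0 x y z t : critical r x y z t -> form12 r x y z t = 0.
Proof.
case=> ex ey ez et; apply: (mulfI (_ : 12 != 0)); first by rewrite pnatr_eq0.
by rewrite form12_euler ex ey ez et !mulr0 !addr0.
Qed.

(* The squarefreeness of the three sextics below is certified by a Bezout relation between
   the polynomial and its derivative over Z[sqrt 3]. Large integers are written in base 1000,
   since a numeral n%:R contains n in unary form. *)
Lemma sextic_111t_sqfree t :
  (243 - 183 * r) + (162 - 144 * r) * t + (351 - 225 * r) * t ^+ 2 + (108 - 84 * r) * t ^+ 3 + (9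
    - 21 * r) * t ^+ 4 + (18 - 12 * r) * t ^+ 5 + (5 - 3 * r) * t ^+ 6 = 0 ->
  (162 - 144 * r) + (702 - 450 * r) * t + (324 - 252 * r) * t ^+ 2 + (36 - 84 * r) * t ^+ 3 + (90
    - 60 * r) * t ^+ 4 + (30 - 18 * r) * t ^+ 5 <> 0.
Proof.
set P := (X in X = 0 -> _); set Q := (X in X <> 0) => eP eQ.
have : ((- ((75 * 1000 + 552) * 1000 + 507) - ((48 * 1000 + 632) * 1000 + 931) * r) + (((17 *
  1000 + 648) * 1000 + 307) + (8585 * 1000 + 37) * r) * t + (- ((76 * 1000 + 343) * 1000 + 823) -
  ((44 * 1000 + 731) * 1000 + 917) * r) * t ^+ 2 + (- (9718 * 1000 + 65) - (6228 * 1000 + 927) *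
  r) * t ^+ 3 + (- (817 * 1000 + 20) - (665 * 1000 + 466) * r) * t ^+ 4) * P +
    ((((44 * 1000 + 143) * 1000 + 353) + ((26 * 1000 + 841) * 1000 + 582) * r) + (((23 * 1000 +
      993) * 1000 + 946) + ((16 * 1000 + 168) * 1000 + 497) * r) * t + ((2275 * 1000 + 704) +
      (1990 * 1000 + 776) * r) * t ^+ 2 + (((19 * 1000 + 766) * 1000 + 280) + ((11 * 1000 + 569)
      * 1000 + 524) * r) * t ^+ 3 + ((1990 * 1000 + 299) + (1272 * 1000 + 606) * r) * t ^+ 4 +
      ((136 * 1000 + 170) + (110 * 1000 + 911) * r) * t ^+ 5) * Q = 2 ^+ 11 * 3 ^+ 4 * 5 ^+ 1 * 7
      ^+ 1 * 11 ^+ 1 * 61 ^+ 1.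
  by rewrite /P /Q; ring: hr.
rewrite eP eQ !mulr0 addr0 => /esym/eqP; apply/negP.
by rewrite !mulf_neq0 ?expf_neq0 ?pnatr_eq0.
Qed.

Lemma sextic_11zz_sqfree w :
  (- 392 - 168 * r) + (144 + 720 * r) * w + ((11 * 1000 + 784) - 216 * r) * w ^+ 2 + (2016 + (10
    * 1000 + 80) * r) * w ^+ 3 + ((11 * 1000 + 784) - 216 * r) * w ^+ 4 + (144 + 720 * r) * w ^+
    5 + (- 392 - 168 * r) * w ^+ 6 = 0 ->
  (144 + 720 * r) + ((23 * 1000 + 568) - 432 * r) * w + (6048 + (30 * 1000 + 240) * r) * w ^+ 2 +
    ((47 * 1000 + 136) - 864 * r) * w ^+ 3 + (720 + 3600 * r) * w ^+ 4 + (- 2352 - 1008 * r) * w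
    ^+ 5 <> 0.
Proof.
set P := (X in X = 0 -> _); set Q := (X in X <> 0) => eP eQ.
have : ((- ((238 * 1000 + 716) * 1000 + 450) + ((123 * 1000 + 389) * 1000 + 298) * r) + (((796 *
  1000 + 495) * 1000 + 896) - ((62 * 1000 + 479) * 1000 + 512) * r) * w + (- ((107 * 1000 + 770)
  * 1000 + 908) + ((546 * 1000 + 640) * 1000 + 188) * r) * w ^+ 2 + (((156 * 1000 + 958) * 1000 +
  200) + ((19 * 1000 + 855) * 1000 + 368) * r) * w ^+ 3 + (- ((35 * 1000 + 451) * 1000 + 570) -
  ((28 * 1000 + 152) * 1000 + 894) * r) * w ^+ 4) * P +
    (((9668 * 1000 + 967) + (9045 * 1000 + 729) * r) + (((92 * 1000 + 321) * 1000 + 663) - ((83 *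
      1000 + 730) * 1000 + 679) * r) * w + (- ((290 * 1000 + 829) * 1000 + 882) + ((11 * 1000 +
      542) * 1000 + 986) * r) * w ^+ 2 + (((24 * 1000 + 534) * 1000 + 622) - ((138 * 1000 + 445)
      * 1000 + 454) * r) * w ^+ 3 + (- ((30 * 1000 + 560) * 1000 + 733) - (3519 * 1000 + 99) * r)
      * w ^+ 4 + ((5908 * 1000 + 595) + (4692 * 1000 + 149) * r) * w ^+ 5) * Q = 2 ^+ 23 * 3 ^+ 4
      * 7 ^+ 1 * 11 ^+ 1.
  by rewrite /P /Q; ring: hr.
rewrite eP eQ !mulr0 addr0 => /esym/eqP; apply/negP.
by rewrite !mulf_neq0 ?expf_neq0 ?pnatr_eq0.
Qed.

Lemma sextic_11ziz_sqfree w :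
  (- 392 - 168 * r) + (144 + 720 * r) * w + (2040 + 1368 * r) * w ^+ 2 + (4896 + 3744 * r) * w ^+
    3 + (- 2040 - 1368 * r) * w ^+ 4 + (144 + 720 * r) * w ^+ 5 + (392 + 168 * r) * w ^+ 6 = 0 ->
  (144 + 720 * r) + (4080 + 2736 * r) * w + ((14 * 1000 + 688) + (11 * 1000 + 232) * r) * w ^+ 2
    + (- 8160 - 5472 * r) * w ^+ 3 + (720 + 3600 * r) * w ^+ 4 + (2352 + 1008 * r) * w ^+ 5 <> 0.
Proof.
set P := (X in X = 0 -> _); set Q := (X in X <> 0) => eP eQ.
have : ((- (((14 * 1000 + 376) * 1000 + 725) * 1000 + 262) - ((7869 * 1000 + 561) * 1000 + 210) *
  r) + ((((56 * 1000 + 109) * 1000 + 908) * 1000 + 664) - (((41 * 1000 + 518) * 1000 + 731) *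
  1000 + 708) * r) * w + (- (((26 * 1000 + 813) * 1000 + 136) * 1000 + 432) + (((21 * 1000 + 381)
  * 1000 + 534) * 1000 + 420) * r) * w ^+ 2 + ((((54 * 1000 + 74) * 1000 + 390) * 1000 + 904) -
  (((35 * 1000 + 533) * 1000 + 96) * 1000 + 524) * r) * w ^+ 3 + (- ((7700 * 1000 + 192) * 1000 +
  178) + ((2650 * 1000 + 236) * 1000 + 78) * r) * w ^+ 4) * P +
    ((- ((8844 * 1000 + 122) * 1000 + 751) + ((6025 * 1000 + 73) * 1000 + 211) * r) + (((5348 *
      1000 + 504) * 1000 + 659) + ((2776 * 1000 + 934) * 1000 + 863) * r) * w + (- (((16 * 1000 +
      415) * 1000 + 975) * 1000 + 658) + (((13 * 1000 + 19) * 1000 + 400) * 1000 + 198) * r) * w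
      ^+ 2 + (((5659 * 1000 + 418) * 1000 + 134) - ((4823 * 1000 + 337) * 1000 + 134) * r) * w ^+
      3 + (- (((10 * 1000 + 788) * 1000 + 469) * 1000 + 803) + ((7049 * 1000 + 179) * 1000 + 899)
      * r) * w ^+ 4 + (((1283 * 1000 + 365) * 1000 + 363) - ((441 * 1000 + 706) * 1000 + 13) * r)
      * w ^+ 5) * Q = 2 ^+ 17 * 3 ^+ 5 * 5 ^+ 1 * 13 ^+ 3 * 61 ^+ 1.
  by rewrite /P /Q; ring: hr.
rewrite eP eQ !mulr0 addr0 => /esym/eqP; apply/negP.
by rewrite !mulf_neq0 ?expf_neq0 ?pnatr_eq0.
Qed.

(** The restriction of the form is the sextic in w = z^2, so a critical point with z nonzero is a
    multiple root of it. At z = 0 the derivative of z^2 vanishes, and the value of the form is used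
    instead. *)
Lemma noncritical_11zz z : ~ critical r 1 1 z z.
Proof.
move=> cr; have ep := critical_form12_eq0 cr; case: cr => _ _ ez _.
have [z0|z0] := eqVneq z 0.
  move: ep; rewrite z0 (_ : form12 _ _ _ _ _ = (- 392) + (- 168) * r).
    apply/eqP/r_lin_neq0.
    rewrite (_ : _ - _ = 2 ^+ 6 * 7 ^+ 2 * 22); last by ring.
    by rewrite !mulf_neq0 ?expf_neq0 ?pnatr_eq0.
  rewrite /form12 /Phi /esym1 /esym2 /esym3; ring: hr.
apply: (@sextic_11zz_sqfree (z ^+ 2)).
  rewrite -[RHS]ep /form12 /Phi /esym1 /esym2 /esym3; ring: hr.
apply: (mulfI z0); rewrite mulr0 -ez.
rewrite /dform12 /PhiA /PhiB /PhiD /esym1 /esym2; ring: hr.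
Qed.

(** The restriction is now a sextic in w = i z^2, whose derivative in z is the combination F_z + i
    F_t = 2 i z P'(w). *)
Lemma noncritical_11ziz i z : i ^+ 2 = -1 -> ~ critical r 1 1 z (i * z).
Proof.
move=> hi cr; have ep := critical_form12_eq0 cr; case: cr => _ _ ez et.
have i0 : i != 0.
  by apply: contra_eqN hi => /eqP->; rewrite expr0n /= eq_sym oppr_eq0 oner_eq0.
have [z0|z0] := eqVneq z 0.
  move: ep; rewrite z0 (_ : form12 _ _ _ _ _ = (- 392) + (- 168) * r).
    apply/eqP/r_lin_neq0.
    rewrite (_ : _ - _ = 2 ^+ 6 * 7 ^+ 2 * 22); last by ring.
    by rewrite !mulf_neq0 ?expf_neq0 ?pnatr_eq0.
  rewrite /form12 /Phi /esym1 /esym2 /esym3; ring: hr.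
apply: (@sextic_11ziz_sqfree (i * z ^+ 2)).
  rewrite -[RHS]ep /form12 /Phi /esym1 /esym2 /esym3; ring: hr hi.
have n0 : 2 * i * z != 0 by rewrite !mulf_neq0 ?pnatr_eq0.
apply: (mulfI n0); rewrite mulr0 -[RHS](_ : dform12 r z 1 1 (i * z) + i * dform12 r (i * z) 1 1 z
  = 0); last first.
  by rewrite ez et mulr0 addr0.
rewrite /dform12 /PhiA /PhiB /PhiD /esym1 /esym2; ring: hr hi.
Qed.

Definition sextic_111t t : C :=
  (243 - 183 * r) + (162 - 144 * r) * t + (351 - 225 * r) * t ^+ 2
  + (108 - 84 * r) * t ^+ 3 + (9 - 21 * r) * t ^+ 4 + (18 - 12 * r) * t ^+ 5
  + (5 - 3 * r) * t ^+ 6.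

Definition dsextic_111t t : C :=
  (162 - 144 * r) + (702 - 450 * r) * t + (324 - 252 * r) * t ^+ 2
  + (36 - 84 * r) * t ^+ 3 + (90 - 60 * r) * t ^+ 4 + (30 - 18 * r) * t ^+ 5.

Lemma form12_111t t :
  form12 r 1 1 1 t = (t ^+ 2 - (3 + r) * t - r) ^+ 3 * sextic_111t t.
Proof. rewrite /sextic_111t /form12 /Phi /esym1 /esym2 /esym3; ring: hr. Qed.

Lemma dform12_111t t : dform12 r t 1 1 1 =
  (t ^+ 2 - (3 + r) * t - r) ^+ 3 * dsextic_111t t
  + 3 * (t ^+ 2 - (3 + r) * t - r) ^+ 2 * (2 * t - (3 + r)) * sextic_111t t.
Proof.
rewrite /sextic_111t /dsextic_111t /dform12 /PhiA /PhiB /PhiD /esym1 /esym2.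
ring: hr.
Qed.

(** Where the quadratic factor is nonzero, a critical point would be a double root of the squarefree
    sextic. *)
Lemma critical_111t t : critical r 1 1 1 t -> t ^+ 2 - (3 + r) * t - r = 0.
Proof.
move=> cr; have := critical_form12_eq0 cr; case: cr => _ _ _.
rewrite form12_111t dform12_111t => et ep; apply/eqP; apply: contraT => Q0.
have e0 : sextic_111t t = 0 by apply: (mulfI (expf_neq0 3 Q0)); rewrite mulr0.
case: (sextic_111t_sqfree e0); apply: (mulfI (expf_neq0 3 Q0)).
by move: et; rewrite e0 mulr0 addr0 mulr0.
Qed.

Lemma dform12_111zt z t (w := z * t) (S := z ^+ 4 + t ^+ 4)
    (A := 2 + S) (B := 1 + 2 * S + w ^+ 4) :
  dform12 r 1 1 z t =
  4 * (PhiA r A B w + PhiB r A w * (1 + S) + 3456 * (S + w ^+ 4))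
  + PhiD r A B w * w.
Proof.
by rewrite /dform12 /B /A /S /w /PhiA /PhiB /PhiD /esym1 /esym2; ring.
Qed.

Lemma dform12_z11t z t (w := z * t) (S := z ^+ 4 + t ^+ 4)
    (A := 2 + S) (B := 1 + 2 * S + w ^+ 4) :
  z * dform12 r z 1 1 t =
  4 * z ^+ 4 * (PhiA r A B w + PhiB r A w * (2 + t ^+ 4)
  + 3456 * (1 + 2 * t ^+ 4)) + PhiD r A B w * w.
Proof.
by rewrite /dform12 /B /A /S /w /PhiA /PhiB /PhiD /esym1 /esym2; ring.
Qed.

(** These are Vieta's formulas: 1, z^4 and t^4 are three distinct roots of the cubic of
    [critical_eq_expr4], so they determine its coefficients. The proof obtains them by successive
    divided differences. *)
Lemma critical_11zt_lin z t (w := z * t) (S := z ^+ 4 + t ^+ 4)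
    (A := 2 + S) (B := 1 + 2 * S + w ^+ 4) :
  z ^+ 4 != 1 -> t ^+ 4 != 1 -> z ^+ 4 != t ^+ 4 -> critical r 1 1 z t ->
  [/\ PhiB r A w = - 3456, PhiA r A B w = 3456 &
      (PhiD r A B w + (13 * 1000 + 824) * w ^+ 3) * w = 0].
Proof.
move=> z1 t1 zt [e1 _ ez et].
have n4 : 4 != 0 :> C by rewrite pnatr_eq0.
have ewS : w ^+ 4 = z ^+ 4 * t ^+ 4 by rewrite exprMn.
have := dform12_z11t t z; cbv zeta.
rewrite et mulr0 (mulrC t) (addrC (t ^+ 4)) -/w -/S -/A -/B => {}et.
have := dform12_z11t z t; cbv zeta; rewrite ez mulr0 -/w -/S -/A -/B => {}ez.
have := dform12_111zt z t; cbv zeta; rewrite e1 -/w -/S -/A -/B => {}e1.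
move: e1 ez et.
move: (PhiA r A B w) (PhiB r A w) (PhiD r A B w) => a b d e1 ez et.
have fz : a + b * (1 + t ^+ 4) + 3456 * t ^+ 4 = 0.
  apply: (mulfI (mulf_neq0 n4 (_ : z ^+ 4 - 1 != 0))); first by rewrite subr_eq0.
  rewrite mulr0; transitivity (0 - 0 : C); last by rewrite subr0.
  by rewrite {1}ez e1 ewS /S; ring.
have ft : a + b * (1 + z ^+ 4) + 3456 * z ^+ 4 = 0.
  apply: (mulfI (mulf_neq0 n4 (_ : t ^+ 4 - 1 != 0))); first by rewrite subr_eq0.
  rewrite mulr0; transitivity (0 - 0 : C); last by rewrite subr0.
  by rewrite {1}et e1 ewS /S; ring.
have eb : b = - 3456.
  apply/eqP; rewrite -addr_eq0; apply/eqP.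
  apply: (mulfI (_ : z ^+ 4 - t ^+ 4 != 0)); first by rewrite subr_eq0.
  rewrite mulr0; transitivity (0 - 0 : C); last by rewrite subr0.
  by rewrite -{1}ft -fz; ring.
have ea : a = 3456.
  transitivity (0 + 3456 : C); last by rewrite add0r.
  by rewrite -fz eb; ring.
split=> //; rewrite e1 ea eb; ring.
Qed.

Lemma critical_11zt z t : z ^+ 4 != 1 -> t ^+ 4 != 1 -> z ^+ 4 != t ^+ 4 ->
  critical r 1 1 z t -> z * t = 1 - 2 * r /\ z ^+ 4 + t ^+ 4 = 24 * r - 38.
Proof.
move=> z1 t1 zt cr; have [] := critical_11zt_lin z1 t1 zt cr.
move: (z * t) (z ^+ 4 + t ^+ 4) => w S eb ea ed.
have n6 : 432 != 0 :> C.
  by rewrite (_ : 432 = 2 ^+ 4 * 3 ^+ 3) ?neq0_23 //; ring.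
have eS : S = (22 - 8 * r) + (8 * r - 12) * w.
  apply: (mulfI n6); apply/eqP; rewrite -subr_eq0; apply/eqP.
  (* As (r - 3) (r + 3) = -6, this factor turns the coefficient -72 (3 + r) of S into 432. *)
  transitivity ((r - 3) * (PhiB r (2 + S) w + 3456)); last first.
    by rewrite eb addNr mulr0.
  rewrite /PhiB; ring: hr.
have E1 : ((12 * 1000 + 168) - (12 * 1000 + 456) * r) + (- (14 * 1000 + 400) + 9792 * r) * w
    + (5904 - 720 * r) * w ^+ 2 + (- 216 - 72 * r) * w ^+ 4 = 0.
  transitivity (PhiA r (2 + S) (1 + 2 * S + w ^+ 4) w - 3456); last first.
    by rewrite ea subrr.
  rewrite eS /PhiA; ring: hr.
suff ew : w = 1 - 2 * r by split=> //; rewrite eS ew; ring: hr.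
have w0 : w != 0.
  apply: contra_eqN E1 => /eqP->; rewrite !expr0n /= !mulr0 !addr0.
  rewrite (_ : _ - _ = 72 * (169 + (- 173) * r)); last by ring.
  rewrite mulf_neq0 ?pnatr_eq0 // r_lin_neq0 //.
  rewrite (_ : _ - _ = - (2 * (1331 * 23))); last by ring.
  by rewrite oppr_eq0 !mulf_neq0 ?pnatr_eq0.
have E2 : ((154 * 1000 + 656) - (71 * 1000 + 712) * r) + (- (89 * 1000 + 856) + (103 * 1000 +
  680) * r) * w
    + ((46 * 1000 + 656) + 8640 * r) * w ^+ 2 + (13 * 1000 + 824) * w ^+ 3 + (- 864 + 864 * r) *
      w ^+ 4 = 0.
  apply: (mulIf w0); rewrite mul0r -ed eS /PhiD; ring: hr.
apply/eqP; rewrite -subr_eq0 -sqrf_eq0; apply/eqP.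
(* Elimination between the quartics E1 and E2: the combination below equals 2^13 3^3 (w - (1 - 2
   r))^2. *)
apply: (mulfI (neq0_23 13 3)); rewrite mulr0.
transitivity (((156 - 144 * r) + (36 - 24 * r) * w) * 0 + ((- 9 + 14 * r) + (- 3) * w) * 0 : C);
  last first.
  by rewrite !mulr0 addr0.
rewrite -{1}E1 -E2; ring: hr.
Qed.

End Certificates.

Section Crit.
Variables (C : numClosedFieldType) (r : C).
Hypothesis hr : r ^+ 2 = 3.

(** For x = y = 0 the form is a polynomial in S = z^4 + t^4 and P = z^4 t^4 alone, namely (5 - 3 r)
    S^3 - 72 (3 + r) S P. *)
Lemma noncritical_00zt z t : z ^+ 4 != t ^+ 4 -> ~ critical r 0 0 z t.
Proof.
wlog t0 : z t / t != 0.
  move=> wl zt; have [t0|t0] := eqVneq t 0; last exact: wl.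
  case=> ex ey ez et; apply: (wl t z); first last.
  - by split; rewrite // 1?dform12_swap34 // -?[RHS]ex // -[RHS]ey dform12_swap34.
  - by rewrite eq_sym.
  - by apply: contra_neq zt => ->; rewrite t0.
move=> zt [_ _ ez et].
have n0 : 5 - 3 * r != 0.
  rewrite (_ : _ - _ = 5 + (- 3) * r); last by ring.
  by apply: (r_lin_neq0 hr); rewrite (_ : _ - _ = - 2); [rewrite oppr_eq0 pnatr_eq0|ring].
have n3 : 3 + r != 0.
  rewrite (_ : _ + _ = 3 + 1 * r); last by ring.
  by apply: (r_lin_neq0 hr); rewrite (_ : _ - _ = 6); [rewrite pnatr_eq0|ring].
have n4 : 4 != 0 :> C by rewrite pnatr_eq0.
have n3' : 3 != 0 :> C by rewrite pnatr_eq0.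
have n72 : 72 != 0 :> C by rewrite pnatr_eq0.
have [z0|z0] := eqVneq z 0.
  move: et; rewrite z0 (_ : dform12 _ _ _ _ _ = 4 * 3 * (5 - 3 * r) * t ^+ 11).
    by apply/eqP; rewrite !mulf_neq0 ?expf_neq0.
  rewrite /dform12 /PhiA /PhiB /PhiD /esym1 /esym2; ring.
(* The combination t^3 F_z - z^3 F_t cancels the derivative along S and leaves k S with k
   nonzero. *)
have S0 : z ^+ 4 + t ^+ 4 = 0.
  pose k := 4 * (72 * (3 + r)) * z ^+ 3 * t ^+ 3 * (z ^+ 4 - t ^+ 4).
  have k0 : k != 0.
    by rewrite /k !mulf_neq0 ?expf_neq0 // subr_eq0.
  apply: (mulfI k0); rewrite mulr0.
  transitivity (t ^+ 3 * dform12 r z 0 0 t - z ^+ 3 * dform12 r t 0 0 z); last first.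
    by rewrite ez et !mulr0 subrr.
  rewrite /k /dform12 /PhiA /PhiB /PhiD /esym1 /esym2; ring.
move: ez; have -> : dform12 r z 0 0 t = 4 * z ^+ 3 * ((z ^+ 4 + t ^+ 4) *
   (- 72 * (3 + r) * t ^+ 4 + 3 * (5 - 3 * r) * (z ^+ 4 + t ^+ 4))
   - 72 * (3 + r) * z ^+ 4 * t ^+ 4).
  rewrite /dform12 /PhiA /PhiB /PhiD /esym1 /esym2; ring.
rewrite S0 mul0r sub0r => /eqP; apply/negP.
by rewrite !mulf_neq0 ?expf_neq0 // oppr_eq0 !mulf_neq0 ?expf_neq0.
Qed.

Definition critical_vec (v : 'cV[C]_4) :=
  forall j, evalp (mderiv j (form12_mpoly r)) v = 0.

Lemma critical_vecP x y z t :
  critical_vec (vec x y z t) <-> critical r x y z t.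
Proof.
split=> [e|[ex ey ez et] j].
- by split; [have := e 0|have := e 1|have := e 2|have := e 3];
    rewrite evalp_mderiv_form12.
- by rewrite evalp_mderiv_form12; case: j => [] [|[|[|[|//]]]].
Qed.

Lemma critical_vec_scale l v : critical_vec v -> critical_vec (l *: v).
Proof.
rewrite (vecE v) scale_vec !critical_vecP => -[ex ey ez et].
by split; rewrite dform12_scale ?ex ?ey ?ez ?et mulr0.
Qed.

Lemma critical_vec_pconj v w : pconj v w -> critical_vec v -> critical_vec w.
Proof.
move=> [g [l [gG _ ->]]] cv; apply: critical_vec_scale => j.
exact: (poly_act_grad j (G29_unit gG) (form12_mpoly_invariant r gG) cv).
Qed.

End Crit.

(** * The orbit of the critical points *)

Section Classification.
Variables (C : numClosedFieldType) (r c : C).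
Hypothesis hr : r ^+ 2 = 3.
Hypothesis hc : c ^+ 2 = (3 + r) * c + r.
Implicit Types (x y z t : C).
Let hi := sqrCi C.

Lemma critical_diagonal x y z t : critical r x y z t ->
  exists x' z' t', pconj (vec x y z t) (vec x' x' z' t').
Proof.
have diag x' y' z' t' : x' ^+ 4 = y' ^+ 4 ->
    exists x z t, pconj (vec x' y' z' t') (vec x x z t).
  move=> /eq_expr4 [n ->]; exists ('i ^+ n * y'), ((- 'i) ^+ n * z'), t'.
  exact: pconj_diag23n.
have via v x' y' z' t' : pconj v (vec x' y' z' t') -> x' ^+ 4 = y' ^+ 4 ->
    exists x z t, pconj v (vec x x z t).
  move=> p /(diag x' y' z' t') [a [b [d q]]]; exists a, b, d.
  exact: pconj_trans p q.
move=> /critical_eq_expr4 u.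
have : [|| x ^+ 4 == y ^+ 4, x ^+ 4 == z ^+ 4, x ^+ 4 == t ^+ 4,
           y ^+ 4 == z ^+ 4, y ^+ 4 == t ^+ 4 | z ^+ 4 == t ^+ 4].
  by move: u; rewrite /= !inE; do !case: (_ == _).
have p13 : pconj (vec x y z t) (vec x z y t) by exact: pconj23.
case/orP=> [/eqP|]; first exact: diag.
case/orP=> [/eqP|]; first exact: via p13.
case/orP=> [/eqP|].
  by apply: via (pconj_trans (pconj34 _ _ _ _) (pconj23 _ _ _ _)).
case/orP=> [/eqP|].
  by apply: via (pconj_trans (pconj12 _ _ _ _) (pconj23 _ _ _ _)).
case/orP=> [/eqP|/eqP].
  by apply: via (pconj_trans (pconj34 _ _ _ _) (pconj_trans (pconj12 _ _ _ _)
    (pconj23 _ _ _ _))).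
by apply: via (pconj1324 _ _ _ _).
Qed.

(** [k] is the inverse of c - 1. The point (1 : 1 : cusp3z : cusp3t) below is the image under [s4]
    of (1 : 1 : i : - i c), rescaled; it represents the critical points whose fourth powers 1, z^4,
    t^4 are distinct. *)
Let k := (c - 2 - r) * (r - 1) / 4.

Definition cusp3z : C := 1 + (2 + 2 * 'i) * k.
Definition cusp3t : C := - 1 + (2 * 'i - 2) * k.

Let n2 : 2 != 0 :> C. Proof. by rewrite pnatr_eq0. Qed.
Let n4 : 4 != 0 :> C. Proof. by rewrite pnatr_eq0. Qed.

(** [3 + r - c] is the other root of the quadratic equation of [c], and [s4] exchanges the two
    points of the line. *)
Lemma pconj_cusp2 : pconj (vec 1 1 1 c) (vec 1 1 1 (3 + r - c)).
Proof.
(* The inverse of - (1 + c) / 2, the common value of the first three coordinates after [s4]. *)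
pose l := - (4 + r - c) / 2.
have l0 : l != 0.
  have e : l * (- (1 + c) / 2) = 1 by rewrite /l; field: hr hc.
  by apply: contra_eq_neq e => ->; rewrite mul0r eq_sym oner_eq0.
apply: pconj_trans (pconj_act _ (G29_s4 C)) _; rewrite s4_vec.
apply: (pconj_trans (pconj_scale _ l0)); rewrite scale_vec.
rewrite (_ : vec _ _ _ _ = vec 1 1 1 (3 + r - c)); first exact: pconj_refl.
by congr vec; rewrite /l; field: hr hc.
Qed.

Lemma pconj_cusp3 : pconj (vec 1 1 1 c) (vec 1 1 cusp3z cusp3t).
Proof.
have c1 : (c - 1) * k = 1 by rewrite /k; field: hr hc.
apply: pconj_trans (pconj_diag34n 1 _ _ _ _) _.
apply: pconj_trans (pconj_act _ (G29_s4 C)) _; rewrite s4_vec !expr1.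
have k0 : k != 0.
  by apply: contra_eq_neq c1 => ->; rewrite mulr0 eq_sym oner_eq0.
have l0 : - 2 * 'i * k != 0.
  by apply: (mulf_neq0 _ k0); apply: mulf_neq0 (neq0Ci C); rewrite oppr_eq0.
apply: (pconj_trans (pconj_scale _ l0)); rewrite scale_vec.
rewrite (_ : vec _ _ _ _ = vec 1 1 cusp3z cusp3t); first exact: pconj_refl.
by congr vec; rewrite /cusp3z /cusp3t /k; field: hi hr hc.
Qed.

Lemma critical_11zt_pconj z t : critical r 1 1 z t ->
  pconj (vec 1 1 1 c) (vec 1 1 z t).
Proof.
have move34 x y u v n : critical r x y u v ->
    critical r x y ('i ^+ n * u) ((- 'i) ^+ n * v).
  by move=> /critical_vecP /(critical_vec_pconj (pconj_diag34n n _ _ _ _)) /critical_vecP.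
have swap34 x y u v : critical r x y u v -> critical r x y v u.
  by move=> /critical_vecP /(critical_vec_pconj (pconj34 _ _ _ _)) /critical_vecP.
have iNi n : (- 'i) ^+ n * 'i ^+ n = 1 :> C.
  by rewrite -exprMn mulNr -expr2 hi opprK expr1n.
have norm u v : critical r 1 1 u v -> u ^+ 4 = 1 -> pconj (vec 1 1 1 c) (vec 1 1 u v).
  move=> cr u1; have /eq_expr4 [n en] : u ^+ 4 = 1 ^+ 4 by rewrite u1 expr1n.
  have cu : (- 'i) ^+ n * u = 1 by rewrite en mulrA iNi mul1r.
  have p := pconj_diag34n (3 * n) 1 1 u v.
  have e3 : 'i ^+ (3 * n) = (- 'i) ^+ n :> C.
    by rewrite exprM (_ : 'i ^+ 3 = - 'i) //; ring: hi.
  rewrite e3 cu in p; set v' := _ * v in p.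
  have /critical_vecP/critical_111t-/(_ hr) e' := critical_vec_pconj p ((critical_vecP _ _ _ _ _).2 cr).
  apply: (pconj_trans _ (pconj_sym p)).
  have : (v' - c) * (v' - (3 + r - c)) = 0 by rewrite -[RHS]e'; ring: hc.
  move=> /eqP; rewrite mulf_eq0 !subr_eq0 => /orP[]/eqP->; first exact: pconj_refl.
  exact: pconj_cusp2.
move=> cr.
have [z1|z1] := eqVneq (z ^+ 4) 1; first exact: norm.
have [t1|t1] := eqVneq (t ^+ 4) 1.
  exact: pconj_trans (norm _ _ (swap34 _ _ _ _ cr) t1) (pconj34 _ _ _ _).
have [/esym/eq_expr4 [n en]|zt] := eqVneq (z ^+ 4) (t ^+ 4).
  exfalso; move: cr; rewrite en => cr.
  (* With n = 2 m + odd n, multiplying z by i^m and t by i^-m changes the ratio t / z from i^n to 1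
     or i. *)
  have hn := odd_double_half n; set m := n./2 in hn.
  have tE : (- 'i) ^+ m * ('i ^+ n * z) = 'i ^+ odd n * ('i ^+ m * z).
    rewrite -{1}hn exprD -addnn exprD.
    transitivity ((- 'i) ^+ m * 'i ^+ m * ('i ^+ odd n * ('i ^+ m * z))).
      by ring.
    by rewrite iNi mul1r.
  have := move34 _ _ _ _ m cr; rewrite tE; case: (odd n); rewrite ?mul1r.
  - exact: noncritical_11ziz.
  - exact: noncritical_11zz.
have [ew eS] := critical_11zt hr z1 t1 zt cr.
have e3w : cusp3z * cusp3t = 1 - 2 * r.
  by rewrite /cusp3z /cusp3t /k; field: hi hr hc.
have e3S : cusp3z ^+ 4 + cusp3t ^+ 4 = 24 * r - 38.
  by rewrite /cusp3z /cusp3t /k; field: hi hr hc.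
have w0 : 1 - 2 * r != 0.
  rewrite (_ : _ - _ = 1 + (- 2) * r); last by ring.
  apply: (r_lin_neq0 hr); rewrite (_ : _ - _ = - 11); last by ring.
  by rewrite oppr_eq0 pnatr_eq0.
have main u v : u * v = 1 - 2 * r -> u ^+ 4 = cusp3z ^+ 4 ->
    pconj (vec 1 1 1 c) (vec 1 1 u v).
  move=> euv /eq_expr4 [n en]; apply: (pconj_trans pconj_cusp3).
  have -> : v = (- 'i) ^+ n * cusp3t.
    have u0 : u != 0 by apply: contra_eq_neq euv => ->; rewrite mul0r eq_sym.
    apply: (mulfI u0); rewrite euv en mulrACA (mulrC ('i ^+ n)) iNi mul1r.
    by rewrite e3w.
  by rewrite en; exact: pconj_diag34n.
(* The sum and the product of z^4 and t^4 are known, so they are the two numbers cusp3z^4 and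
   cusp3t^4 in some order. *)
have : (z ^+ 4 - cusp3z ^+ 4) * (t ^+ 4 - cusp3z ^+ 4) = 0.
  transitivity ((z * t) ^+ 4 - (cusp3z * cusp3t) ^+ 4 - cusp3z ^+ 4 *
    ((z ^+ 4 + t ^+ 4) - (cusp3z ^+ 4 + cusp3t ^+ 4))); first by ring.
  by rewrite ew eS e3w e3S !subrr mulr0 subrr.
move=> /eqP; rewrite mulf_eq0 !subr_eq0 => /orP[]/eqP e; first exact: main.
apply: (pconj_trans (main t z _ e)); first by rewrite mulrC.
exact: pconj34.
Qed.

Lemma critical_yyzt_pconj y z t : y != 0 -> critical_vec r (vec y y z t) ->
  pconj (vec 1 1 1 c) (vec y y z t).
Proof.
move=> y0 /(critical_vec_scale y^-1).
rewrite scale_vec mulVf // => /critical_vecP/critical_11zt_pconj p.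
apply: (pconj_trans p).
have := pconj_scale (vec 1 1 (y^-1 * z) (y^-1 * t)) y0.
by rewrite scale_vec !mulrA divff // !mul1r mulr1.
Qed.

Lemma critical_xxzt_pconj x z t : vec x x z t != 0 ->
  critical_vec r (vec x x z t) -> pconj (vec 1 1 1 c) (vec x x z t).
Proof.
have [->|x0] := eqVneq x 0; last by move=> _; exact: critical_yyzt_pconj.
move=> v0 /critical_vecP cr.
have [/eq_expr4 [n zt]|zt] := eqVneq (z ^+ 4) (t ^+ 4); last first.
  by case: (noncritical_00zt hr zt).
(* The exponent 3 n gives i^(3 n) i^n = 1, which cancels the ratio z = i^n t. *)
have p : pconj (vec 0 0 z t) (vec t t 0 0).
  apply: (pconj_trans (pconj1324 _ _ _ _)).
  apply: (pconj_trans (pconj12 _ _ _ _)).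
  apply: (pconj_trans (pconj_diag23n (3 * n)%N _ _ _ _)); rewrite zt !mulr0.
  rewrite mulrA -exprD (_ : (3 * n + n = 4 * n)%N); last by lia.
  rewrite exprM (_ : 'i ^+ 4 = 1) ?expr1n ?mul1r; last by ring: hi.
  exact: pconj_refl.
apply: (pconj_trans _ (pconj_sym p)); apply: critical_yyzt_pconj.
  apply: contra_neq v0 => t0; rewrite zt t0 mulr0.
  by apply/colP => j; rewrite !mxE; case: j => [] [|[|[|[|//]]]].
exact/(critical_vec_pconj p)/critical_vecP.
Qed.

Theorem critical_pconj v : v != 0 -> critical_vec r v -> pconj (vec 1 1 1 c) v.
Proof.
move=> v0 cv; rewrite (vecE v) in v0 cv *.
have [x [z [t p]]] := critical_diagonal ((critical_vecP _ _ _ _ _).1 cv).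
apply: pconj_trans (pconj_sym p); apply: critical_xxzt_pconj.
  case: p => g [l [gG l0 ->]]; rewrite scaler_eq0 negb_or l0 /=.
  apply: contra_neq v0 => e; rewrite -[RHS](mulmx0 _ (invmx g)) -e mulmxA.
  by rewrite mulVmx ?mul1mx // G29_unit.
exact: critical_vec_pconj p cv.
Qed.

End Classification.

Lemma near_fst (T : topologicalType) (x : T) (P : T -> Prop) :
  (\forall y \near x, P y) -> \forall p \near (x, x), P p.1.
Proof.
move=> Px; exists (P, setT) => /=; first by split=> //; exact: filterT.
by move=> [a b] [].
Qed.

Lemma near_snd (T : topologicalType) (x : T) (P : T -> Prop) :
  (\forall y \near x, P y) -> \forall p \near (x, x), P p.2.
Proof.
move=> Px; exists (setT, P) => /=; first by split=> //; exact: filterT.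
by move=> [a b] [].
Qed.

(** * Holomorphic functions on C^n *)

Section Carat.
Variables (C : numFieldType) (n : nat).
Local Notation V := 'cV[C]_n.
Implicit Types (f g : V -> C) (x y z : V) (d : 'rV[C]_n).

(* Strict differentiability in the form of Caratheodory: the increments of f
   near x are given by a matrix that depends on both points and tends to d. *)
Definition carat f x d :=
  exists q : V * V -> 'rV[C]_n, q p @[p --> (x, x)] --> d /\
    \forall p \near (x, x), f p.1 - f p.2 = (q p *m (p.1 - p.2)) 0 0.

Lemma mx_norm_le m k (A : 'M[C]_(m, k)) e : 0 <= e ->
  (forall i j, `|A i j| <= e) -> `|A| <= e.
Proof.
move=> e0 Ae; have [A0|A0] := eqVneq (mx_norm A) 0.
  by rewrite [leLHS]A0.
by have [i Ai] := mx_norm_neq0 A0; rewrite [leLHS]Ai.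
Qed.

Lemma le_mx_norm m k (A : 'M[C]_(m, k)) i j : `|A i j| <= `|A|.
Proof.
rewrite [leRHS]mx_normE.
have -> : `|A i j| = (`|A i j|%:nng)%:num by [].
rewrite num_le.
exact: (le_bigmax _ (fun i => `|A i.1 i.2|%:nng) (i, j)).
Qed.

(** The norm is the largest modulus of an entry, whence the factor [k]. *)
Lemma norm_mulmx_le m k l (A : 'M[C]_(m, k)) (B : 'M[C]_(k, l)) :
  `|A *m B| <= k%:R * `|A| * `|B|.
Proof.
apply: mx_norm_le => [|i j]; first by rewrite !mulr_ge0.
rewrite mxE (le_trans (ler_norm_sum _ _ _)) //.
have -> : k%:R * `|A| * `|B| = \sum_(h < k) (`|A| * `|B|).
  by rewrite sumr_const card_ord -mulrA mulr_natl.
apply: ler_sum => h _.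
by rewrite normrM ler_pM // le_mx_norm.
Qed.

Lemma carat_strict f x d : carat f x d -> forall e : C, 0 < e ->
  \forall p \near (x, x),
    `|f p.1 - f p.2 - (d *m (p.1 - p.2)) 0 0| <= e * `|p.1 - p.2|.
Proof.
move=> [q [qd fq]] e e0.
(* [n.+1] bounds the factor n of [norm_mulmx_le] and stays invertible for n = 0. *)
have n0 : 0 < n.+1%:R :> C by rewrite ltr0n.
have /cvgrPdist_le /(_ (e / n.+1%:R)) := qd; rewrite divr_gt0 // => /(_ isT) qe.
near=> p.
have -> : f p.1 - f p.2 = (q p *m (p.1 - p.2)) 0 0 by near: p.
have -> : (q p *m (p.1 - p.2)) 0 0 - (d *m (p.1 - p.2)) 0 0 =
    - ((d - q p) *m (p.1 - p.2)) 0 0.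
  by rewrite mulmxBl [in RHS]mxE [in X in - (_ + X)]mxE; ring.
rewrite normrN (le_trans (le_mx_norm _ _ _)) // (le_trans (norm_mulmx_le _ _)) //.
apply: ler_wpM2r => //; have : `|d - q p| <= e / n.+1%:R by near: p.
rewrite ler_pdivlMr // mulrC; apply: le_trans.
by apply: ler_wpM2r => //; rewrite ler_nat.
Unshelve. all: by end_near. Qed.

Lemma carat_cvg f x d : carat f x d -> f @ x --> f x.
Proof.
move=> /carat_strict /(_ 1 ltr01) H.
have n0 : 0 < n%:R * `|d| + 2 :> C by rewrite ltr_wpDl // mulr_ge0.
apply/(@cvgrPdist_le _ _ _ (nbhs x)) => e e0.
have {H} : \forall y \near x, `|f y - f x - (d *m (y - x)) 0 0| <= 1 * `|y - x|.
  have := (cvg_pair (@cvg_id _ (nbhs x)) (cvg_cst x)) _ H; exact.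
move=> H.
have Hx : \forall y \near x, `|x - y| <= e / (n%:R * `|d| + 2).
  by have /cvgrPdist_le := @cvg_id _ (nbhs x); apply; rewrite divr_gt0.
near=> y; rewrite distrC -[f y - f x](subrK ((d *m (y - x)) 0 0)).
apply: (le_trans (ler_normD _ _)).
have := le_mx_norm (d *m (y - x)) 0 0.
have := norm_mulmx_le d (y - x).
have : `|x - y| <= e / (n%:R * `|d| + 2) by near: y.
rewrite distrC ler_pdivlMr // => h1 h2 h3.
apply: le_trans h1; rewrite mulrDr mulrC addrC.
have h4 : `|f y - f x - (d *m (y - x)) 0 0| <= 1 * `|y - x| by near: y.
apply: lerD; first exact: le_trans h3 h2.
by rewrite (le_trans h4) // mul1r ler_peMr // ler1n.
Unshelve. all: by end_near. Qed.

Lemma carat_cst (c : C) x : carat (fun=> c) x 0.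
Proof.
exists (fun=> 0); split; first exact: cvg_cst.
by near=> p; rewrite subrr mul0mx mxE.
Unshelve. all: by end_near. Qed.

Lemma carat_coord x j : carat (fun v => v j 0) x (delta_mx 0 j).
Proof.
exists (fun=> delta_mx 0 j); split; first exact: cvg_cst.
by near=> p; rewrite -rowE !mxE.
Unshelve. all: by end_near. Qed.

Lemma caratD f g x d d' : carat f x d -> carat g x d' ->
  carat (fun v => f v + g v) x (d + d').
Proof.
move=> [q [qd fq]] [q' [qd' gq']]; exists (fun p => q p + q' p); split.
  exact: cvgD.
near=> p; rewrite mulmxDl mxE.
have <- : f p.1 - f p.2 = (q p *m (p.1 - p.2)) 0 0 by near: p.
have <- : g p.1 - g p.2 = (q' p *m (p.1 - p.2)) 0 0 by near: p.
ring.
Unshelve. all: by end_near. Qed.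

(** In this form of differentiability the product rule is an exact identity between increments, with
    no remainder to estimate. *)
Lemma caratM f g x d d' : carat f x d -> carat g x d' ->
  carat (fun v => f v * g v) x (g x *: d + f x *: d').
Proof.
move=> cf cg; have fc := carat_cvg cf; have gc := carat_cvg cg.
move: cf cg => [q [qd fq]] [q' [qd' gq']].
exists (fun p => g p.1 *: q p + f p.2 *: q' p); split.
  have gc1 : g p.1 @[p --> (x, x)] --> g x by apply: cvg_comp gc; exact: cvg_fst.
  have fc2 : f p.2 @[p --> (x, x)] --> f x by apply: cvg_comp fc; exact: cvg_snd.
  by apply: cvgD; exact: cvgZ.
near=> p; rewrite mulmxDl -!scalemxAl [RHS]mxE [X in _ = X + _]mxE [X in _ = _ + X]mxE.
have <- : f p.1 - f p.2 = (q p *m (p.1 - p.2)) 0 0 by near: p.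
have <- : g p.1 - g p.2 = (q' p *m (p.1 - p.2)) 0 0 by near: p.
ring.
Unshelve. all: by end_near. Qed.

(** [k] is the divided difference of [h]; for the inverse and the square root it is an explicit
    continuous function of two points. *)
Lemma carat_comp (h : C -> C) (k : C * C -> C) (k0 : C) f x d :
  k p @[p --> (f x, f x)] --> k0 ->
  (\forall p \near (f x, f x), h p.1 - h p.2 = k p * (p.1 - p.2)) ->
  carat f x d -> carat (h \o f) x (k0 *: d).
Proof.
move=> kk hk cf; have fc := carat_cvg cf; move: cf => [q [qd fq]].
have ffc : (f p.1, f p.2) @[p --> (x, x)] --> (f x, f x).
  have fc1 : f p.1 @[p --> (x, x)] --> f x by apply: cvg_comp fc; exact: cvg_fst.
  have fc2 : f p.2 @[p --> (x, x)] --> f x by apply: cvg_comp fc; exact: cvg_snd.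
  exact: (cvg_pair fc1 fc2).
exists (fun p => k (f p.1, f p.2) *: q p); split.
  have kf : k (f p.1, f p.2) @[p --> (x, x)] --> k0 by apply: cvg_comp kk; exact: ffc.
  exact: cvgZ.
have {}hk := ffc _ hk; near=> p; rewrite -scalemxAl mxE /=.
have <- : f p.1 - f p.2 = (q p *m (p.1 - p.2)) 0 0 by near: p.
by near: p.
Unshelve. all: by end_near. Qed.

(* Holomorphy near x, with differential d at x. *)
Definition holo f x d := carat f x d /\
  \forall y \near x, exists d', carat f y d'.

Lemma holo_cst (c : C) x : holo (fun=> c) x 0.
Proof.
split; first exact: carat_cst.
by near=> y; exists 0; exact: carat_cst.
Unshelve. all: by end_near. Qed.

Lemma holo_linear x d : holo (fun v => (d *m v) 0 0) x d.
Proof.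
have h y : carat (fun v => (d *m v) 0 0) y d.
  exists (fun=> d); split; first exact: cvg_cst.
  by near=> p; rewrite mulmxBr !mxE.
by split=> //; near=> y; exists d.
Unshelve. all: by end_near. Qed.

Lemma holo_coord x j : holo (fun v => v j 0) x (delta_mx 0 j).
Proof.
split; first exact: carat_coord.
by near=> y; exists (delta_mx 0 j); exact: carat_coord.
Unshelve. all: by end_near. Qed.

Lemma holoD f g x d d' : holo f x d -> holo g x d' ->
  holo (fun v => f v + g v) x (d + d').
Proof.
move=> [cf nf] [cg ng]; split; first exact: caratD.
near=> y.
have [d1 fd] : exists d1, carat f y d1 by near: y.
have [d2 gd] : exists d2, carat g y d2 by near: y.
by exists (d1 + d2); exact: caratD.
Unshelve. all: by end_near. Qed.

Lemma holoM f g x d d' : holo f x d -> holo g x d' ->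
  holo (fun v => f v * g v) x (g x *: d + f x *: d').
Proof.
move=> [cf nf] [cg ng]; split; first exact: caratM.
near=> y.
have [d1 fd] : exists d1, carat f y d1 by near: y.
have [d2 gd] : exists d2, carat g y d2 by near: y.
by exists (g y *: d1 + f y *: d2); exact: caratM.
Unshelve. all: by end_near. Qed.

Lemma holo_cvg f x d : holo f x d -> f y @[y --> x] --> f x.
Proof. by move=> [cf _]; exact: carat_cvg cf. Qed.

Lemma holo_comp (h : C -> C) (k : C * C -> C) f x d :
  (\forall a \near f x, k p @[p --> (a, a)] --> k (a, a) /\
    \forall p \near (a, a), h p.1 - h p.2 = k p * (p.1 - p.2)) ->
  holo f x d -> holo (h \o f) x (k (f x, f x) *: d).
Proof.
move=> hk hf; have fc := holo_cvg hf; move: hf => [cf nf]; split.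
  by have [] := nbhs_singleton hk => k1 k2; exact: carat_comp k1 k2 cf.
have {}hk := fc _ hk; near=> y.
have [d1 fd] : exists d1, carat f y d1 by near: y.
have /= [k1 k2] : (k p @[p --> (f y, f y)] --> k (f y, f y) /\
    \forall p \near (f y, f y), h p.1 - h p.2 = k p * (p.1 - p.2)) by near: y.
by exists (k (f y, f y) *: d1); exact: carat_comp k1 k2 fd.
Unshelve. all: by end_near. Qed.

Lemma holoV f x d : f x != 0 -> holo f x d ->
  holo (fun v => (f v)^-1) x (- ((f x)^-1 * (f x)^-1) *: d).
Proof.
move=> fx hf.
apply: (holo_comp (h := @GRing.inv C) (k := fun p => - (p.1^-1 * p.2^-1))) hf.
have : \forall a \near f x, a != 0.
  have := @cvg_id _ (nbhs (f x)) => /cvgr_neq0; exact.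
apply: filterS => a a0; split.
  apply: cvgN; apply: cvgM; apply: cvgV => //; [exact: cvg_fst|exact: cvg_snd].
have na : \forall b \near a, b != 0.
  have := @cvg_id _ (nbhs a) => /cvgr_neq0; exact.
have n1 : \forall p \near (a, a), p.1 != 0.
  exact: (near_fst na).
have n2 : \forall p \near (a, a), p.2 != 0.
  exact: (near_snd na).
near=> p.
have p1 : p.1 != 0 by near: p.
have p2 : p.2 != 0 by near: p.
by field; rewrite p1 p2.
Unshelve. all: by end_near. Qed.

End Carat.

(** * A holomorphic square root near 1 *)

Section SquareRoot.
Variable C : numClosedFieldType.
Implicit Types z w : C.

(* sqrtC itself is not continuous at 1, since its values have an argument in [0, pi). *)
Definition csqrt z :=
  if `|sqrtC z - 1| <= `|sqrtC z + 1| then sqrtC z else - sqrtC z.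

Lemma csqrtK z : csqrt z ^+ 2 = z.
Proof. by rewrite /csqrt; case: ifP => _; rewrite ?sqrrN sqrtCK. Qed.

Lemma csqrt_dist z : `|csqrt z - 1| <= `|csqrt z + 1|.
Proof.
rewrite /csqrt; case: ifPn => // h.
rewrite -opprD normrN (_ : - _ + 1 = - (sqrtC z - 1)) ?normrN; last by ring.
have := @real_leVge C `|sqrtC z - 1| `|sqrtC z + 1| (normr_real _) (normr_real _).
by rewrite (negbTE h).
Qed.

Lemma csqrt_add1_neq0 z : csqrt z + 1 != 0.
Proof.
apply/eqP => e; have := csqrt_dist z; rewrite e normr0 normr_le0.
rewrite (_ : csqrt z = - 1); last by apply/eqP; rewrite -addr_eq0 e.
by rewrite -opprD oppr_eq0 -[1 + 1]/2%:R pnatr_eq0.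
Qed.

(** For the root s nearer to 1 than to -1, |s - 1|^2 <= |s - 1| |s + 1| = |z - 1|. *)
Lemma csqrt_near1 z : `|z - 1| <= 4^-1 -> `|csqrt z - 1| <= 2^-1.
Proof.
move=> z1; rewrite -(@ler_pXn2r _ 2) ?nnegrE ?invr_ge0 ?ler0n //.
rewrite (_ : 2^-1 ^+ 2 = 4^-1); last by field.
apply: le_trans z1; rewrite -{2}(csqrtK z).
rewrite (_ : _ ^+ 2 - 1 = (csqrt z - 1) * (csqrt z + 1)); last by ring.
by rewrite normrM expr2 ler_wpM2l // csqrt_dist.
Qed.

Lemma csqrt_add_ge1 z w : `|z - 1| <= 4^-1 -> `|w - 1| <= 4^-1 ->
  1 <= `|csqrt z + csqrt w|.
Proof.
move=> /csqrt_near1 hz /csqrt_near1 hw.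
have : `|2 : C| <= `|csqrt z + csqrt w| + (`|csqrt z - 1| + `|csqrt w - 1|).
  apply: le_trans (lerD (lexx _) (ler_normD _ _)).
  apply: le_trans (ler_normB _ _); rewrite (_ : _ - _ = 2) //; ring.
rewrite normr_nat => h; rewrite -(lerD2r (2^-1 + 2^-1)).
apply: le_trans (lerD (lexx _) (lerD hz hw)); apply: le_trans h.
by rewrite (_ : 1 + _ = 2) //; field.
Qed.

Lemma csqrtB z w : `|z - 1| <= 4^-1 -> `|w - 1| <= 4^-1 ->
  csqrt z - csqrt w = (csqrt z + csqrt w)^-1 * (z - w).
Proof.
move=> hz hw; have n0 : csqrt z + csqrt w != 0.
  by rewrite -normr_gt0 (lt_le_trans _ (csqrt_add_ge1 hz hw)).
by apply: (mulfI n0); rewrite mulVKf // -{3}(csqrtK z) -{3}(csqrtK w); ring.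
Qed.

Lemma near_csqrt z : `|z - 1| < 4^-1 -> \forall w \near z, `|w - 1| <= 4^-1.
Proof.
move=> hz; have e0 : 0 < 4^-1 - `|z - 1| by rewrite subr_gt0.
have : \forall w \near z, `|z - w| <= 4^-1 - `|z - 1|.
  by have /cvgrPdist_le := @cvg_id _ (nbhs z); apply.
apply: filterS => w; rewrite lerBrDr distrC => h; apply: le_trans h.
by apply: le_trans (ler_normD _ _); rewrite addrA subrK.
Qed.

Lemma csqrt_cvg z : `|z - 1| < 4^-1 -> csqrt w @[w --> z] --> csqrt z.
Proof.
move=> hz; apply/(@cvgrPdist_le _ _ _ (nbhs z)) => e e0.
have nz := near_csqrt hz.
have Hz : \forall w \near z, `|z - w| <= e.
  by have /cvgrPdist_le := @cvg_id _ (nbhs z); apply.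
near=> w; rewrite csqrtB; [|exact: ltW|by near: w].
apply: (@le_trans _ _ `|z - w|); last by near: w.
rewrite normrM ler_piMl // normfV invf_le1 ?csqrt_add_ge1 //; try exact: ltW.
  by near: w.
by apply: lt_le_trans (csqrt_add_ge1 (ltW hz) _) => //; near: w.
Unshelve. all: by end_near. Qed.

Lemma holo_csqrt n (f : 'cV[C]_n -> C) x d : `|f x - 1| < 4^-1 -> holo f x d ->
  holo (fun v => csqrt (f v)) x ((csqrt (f x) + csqrt (f x))^-1 *: d).
Proof.
move=> fx hf.
apply: (holo_comp (h := csqrt) (k := fun p => (csqrt p.1 + csqrt p.2)^-1)) hf.
have : \forall a \near f x, `|a - 1| < 4^-1.
  have e0 : 0 < 4^-1 - `|f x - 1| by rewrite subr_gt0.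
  have : \forall w \near f x, `|f x - w| < 4^-1 - `|f x - 1|.
    by have /cvgrPdist_lt := @cvg_id _ (nbhs (f x)); apply.
  apply: filterS => w; rewrite ltrBrDr distrC => h; apply: le_lt_trans h.
  by apply: le_trans (ler_normD _ _); rewrite addrA subrK.
apply: filterS => a ha; have ca := csqrt_cvg ha; have na := near_csqrt ha.
split.
  apply: cvgV.
    by rewrite -normr_gt0 (lt_le_trans _ (csqrt_add_ge1 (ltW ha) (ltW ha))).
  have c1 : csqrt p.1 @[p --> (a, a)] --> csqrt a.
    by apply: cvg_comp ca; exact: cvg_fst.
  have c2 : csqrt p.2 @[p --> (a, a)] --> csqrt a.
    by apply: cvg_comp ca; exact: cvg_snd.
  exact: cvgD.
have n1 : \forall p \near (a, a), `|p.1 - 1| <= 4^-1.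
  exact: (near_fst na).
have n2 : \forall p \near (a, a), `|p.2 - 1| <= 4^-1.
  exact: (near_snd na).
by near=> p; apply: csqrtB; near: p.
Unshelve. all: by end_near. Qed.

End SquareRoot.

(** * The inverse function theorem *)

Section NearIdentity.
Variables (C : numFieldType) (V : normedModType C).

(* The form of completeness that the contraction argument needs. *)
Definition geometric_complete := forall (u : nat -> V) (M : C), 0 <= M ->
  (forall k, `|u k.+1 - u k| <= M / 2 ^+ k) -> exists l : V, u k @[k --> \oo] --> l.

Variables (f : V -> V) (x0 : V) (r : C).
Hypothesis r0 : 0 < r.
Hypothesis f_near_id : forall y z, `|y - x0| < r -> `|z - x0| < r ->
  `|(y - z) - (f y - f z)| <= 2^-1 * `|y - z|.

Lemma near_id_expand y z : `|y - x0| < r -> `|z - x0| < r ->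
  `|y - z| <= 2 * `|f y - f z|.
Proof.
move=> hy hz; have h := f_near_id hy hz.
have h2 : `|y - z| <= 2^-1 * `|y - z| + `|f y - f z|.
  apply: le_trans (lerD h (lexx _)).
  by rewrite -[X in `|X| <= _](subrK (f y - f z)) ler_normD.
rewrite -(@ler_pM2l _ 2^-1) ?invr_gt0 ?ltr0n // mulKf ?pnatr_eq0 //.
rewrite -(lerD2l (2^-1 * `|y - z|)) -mulrDl (_ : 2^-1 + 2^-1 = 1) ?mul1r //.
by field.
Qed.

Lemma near_id_surj w : geometric_complete -> `|w - f x0| < r / 4 ->
  exists2 y, `|y - x0| < r & f y = w.
Proof.
move=> gc hw; set e := `|w - f x0| in hw.
have e0 : 0 <= e by exact: normr_ge0.
(* A fixed point of [T] solves f y = w. [T] contracts by 1/2 and its first step from [x0] has length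
   [e], so the whole path is shorter than 2 e. *)
pose T y := y - f y + w; pose u k := iter k T x0.
have uS k : u k.+1 = T (u k) by [].
(* The radius r / 4 for [w] leaves a margin, so that the limit also lies in the open ball of radius
   [r]. *)
have er : 2 * e < r / 2.
  by rewrite -ltr_pdivlMl ?ltr0n // (_ : 2^-1 * _ = r / 4) //; field.
have r2 : r / 2 < r.
  by rewrite ltr_pdivrMr ?ltr0n // mulr_natr mulr2n ltrDl.
have Tlip y z : `|y - x0| < r -> `|z - x0| < r -> `|T y - T z| <= 2^-1 * `|y - z|.
  move=> hy hz; apply: le_trans (f_near_id hy hz).
  rewrite /T opprD addrACA subrr addr0 opprB (addrC (f z)) addrACA.
  by rewrite opprB (addrC (f z)).
have inv2 k : (2 ^+ k)^-1 = 2 * (2 ^+ k.+1)^-1 :> C.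
  by rewrite exprS; field; rewrite expf_neq0 // pnatr_eq0.
have key k : `|u k - x0| <= 2 * e * (1 - (2 ^+ k)^-1) /\ `|u k.+1 - u k| <= e / 2 ^+ k.
  elim: k => [|k [h1 h2]].
    rewrite expr0 invr1 mulr1 /u /= !subrr mulr0 normr0; split=> //.
    by rewrite /T -(addrA x0) (addrC x0) addrK addrC.
  have h3 : `|u k.+1 - x0| <= 2 * e * (1 - (2 ^+ k.+1)^-1).
    rewrite -[u k.+1](subrK (u k)) -addrA (le_trans (ler_normD _ _)) //.
    apply: le_trans (lerD h2 h1) _; rewrite inv2 le_eqVlt; apply/orP; left.
    by apply/eqP; ring.
  split=> //.
  have lt1 m : 2 * e * (1 - (2 ^+ m)^-1) < r.
    apply: le_lt_trans r2; apply: le_trans (ltW er).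
    by rewrite ler_piMr ?mulr_ge0 // gerBl invr_ge0 exprn_ge0.
  rewrite uS {2}uS; apply: le_trans (Tlip _ _ _ _) _.
  - exact: le_lt_trans h3 (lt1 _).
  - exact: le_lt_trans h1 (lt1 _).
  apply: le_trans (ler_wpM2l _ h2) _; first by rewrite invr_ge0.
  by rewrite exprS invfM mulrCA.
have [l ul] := gc u e e0 (fun k => (key k).2).
have ul' (a : C) : 0 < a -> exists k, `|l - u k| <= a /\ `|l - u k.+1| <= a.
  move=> a0; have /cvgrPdist_le /(_ a a0) [N _ uN] := ul.
  by exists N; split; apply: uN => //=.
have uk k : `|u k - x0| <= 2 * e.
  have [h _] := key k; apply: le_trans h _.
  by rewrite ler_piMr ?mulr_ge0 // gerBl invr_ge0 exprn_ge0.
have lr : `|l - x0| < r.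
  have [|k [h _]] := ul' (r / 2 - 2 * e); first by rewrite subr_gt0.
  apply: le_lt_trans r2; rewrite -[l](subrK (u k)) -addrA.
  by apply: le_trans (ler_normD _ _) _; apply: le_trans (lerD h (uk k)) _; rewrite subrK.
exists l => //; have : T l - l = 0.
  apply/eqP; rewrite -normr_eq0 eq_le normr_ge0 andbT.
  apply/ler_addgt0Pr => a a0; rewrite add0r.
  have [|k [h1 h2]] := ul' (a / 2); first by rewrite divr_gt0.
  rewrite (_ : T l - l = (T l - T (u k)) - (l - u k.+1)); last first.
    by rewrite uS opprB addrA subrK.
  apply: le_trans (ler_normB _ _) _.
  apply: (@le_trans _ _ (a / 2 + a / 2)); last by rewrite -splitr.
  apply: lerD h2; apply: le_trans (Tlip _ _ lr _) _.
    by apply: le_lt_trans (uk k) _; exact: lt_trans er r2.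
  apply: le_trans h1; rewrite ler_piMl // invf_le1 ?ltr0n //.
  by rewrite ler1n.
by move=> /eqP; rewrite /T -(addrA l) (addrC l) addrK addrC subr_eq0 => /eqP.
Qed.

End NearIdentity.

Lemma differentiable_eps (K : numFieldType) (V W : normedModType K)
    (f : V -> W) (L : {linear V -> W}) x : continuous L ->
  (forall e : K, 0 < e -> \forall y \near x,
    `|f y - f x - L (y - x)| <= e * `|y - x|) -> differentiable f x.
Proof.
move=> cL fM; have dL : f \o shift x = cst (f x) + L +o_ 0 id.
  apply/eqaddoP => e e0; have := fM e e0; rewrite (near_shift 0) /= => h.
  apply: filterS h => y /=; rewrite subr0 addrK => h.
  by apply: le_trans h; rewrite !fctE /= opprD addrA.
have LE := diff_unique cL dL.
by apply/diff_locallyP; rewrite LE.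
Qed.

Section Differential.
Variables (C : numFieldType) (n : nat).
Local Notation V := 'cV[C]_n.
Implicit Types (f g : V -> V) (x y z : V) (M : 'M[C]_n).

Definition mdiff f x M := forall e : C, 0 < e ->
  \forall y \near x, `|f y - f x - M *m (y - x)| <= e * `|y - x|.

Lemma mulmx_continuous M : continuous (mulmx M : V -> V).
Proof.
move=> x; apply/(@cvgrPdist_le _ _ _ (nbhs x)) => e e0.
have n0 : 0 < n%:R * `|M| + 1 :> C by rewrite ltr_wpDl // mulr_ge0.
have Hx : \forall y \near x, `|x - y| <= e / (n%:R * `|M| + 1).
  by have /cvgrPdist_le := @cvg_id _ (nbhs x); apply; rewrite divr_gt0.
near=> y; rewrite -mulmxBr; apply: le_trans (norm_mulmx_le _ _) _.
have : `|x - y| <= e / (n%:R * `|M| + 1) by near: y.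
rewrite ler_pdivlMr // => h; apply: le_trans h; rewrite mulrC ler_wpM2l //.
by rewrite lerDl.
Unshelve. all: by end_near. Qed.

Lemma mdiff_differentiable f x M : mdiff f x M -> differentiable f x.
Proof.
move=> fM.
exact: (differentiable_eps (L := mulmx M : {linear V -> V})
  (@mulmx_continuous M) fM).
Qed.

(** A kernel vector would satisfy |h| <= 3/4 |h|. *)
Lemma near_id_unitmx M : (forall h : V, `|M *m h - h| <= 3 / 4 * `|h|) ->
  M \in unitmx.
Proof.
move=> hM; rewrite -unitmx_tr -row_free_unit; apply: inj_row_free => v vM.
have := hM v^T; rewrite -[M]trmxK -trmx_mul vM trmx0 sub0r normrN.
rewrite -{1}[`|v^T|]mul1r -subr_ge0 -mulrBl.
rewrite (_ : 3 / 4 - 1 = - 4^-1); last by field.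
rewrite mulNr oppr_ge0 pmulr_rle0 ?invr_gt0 ?ltr0n // normr_le0.
by move=> /eqP/(congr1 trmx); rewrite trmxK trmx0.
Qed.

End Differential.

Section InverseFunction.
Variables (C : numFieldType) (n : nat).
Local Notation V := 'cV[C]_n.
Variables (phi : V -> V) (x0 : V) (M0 : 'M[C]_n) (good : V -> Prop).
Hypothesis complete : geometric_complete V.
Hypothesis uM0 : M0 \in unitmx.
Hypothesis phi_strict : forall e : C, 0 < e -> \forall p \near (x0, x0),
  `|phi p.1 - phi p.2 - M0 *m (p.1 - p.2)| <= e * `|p.1 - p.2|.
Hypothesis phi_diff : \forall x \near x0, good x /\ exists M, mdiff phi x M.

Let P := invmx M0.
Let f y := P *m phi y.
Let K := n%:R * `|P| + 1.

Let K_gt0 : 0 < K. Proof. by rewrite /K ltr_wpDl // mulr_ge0. Qed.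

Let norm_P (y : V) : `|P *m y| <= K * `|y|.
Proof.
apply: le_trans (norm_mulmx_le _ _) _.
by rewrite ler_wpM2r // /K lerDl.
Qed.

Let ex_radius : exists2 r : C, 0 < r &
  (forall y z, `|y - x0| < r -> `|z - x0| < r ->
    `|(y - z) - (f y - f z)| <= 2^-1 * `|y - z|) /\
  (forall x, `|x - x0| < r -> good x /\ exists M, mdiff phi x M).
Proof.
have e0 : 0 < 2^-1 / K by rewrite divr_gt0 // invr_gt0 ltr0n.
have h1 := phi_strict e0.
have h2 := near_fst phi_diff.
have [[A B] /= [nA nB] AB] := filterI h1 h2.
have nAB : nbhs (x0 : V) (A `&` B) by exact: filterI.
have /(nbhs_ballP x0) [r /= r0 hr] := nAB.
have {}hr y : `|y - x0| < r -> A y /\ B y.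
  by move=> hy; apply: hr; rewrite -ball_normE /= distrC.
exists r => //; split=> [y z hy hz|x hx].
  have [] := AB (y, z); first by split=> /=; [have [] := hr y hy|have [] := hr z hz].
  move=> /= h _; rewrite /f -mulmxBr.
  have -> : y - z = P *m (M0 *m (y - z)) by rewrite mulmxA mulVmx // mul1mx.
  rewrite -mulmxBr -normrN -mulmxN opprB; apply: le_trans (norm_P _) _.
  rewrite mulmxA mulVmx // mul1mx.
  by rewrite -ler_pdivlMl // mulrA (mulrC _ 2^-1).
have [Ax Bx] := hr x hx.
by have [_ []] := AB (x, x) (conj Ax Bx).
Qed.

(** Strict differentiability at [x0] alone makes P phi a small perturbation of the identity; at the
    nearby points plain differentiability is enough to differentiate the inverse. [good] is any
    property valid near [x0], carried along so that [U] is small enough for it. *)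
Theorem inverse_function : exists (U W : set V) (psi : V -> V),
  [/\ [/\ open U, open W, U x0 & W (phi x0)],
      forall u, U u -> [/\ good u, W (phi u) & psi (phi u) = u],
      forall w, W w -> U (psi w) /\ phi (psi w) = w,
      forall u, U u -> differentiable phi u &
      forall w, W w -> differentiable psi w].
Proof.
have [r r0 [fr dgr]] := ex_radius.
have dr x hx := (dgr x hx).2.
have PK (y : V) : M0 *m (P *m y) = y by rewrite mulmxA mulmxV // mul1mx.
pose W : set V := [set w | `|P *m w - f x0| < r / 4].
pose U : set V := [set u | `|u - x0| < r /\ W (phi u)].
have r4 : 0 < r / 4 by rewrite divr_gt0 // ltr0n.
have psiP w : W w -> exists u, `|u - x0| < r /\ phi u = w.
  move=> Ww; have [u ur fu] := near_id_surj r0 fr complete Ww.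
  by exists u; split=> //; rewrite -(PK (phi u)) -/(f u) fu PK.
(* Where no preimage exists, [psi] takes the default value [x0]. *)
pose psi w := xget x0 [set u | `|u - x0| < r /\ phi u = w].
have {}psiP w : W w -> `|psi w - x0| < r /\ phi (psi w) = w.
  by move=> /psiP [u hu]; rewrite /psi; case: xgetP => [v -> //|/(_ u)].
have inj u v : `|u - x0| < r -> `|v - x0| < r -> phi u = phi v -> u = v.
  move=> hu hv e; apply/eqP; rewrite -subr_eq0 -normr_le0.
  by apply: le_trans (near_id_expand fr hu hv) _; rewrite /f e subrr normr0 mulr0.
have phic x : `|x - x0| < r -> phi y @[y --> x] --> phi x.
  move=> /dr [M /mdiff_differentiable]; exact: differentiable_continuous.
have opW : open W.
  rewrite (_ : W = (fun w => P *m w) @^-1` (ball (f x0) (r / 4))).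
    by apply: open_comp; [move=> w _; exact: mulmx_continuous|exact: ball_open].
  by apply/seteqP; split => w; rewrite /W /= -ball_normE /= distrC.
have opball : open [set u : V | `|u - x0| < r].
  rewrite (_ : [set _ | _] = ball x0 r); first exact: ball_open.
  by apply/seteqP; split => u; rewrite /= -ball_normE /= distrC.
have opU : open U.
  rewrite openE => u [ur Wu]; rewrite /interior.
  have h1 := open_nbhs_nbhs (conj opball ur).
  have h2 := phic u ur _ (open_nbhs_nbhs (conj opW Wu)).
  exact: filterI h1 h2.
have Wx0 : W (phi x0) by rewrite /W /= /f subrr normr0.
exists U, W, psi; split.
- by split=> //; split; rewrite ?subrr ?normr0.
- move=> u [ur Wu]; have [h1 h2] := psiP _ Wu.
  by split=> //; [have [] := dgr u ur|exact: inj].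
- by move=> w Ww; have [h1 h2] := psiP _ Ww; split=> //; split; rewrite ?h2.
- by move=> u [ur _]; have [M /mdiff_differentiable] := dr u ur.
move=> w0 Ww0; have [xr xw] := psiP _ Ww0; set x := psi w0 in xr xw.
have [M hM] := dr x xr.
have lip w : W w -> `|psi w - x| <= 2 * K * `|w - w0|.
  move=> Ww; have [h1 h2] := psiP _ Ww.
  apply: le_trans (near_id_expand fr h1 xr) _; rewrite -mulrA ler_wpM2l //.
  by rewrite /f -mulmxBr h2 xw norm_P.
have psic : psi w @[w --> w0] --> x.
  apply/(@cvgrPdist_le _ _ _ (nbhs w0)) => e e0.
  have k0 : 0 < 2 * K by rewrite mulr_gt0 // ltr0n.
  have Hw : \forall w \near w0, `|w0 - w| <= e / (2 * K).
    by have /cvgrPdist_le := @cvg_id _ (nbhs w0); apply; rewrite divr_gt0.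
  have nW : \forall w \near w0, W w by exact: open_nbhs_nbhs.
  near=> w; rewrite distrC; apply: le_trans (lip w _) _; first by near: w.
  by rewrite mulrC -ler_pdivlMr // distrC; near: w.
(* The bound 1/2 on increments of the perturbation passes to its derivative; the differentiability
   error adds 1/4, which gives the 3/4 of [near_id_unitmx]. *)
have uM : M \in unitmx.
  suff : P *m M \in unitmx by rewrite unitmx_mul => /andP[].
  apply: near_id_unitmx => h.
  have e0 : 0 < 4^-1 / K by rewrite divr_gt0 // invr_gt0 ltr0n.
  have nx : nbhs x [set u : V | `|u - x0| < r].
    by apply: open_nbhs_nbhs; split.
  have nAB : nbhs (x : V) ([set u | `|u - x0| < r] `&`
      [set y | `|phi y - phi x - M *m (y - x)| <= 4^-1 / K * `|y - x|]).
    exact: filterI nx (hM _ e0).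
  have /(nbhs_ballP x) [s /= s0 hs] := nAB.
  have h1 : 0 < `|h| + 1 by rewrite ltr_wpDl.
  pose t := s / (`|h| + 1); have t0 : 0 < t by rewrite divr_gt0.
  have [] := hs (t *: h + x).
    rewrite -ball_normE /= distrC addrK normrZ gtr0_norm //.
    by rewrite /t mulrAC ltr_pdivrMr // ltr_pM2l // ltrDl.
  rewrite /= addrK => yr ye.
  rewrite -(ler_pM2l t0) mulrCA.
  have -> : t * `|P *m M *m h - h| =
      `|P *m (phi (t *: h + x) - phi x) - t *: h
        - P *m (phi (t *: h + x) - phi x - M *m (t *: h))|.
    move: (phi _ - phi x) => D.
    rewrite (mulmxBr P D) opprB [X in _ = `|X|]addrC subrKA -mulmxA -!scalemxAr -scalerBr.
    by rewrite normrZ gtr0_norm.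
  apply: le_trans (ler_normB _ _) _.
  have -> : 3 / 4 * (t * `|h|) = 2^-1 * (t * `|h|) + 4^-1 * (t * `|h|) by field.
  have nt : t * `|h| = `|t *: h| by rewrite normrZ gtr0_norm.
  apply: lerD; rewrite nt.
    by have := fr _ _ yr xr; rewrite addrK distrC /f -mulmxBr.
  apply: le_trans (norm_P _) _.
  rewrite mulrC -ler_pdivlMr //; apply: le_trans ye _.
  by rewrite mulrAC.
apply: (@mdiff_differentiable _ _ _ _ (invmx M)) => e e0.
pose k := n%:R * `|invmx M| + 1.
have k0 : 0 < k by rewrite /k ltr_wpDl // mulr_ge0.
(* [k] pays for multiplying by [invmx M], and 2 K is the Lipschitz constant of [psi]. *)
have e1 : 0 < e / (k * (2 * K)) by rewrite divr_gt0 // !mulr_gt0 // ltr0n.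
have nM := psic _ (hM _ e1).
have nW : \forall w \near w0, W w by exact: open_nbhs_nbhs.
near=> w.
have Ww : W w by near: w.
have [h1 h2] := psiP _ Ww.
have : `|phi (psi w) - phi x - M *m (psi w - x)| <= e / (k * (2 * K)) * `|psi w - x|.
  by near: w.
rewrite h2 xw => h.
rewrite -/x (_ : psi w - x = invmx M *m (M *m (psi w - x))); last first.
  by rewrite mulmxA mulVmx // mul1mx.
rewrite -mulmxBr -normrN -mulmxN opprB.
apply: le_trans (norm_mulmx_le _ _) _.
apply: (@le_trans _ _ (k * (e / (k * (2 * K)) * `|psi w - x|))).
  by apply: ler_pM; rewrite ?mulr_ge0 // /k lerDl.
apply: (@le_trans _ _ (k * (e / (k * (2 * K)) * (2 * K * `|w - w0|)))).
  rewrite ler_pM2l // ler_pM2l //; exact: lip.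
rewrite le_eqVlt; apply/orP; left; apply/eqP; field.
by rewrite !gt_eqF.
Unshelve. all: by end_near. Qed.

End InverseFunction.

(** * Completeness of the complex column spaces *)

Lemma cvg_halving (R : realType) (M : R) : M / 2 ^+ k @[k --> \oo] --> 0.
Proof.
have := @cvg_geometric R M 2^-1; rewrite gtr0_norm ?invr_gt0 ?ltr0n //.
rewrite invf_lt1 ?ltr0n ?ltr1n // => /(_ isT).
by apply: cvg_trans; apply: near_eq_cvg; near=> k; rewrite /geometric /= exprVn.
Unshelve. all: by end_near. Qed.

(** With a_k = M / 2^k the sequences u_k - 2 a_k and u_k + 2 a_k are monotone and enclose u_k, so
    monotone convergence suffices. *)
Lemma geometric_complete_real (R : realType) (u : nat -> R) (M : R) : 0 <= M ->
  (forall k, `|u k.+1 - u k| <= M / 2 ^+ k) -> exists l : R, u k @[k --> \oo] --> l.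
Proof.
move=> M0 hu; pose a k := M / 2 ^+ k.
have a0 k : 0 <= a k by rewrite divr_ge0 // exprn_ge0.
have aS k : a k.+1 = a k / 2.
  by rewrite /a exprS; field; rewrite expf_neq0 // pnatr_eq0.
have low : nondecreasing_seq (fun k => u k - 2 * a k).
  apply/nondecreasing_seqP => k; rewrite aS.
  have := hu k; rewrite ler_norml -/(a k) => /andP[h1 _]; lra.
have high : nonincreasing_seq (fun k => u k + 2 * a k).
  apply/nonincreasing_seqP => k; rewrite aS.
  have := hu k; rewrite ler_norml -/(a k) => /andP[_ h1]; lra.
have ub : has_ubound (range (fun k => u k - 2 * a k)).
  exists (u 0 + 2 * a 0) => _ [k _ <-].
  have := high 0 k (leq0n k); have := a0 k; lra.
have := nondecreasing_cvgn low ub; move: (sup _) => s h1.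
exists (s + 2 * 0).
have h2 : 2 * a k @[k --> \oo] --> (2 * 0 : R).
  by apply: cvgM; [exact: cvg_cst|exact: cvg_halving].
have <- : (fun k => u k - 2 * a k + 2 * a k) = u.
  by apply: funext => k; rewrite subrK.
exact: cvgD h1 h2.
Qed.

Section Complex.
Variable R : realType.
Local Notation C := R[i].

Lemma norm_complex_le (x : C) :
  `|x| <= (`|complex.Re x| + `|complex.Im x|)%:C%C.
Proof.
rewrite {1}(complexE x) rmorphD /=.
apply: le_trans (ler_normD _ _) _; rewrite normrM.
rewrite !normc_def /= !expr0n /= !addr0 !add0r expr1n !sqrtr_sqr sqrtr1 mul1r.
exact: lexx.
Qed.

Lemma normc_ge_Im (x : C) : (`|complex.Im x|)%:C%C <= `|x|.
Proof.
rewrite normc_def lecR -sqrtr_sqr ler_sqrt ?addr_ge0 ?sqr_ge0 //.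
by rewrite lerDr sqr_ge0.
Qed.

Lemma complex_gt0E (e : C) : 0 < e -> e = (complex.Re e)%:C%C /\ 0 < complex.Re e.
Proof. by case: e => a b; rewrite ltcE /= => /andP[/eqP -> ?]. Qed.

Lemma geometric_complete_complex (u : nat -> C) (M : C) : 0 <= M ->
  (forall k, `|u k.+1 - u k| <= M / 2 ^+ k) ->
  exists l : C, forall e : C, 0 < e -> \forall k \near \oo, `|l - u k| <= e.
Proof.
move=> M0 hu; pose m := complex.Re M.
have [ME m0] : M = m%:C%C /\ 0 <= m.
  by rewrite /m; case: (M) M0 => a b; rewrite lecE /= => /andP[/eqP -> ?].
have bnd k : M / 2 ^+ k = (m / 2 ^+ k)%:C%C.
  by rewrite ME rmorphM /= fmorphV /= rmorphXn /= rmorph_nat.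
have hRe k : `|complex.Re (u k.+1) - complex.Re (u k)| <= m / 2 ^+ k.
  rewrite -lecR -bnd; apply: le_trans (hu k).
  by rewrite -raddfB; exact: normc_ge_Re.
have hIm k : `|complex.Im (u k.+1) - complex.Im (u k)| <= m / 2 ^+ k.
  rewrite -lecR -bnd; apply: le_trans (hu k).
  by rewrite -raddfB; exact: normc_ge_Im.
have [a /cvgrPdist_le ha] := geometric_complete_real m0 hRe.
have [b /cvgrPdist_le hb] := geometric_complete_real m0 hIm.
exists (a +i* b)%C => e /complex_gt0E [eE e0].
have e2 : 0 < complex.Re e / 2 by rewrite divr_gt0.
near=> k; apply: le_trans (norm_complex_le _) _; rewrite eE lecR.
rewrite !raddfB /= [leRHS]splitr; apply: lerD; near: k; [exact: ha|exact: hb].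
Unshelve. all: by end_near. Qed.

Lemma geometric_complete_cV n : geometric_complete ('cV[C]_n : normedModType C).
Proof.
move=> u M M0 hu.
have ex i : exists l : C, forall e : C, 0 < e ->
    \forall k \near \oo, `|l - u k i 0| <= e.
  apply: (geometric_complete_complex M0) => k; apply: le_trans (hu k).
  by have := le_mx_norm (u k.+1 - u k) i 0; rewrite !mxE.
have [l hl] := choice ex.
exists (\col_i l i); apply/cvgrPdist_le => e e0.
have : \forall k \near \oo, forall i, `|l i - u k i 0| <= e.
  by apply: filter_forall => i; exact: hl.
apply: filterS => k hk.
apply: mx_norm_le => [|i j]; first exact: ltW.
by rewrite ord1 !mxE.
Qed.

End Complex.

(** * The local equation at the cusp *)

Section LocalForm.
Variable K : comNzRingType.
Implicit Types r m u w x y z : K.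

(* The arguments of Phi at (x, y, z, 1), where x, y, z are m + xi + eta, m + o xi + o^2 eta,
   m + o^2 xi + o eta for a primitive cube root o of 1, in terms of m, u = xi eta and
   w = xi^3 + eta^3. *)
Definition nD m u w := m ^+ 3 - 3 * m * u + w.
(** [nS] is the second elementary symmetric function of x^2, y^2, z^2, and [nT] that of x^4, y^4,
    z^4. *)
Definition nS m u w := 3 * m ^+ 4 + 9 * u ^+ 2 - 6 * m * w.
Definition nA m u w := 1 + 3 * m ^+ 4 + u * (36 * m ^+ 2 + 18 * u) + w * (12 * m).
Definition nT m u w := nS m u w ^+ 2 - 2 * (3 * m ^+ 2 + 6 * u) * nD m u w ^+ 2.
Definition nB m u w := nA m u w - 1 + nT m u w.
Definition nE m u w := nT m u w + nD m u w ^+ 4.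
Definition locform r m u w := Phi r (nA m u w) (nB m u w) (nE m u w) (nD m u w).

Lemma form12_locform r o m xi eta : o ^+ 2 = - 1 - o ->
  form12 r (m + xi + eta) (m + o * xi + o ^+ 2 * eta)
    (m + o ^+ 2 * xi + o * eta) 1 =
  locform r m (xi * eta) (xi ^+ 3 + eta ^+ 3).
Proof.
move=> ho.
(* Graeffe's root squaring, applied twice, passes from the elementary symmetric functions of x, y, z
   to those of the fourth powers. *)
have sym x y z :
    form12 r x y z 1 =
    (let e1 := x + y + z in let e2 := x * y + y * z + z * x in let e3 := x * y * z in
     let s1 := e1 ^+ 2 - 2 * e2 in let s2 := e2 ^+ 2 - 2 * e1 * e3 in
     let t1 := s1 ^+ 2 - 2 * s2 in let t2 := s2 ^+ 2 - 2 * s1 * e3 ^+ 2 in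
     Phi r (1 + t1) (t1 + t2) (t2 + e3 ^+ 4) e3).
  by rewrite /form12 /Phi /esym1 /esym2 /esym3; ring.
rewrite sym; cbv zeta.
have -> : m + xi + eta + (m + o * xi + o ^+ 2 * eta) +
    (m + o ^+ 2 * xi + o * eta) = 3 * m by ring: ho.
set e2 := _ + _ * (m + xi + eta).
have -> : e2 = 3 * m ^+ 2 - 3 * (xi * eta) by rewrite /e2; ring: ho.
set e3 := _ * (m + o ^+ 2 * xi + o * eta).
have -> : e3 = nD m (xi * eta) (xi ^+ 3 + eta ^+ 3).
  by rewrite /e3 /nD; ring: ho.
rewrite /locform /nE /nB /nT /nA /nS.
move: (xi * eta) (xi ^+ 3 + eta ^+ 3) => u w.
have -> : (3 * m ^+ 2 - 3 * u) ^+ 2 - 2 * (3 * m) * nD m u w =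
  3 * m ^+ 4 + 9 * u ^+ 2 - 6 * m * w by rewrite /nD; ring.
have -> : (3 * m) ^+ 2 - 2 * (3 * m ^+ 2 - 3 * u) = 3 * m ^+ 2 + 6 * u by ring.
by move: (nD m u w) => D; congr Phi; ring.
Qed.

(** The suffixes denote the coefficients of an exact decomposition f = f(m, 0, 0) + u f_u + w f_w,
    not derivatives. [nQ] and the [dPhi] functions are the divided differences of the fourth power
    and of [Phi] between (m, 0, 0) and (m, u, w). *)
Definition nT_u m u w := 9 * u * (nS m u w + 3 * m ^+ 4) - 2 * (6 * nD m u w ^+ 2
  + 3 * m ^+ 2 * (- 3 * m) * (nD m u w + m ^+ 3)).
Definition nT_w m u w := - 6 * m * (nS m u w + 3 * m ^+ 4) - 2 * (3 * m ^+ 2 * (nD m u w + m ^+ 3)).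
Definition nQ m u w := (nD m u w + m ^+ 3) * (nD m u w ^+ 2 + m ^+ 6).
Definition dPhiA r m u w := let A := nA m u w in let A0 := nA m 0 0 in let D := nD m u w in
  - 72 * (3 + r) * nB m u w + (5 - 3 * r) * (A ^+ 2 + A * A0 + A0 ^+ 2)
  + 36 * (7 - r) * (A + A0) * D + 288 * (12 + r) * D ^+ 2.
Definition dPhiB r m u w := - 72 * (3 + r) * nA m 0 0 + 864 * (r - 1) * nD m u w.
Definition dPhiD r m u w := let A0 := nA m 0 0 in let D := nD m u w in let D0 := m ^+ 3 in
  864 * (r - 1) * nB m 0 0 + 36 * (7 - r) * A0 ^+ 2 + 288 * (12 + r) * A0 * (D + D0)
  + 3456 * (1 + 2 * r) * (D ^+ 2 + D * D0 + D0 ^+ 2).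

Definition locform_u r m u w :=
  (36 * m ^+ 2 + 18 * u) * dPhiA r m u w + (36 * m ^+ 2 + 18 * u + nT_u m u w) * dPhiB r m u w
  + 3456 * (nT_u m u w - 3 * m * nQ m u w) - 3 * m * dPhiD r m u w.
Definition locform_w r m u w :=
  12 * m * dPhiA r m u w + (12 * m + nT_w m u w) * dPhiB r m u w
  + 3456 * (nT_w m u w + nQ m u w) + dPhiD r m u w.

Lemma locform_split r m u w :
  locform r m u w = locform r m 0 0 + u * locform_u r m u w + w * locform_w r m u w.
Proof.
have eD : nD m u w = m ^+ 3 + u * (- 3 * m) + w by rewrite /nD; ring.
have eS : nS m u w = 3 * m ^+ 4 + u * (9 * u) + w * (- 6 * m) by rewrite /nS; ring.
have eT : nT m u w = nT m 0 0 + u * nT_u m u w + w * nT_w m u w.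
  by rewrite /nT_u /nT_w /nT eD eS /nD /nS; ring.
have eA : nA m u w = nA m 0 0 + u * (36 * m ^+ 2 + 18 * u) + w * (12 * m).
  by rewrite /nA; ring.
have eB : nB m u w = nB m 0 0 + u * (36 * m ^+ 2 + 18 * u + nT_u m u w)
    + w * (12 * m + nT_w m u w).
  by rewrite /nB eA eT; ring.
have eE : nE m u w = nE m 0 0 + u * (nT_u m u w - 3 * m * nQ m u w)
    + w * (nT_w m u w + nQ m u w).
  by rewrite /nE eT /nQ eD /nD; ring.
have gen (A B E D A0 B0 E0 D0 a1 a2 b1 b2 e1 e2 d1 d2 : K) :
    A = A0 + u * a1 + w * a2 -> B = B0 + u * b1 + w * b2 ->
    E = E0 + u * e1 + w * e2 -> D = D0 + u * d1 + w * d2 ->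
    let dA := - 72 * (3 + r) * B + (5 - 3 * r) * (A ^+ 2 + A * A0 + A0 ^+ 2)
      + 36 * (7 - r) * (A + A0) * D + 288 * (12 + r) * D ^+ 2 in
    let dB := - 72 * (3 + r) * A0 + 864 * (r - 1) * D in
    let dD := 864 * (r - 1) * B0 + 36 * (7 - r) * A0 ^+ 2 + 288 * (12 + r) * A0 * (D + D0)
      + 3456 * (1 + 2 * r) * (D ^+ 2 + D * D0 + D0 ^+ 2) in
    Phi r A B E D = Phi r A0 B0 E0 D0
      + u * (a1 * dA + b1 * dB + 3456 * e1 + d1 * dD)
      + w * (a2 * dA + b2 * dB + 3456 * e2 + d2 * dD).
  by move=> -> -> -> ->; cbv zeta; rewrite /Phi; ring.
have eD' : nD m u w = nD m 0 0 + u * (- 3 * m) + w * 1 by rewrite /nD; ring.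
rewrite /locform (gen _ _ _ _ _ _ _ _ _ _ _ _ _ _ _ _ eA eB eE eD').
have eD0 : nD m 0 0 = m ^+ 3 by rewrite /nD; ring.
rewrite /locform_u /locform_w /dPhiA /dPhiB /dPhiD eD0; cbv zeta.
congr (_ + _ * _ + _ * _); ring.
Qed.

Lemma locform_u00 r m :
  let A := 1 + 3 * m ^+ 4 in let B := 3 * m ^+ 4 + 3 * m ^+ 8 in
  locform_u r m 0 0 =
  36 * m ^+ 2 * PhiA r A B (m ^+ 3)
  + (36 * m ^+ 2 + 24 * m ^+ 6) * PhiB r A (m ^+ 3)
  + 3456 * (24 * m ^+ 6 - 12 * m ^+ 10) - 3 * m * PhiD r A B (m ^+ 3).
Proof.
cbv zeta; rewrite /locform_u /dPhiA /dPhiB /dPhiD /nT_u /nQ /nB /nE /nT /nA /nS /nD.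
by rewrite /PhiA /PhiB /PhiD; ring.
Qed.

(** The polynomial [sextic_111t] with its coefficients reversed, since (m : m : m : 1) = (1 : 1 : 1
    : 1/m). *)
Definition loccofactor r m :=
  (5 - 3 * r) + (18 - 12 * r) * m + (9 - 21 * r) * m ^+ 2 + (108 - 84 * r) * m ^+ 3
  + (351 - 225 * r) * m ^+ 4 + (162 - 144 * r) * m ^+ 5 + (243 - 183 * r) * m ^+ 6.

Lemma locform_line r m : r ^+ 2 = 3 ->
  locform r m 0 0 = (1 - (3 + r) * m - r * m ^+ 2) ^+ 3 * loccofactor r m.
Proof.
move=> hr; rewrite /locform /loccofactor /Phi /nB /nE /nT /nA /nS /nD; ring: hr.
Qed.

End LocalForm.

(** * Closure properties of holomorphic functions *)

Section Hol.
Variables (C : numClosedFieldType) (n : nat).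
Implicit Types (f g : 'cV[C]_n -> C) (x : 'cV[C]_n).

(** Most auxiliary functions enter the coordinates only through terms whose factors vanish at the
    cusp, so their differentials can stay unnamed. *)
Definition hol f x := exists d, holo f x d.

Lemma hol_cst (c : C) x : hol (fun=> c) x.
Proof. by exists 0; exact: holo_cst. Qed.

Lemma hol_coord j x : hol (fun v => v j 0) x.
Proof. by exists (delta_mx 0 j); exact: holo_coord. Qed.

Lemma holD f g x : hol f x -> hol g x -> hol (fun v => f v + g v) x.
Proof. by move=> [d fd] [d' gd]; exists (d + d'); exact: holoD. Qed.

Lemma holM f g x : hol f x -> hol g x -> hol (fun v => f v * g v) x.
Proof.
by move=> [d fd] [d' gd]; exists (g x *: d + f x *: d'); exact: holoM.
Qed.

Lemma holN f x : hol f x -> hol (fun v => - f v) x.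
Proof.
move=> hf; have := holM (hol_cst (-1) x) hf.
by under [X in hol X]eq_fun do rewrite mulN1r.
Qed.

Lemma holX f k x : hol f x -> hol (fun v => f v ^+ k) x.
Proof.
move=> hf; elim: k => [|k IHk].
  by under eq_fun do rewrite expr0; exact: hol_cst.
by under eq_fun do rewrite exprS; exact: holM.
Qed.

Lemma holV f x : f x != 0 -> hol f x -> hol (fun v => (f v)^-1) x.
Proof. by move=> fx [d hd]; eexists; exact: holoV hd. Qed.

Lemma hol_csqrt f x : f x = 1 -> hol f x -> hol (fun v => csqrt (f v)) x.
Proof.
move=> fx [d hd]; eexists; apply: holo_csqrt hd.
by rewrite fx subrr normr0 invr_gt0 ltr0n.
Qed.

Lemma hol_neq0 f x : hol f x -> f x != 0 -> \forall y \near x, f y != 0.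
Proof.
move=> [d /holo_cvg hf] fx; have h : \forall a \near f x, a != 0.
  have := @cvg_id _ (nbhs (f x)) => /cvgr_neq0; exact.
exact: (hf _ h).
Qed.

Lemma hol_mdiff (phi : 'cV[C]_n -> 'cV[C]_n) x :
  (forall k, exists d, carat (fun v => phi v k 0) x d) ->
  exists M, mdiff phi x M.
Proof.
move=> /choice [d hd]; exists (\matrix_(k, j) d k 0 j) => e e0.
have h k := carat_strict (hd k) e0.
have {}h k : \forall y \near x,
    `|phi y k 0 - phi x k 0 - (d k *m (y - x)) 0 0| <= e * `|y - x|.
  exact: (cvg_pair (@cvg_id _ (nbhs x)) (cvg_cst x)) _ (h k).
have {}h : \forall y \near x, forall k,
    `|phi y k 0 - phi x k 0 - (d k *m (y - x)) 0 0| <= e * `|y - x|.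
  exact: (@filter_forall _ _ _ (nbhs x) _ h).
apply: filterS h => y hy.
apply: mx_norm_le => [|k j]; first by rewrite mulr_ge0 // ltW.
apply: le_trans (hy k); rewrite ord1 !mxE.
by under eq_bigr do rewrite mxE; exact: lexx.
Qed.

Lemma holo_strict (phi : 'cV[C]_n -> 'cV[C]_n) x (M : 'M[C]_n) :
  (forall k, carat (fun v => phi v k 0) x (row k M)) -> forall e : C, 0 < e ->
  \forall p \near (x, x),
    `|phi p.1 - phi p.2 - M *m (p.1 - p.2)| <= e * `|p.1 - p.2|.
Proof.
move=> hd e e0; have h k := carat_strict (hd k) e0.
have {}h : \forall p \near (x, x), forall k,
    `|phi p.1 k 0 - phi p.2 k 0 - (row k M *m (p.1 - p.2)) 0 0| <= e * `|p.1 - p.2|.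
  exact: (@filter_forall _ _ _ (nbhs (x, x)) _ h).
apply: filterS h => p hp.
apply: mx_norm_le => [|k j]; first by rewrite mulr_ge0 // ltW.
by apply: le_trans (hp k); rewrite ord1 -row_mul !mxE.
Qed.

End Hol.

(** * Coordinates of the A_2 singularity *)

Section LocalCusp.
Variables (C : numClosedFieldType) (r c : C).
Hypothesis hr : r ^+ 2 = 3.
Hypothesis hc : c ^+ 2 = (3 + r) * c + r.
Local Notation V := 'cV[C]_3.

(** A primitive cube root of 1, since (i r)^2 = -3. Below, - [del] is the other root 3 + r - c; the
    product of the roots is - r, so [gam] is 1/c. *)
Let o : C := (- 1 + 'i * r) / 2.
Let del : C := c - 3 - r.
Let gam : C := del * r / 3.

Let ho : o ^+ 2 = - 1 - o.
Proof. by have hi := sqrCi C; rewrite /o; field: hi hr. Qed.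

Let hd : del ^+ 2 = r - (3 + r) * del.
Proof. by rewrite /del; ring: hr hc. Qed.

Let hg2 : gam ^+ 2 = r / 3 - (r + 1) * gam.
Proof. by rewrite /gam; field: hr hd. Qed.

Let mm (v : V) := (v 0 0 + v 1 0 + v 2 0) * 3^-1.
Let xi (v : V) := (v 0 0 + o ^+ 2 * v 1 0 + o * v 2 0) * 3^-1.
Let eta (v : V) := (v 0 0 + o * v 1 0 + o ^+ 2 * v 2 0) * 3^-1.
Let fu v := xi v * eta v.
Let fw v := xi v ^+ 3 + eta v ^+ 3.
Let g1 v := locform_u r (mm v) (fu v) (fw v).
Let g2 v := locform_w r (mm v) (fu v) (fw v).
Let rho v := g2 v * (g1 v)^-1.
Let sq v := csqrt (1 + - (4 * rho v ^+ 2 * fu v)).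
(** The equation rho (1 + a^2 u) = a has the roots (1 - s) / (2 rho u) and (1 + s) / (2 rho u),
    where s^2 = 1 - 4 rho^2 u. The first one is regular at u = 0 and is written here in rationalized
    form. *)
Let aa v := 2 * rho v * (1 + sq v)^-1.
Let hh v := g1 v * (1 + aa v ^+ 2 * fu v)^-1.
(** Since 1 - (3 + r) m - r m^2 = - r (m - gam) (m + gam + r + 1), this is the form on the line
    divided by (m - gam)^3. *)
Let ee v := (- r * (mm v + gam + r + 1)) ^+ 3 * loccofactor r (mm v).
Let alpha v := (xi v + aa v * eta v ^+ 2) * (hh v * (ee v)^-1).
Let beta v := eta v + aa v * xi v ^+ 2.
(** The squares of the first two coordinates add up to alpha beta. Division by [ee] inside [alpha]
    leaves [ee] as a common invertible factor of the equation. *)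
Let phi v : V := \col_k nth 0 [:: (alpha v + beta v) * 2^-1;
  (alpha v + - beta v) * (2 * 'i)^-1; mm v + - gam] k.
Let p0 : V := const_mx gam.

Let n3 : 3 != 0 :> C. Proof. by rewrite pnatr_eq0. Qed.
Let n2 : 2 != 0 :> C. Proof. by rewrite pnatr_eq0. Qed.

Let mm0 : mm p0 = gam. Proof. by rewrite /mm !mxE; field. Qed.
Let xi0 : xi p0 = 0. Proof. by rewrite /xi !mxE; field: ho. Qed.
Let eta0 : eta p0 = 0. Proof. by rewrite /eta !mxE; field: ho. Qed.
Let fu0 : fu p0 = 0. Proof. by rewrite /fu xi0 mul0r. Qed.
Let fw0 : fw p0 = 0. Proof. by rewrite /fw xi0 eta0 !expr0n /= addr0. Qed.

Let coordE (v : V) : [/\ v 0 0 = mm v + xi v + eta v,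
  v 1 0 = mm v + o * xi v + o ^+ 2 * eta v &
  v 2 0 = mm v + o ^+ 2 * xi v + o * eta v].
Proof. by split; rewrite /mm /xi /eta; field: ho. Qed.

Let g1_neq0 : g1 p0 != 0.
Proof.
rewrite /g1 mm0 fu0 fw0; set g := locform_u _ _ _ _.
(* A scalar multiple of the inverse of [g] in Q(r, gam); the product with [g] is an integer with
   prime factors 2 and 3 only. *)
pose k := - (1351 * 1000 + 296 + (804 * 1000 + 480) * r)
  - (508 * 1000 + 32 + (247 * 1000 + 680) * r) * gam.
have e : g * k = 2 ^+ 26 * 3 ^+ 3.
  rewrite /g locform_u00; cbv zeta.
  have h3 : gam ^+ 3 = - 1 - r / 3 + (4 + 7 / 3 * r) * gam by rewrite /gam; field: hr hd.
  have h4 : gam ^+ 4 = 7 / 3 + 4 / 3 * r - (12 + 20 / 3 * r) * gam.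
    by rewrite /gam; field: hr hd.
  have h6 : gam ^+ 6 = 20 + 103 / 9 * r - (101 + 175 / 3 * r) * gam.
    by rewrite (exprM _ 3 2) h3 /gam; field: hr hd.
  have h8 : gam ^+ 8 = 1537 / 9 + 296 / 3 * r - (2600 / 3 + 4504 / 9 * r) * gam.
    by rewrite (exprM _ 4 2) h4 /gam; field: hr hd.
  have -> : gam ^+ 10 = gam ^+ 6 * gam ^+ 4 by rewrite -exprD.
  rewrite h8 h6 h4 h3 hg2.
  have -> : 1 + 3 * (7 / 3 + 4 / 3 * r - (12 + 20 / 3 * r) * gam) =
    8 + 4 * r - (36 + 20 * r) * gam by field.
  set B := (X in PhiA r _ X); have -> : B = (1558 / 3 + 300 * r) - (2636 + 4564 / 3 * r) * gam.
    by rewrite /B; field.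
  by rewrite /k /PhiA /PhiB /PhiD /gam; field: hr hd.
apply: contra_eq_neq e => ->; rewrite mul0r eq_sym.
by rewrite mulf_neq0 ?expf_neq0.
Qed.

Let ee_neq0 : ee p0 != 0.
Proof.
rewrite /ee mm0 mulf_neq0 ?expf_neq0 //.
  (* The discriminant (3 + r)^2 + 4 r of the quadratic polynomial in m with root [gam]. *)
  have e : (- r * (gam + gam + r + 1)) ^+ 2 = 12 + 10 * r by rewrite /gam; field: hr hd.
  have d0 : 12 + 10 * r != 0.
    by apply: (r_lin_neq0 hr); rewrite (_ : _ - _ = - (12 * 13)) ?oppr_eq0 ?mulf_neq0 ?pnatr_eq0 //; ring.
  by rewrite -sqrf_eq0 e.
have e : loccofactor r gam * (- (14 * 1000 + 144 + 8064 * r) - (4608 + 2880 * r) * gam) = 2 ^+ 16.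
  by rewrite /loccofactor /gam; field: hr hd.
apply: contra_eq_neq e => ->; rewrite mul0r eq_sym.
by rewrite expf_neq0.
Qed.

Let form12_split (v : V) : form12 r (v 0 0) (v 1 0) (v 2 0) 1 =
  (mm v - gam) ^+ 3 * ee v + fu v * g1 v + fw v * g2 v.
Proof.
have [-> -> ->] := coordE v.
rewrite form12_locform // locform_split locform_line // /ee /g1 /g2.
congr (_ + _ + _); rewrite [RHS]mulrA -[in RHS]exprMn; congr (_ ^+ 3 * _).
by rewrite /gam; field: hr hd.
Qed.

(* The factorisation h (xi + a eta^2) (eta + a xi^2) = u g1 + w g2 holds because
   rho (1 + a^2 u) = a. *)
Let normal_form (v : V) : g1 v != 0 -> ee v != 0 -> 1 + aa v ^+ 2 * fu v != 0 ->
  form12 r (v 0 0) (v 1 0) (v 2 0) 1 =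
  ee v * (((alpha v + beta v) * 2^-1) ^+ 2 + ((alpha v - beta v) * (2 * 'i)^-1) ^+ 2
    + (mm v - gam) ^+ 3).
Proof.
move=> g1n en dn; have hi := sqrCi C; have i0 := neq0Ci C.
have sqn : 1 + sq v != 0 by rewrite addrC csqrt_add1_neq0.
have sq2 : sq v ^+ 2 = 1 - 4 * rho v ^+ 2 * fu v by rewrite /sq csqrtK.
have ha : aa v = rho v * (1 + aa v ^+ 2 * fu v).
  rewrite /aa; move: (rho v) (sq v) (fu v) sqn sq2 => p s u sn s2.
  have -> : (2 * p * (1 + s)^-1) ^+ 2 * u = (4 * p ^+ 2 * u) * (1 + s)^-1 ^+ 2.
    by ring.
  rewrite (_ : 4 * p ^+ 2 * u = 1 - s ^+ 2); last by rewrite s2; ring.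
  by field.
have -> : ((alpha v + beta v) * 2^-1) ^+ 2 + ((alpha v - beta v) * (2 * 'i)^-1) ^+ 2
    = alpha v * beta v.
  by field: hi.
rewrite form12_split [RHS]mulrDr [RHS]addrC [X in _ = X + _]mulrC -addrA.
congr (_ + _).
have -> : ee v * (alpha v * beta v) = hh v * ((xi v + aa v * eta v ^+ 2) * beta v).
  by rewrite /alpha; field.
have hr1 : g2 v = rho v * g1 v by rewrite /rho mulfVK.
rewrite hr1 /hh; rewrite /beta /fu /fw; rewrite /fu in ha dn.
move: ha dn; move: (aa v) (rho v) (g1 v) (xi v) (eta v) => a p g x y ha dn.
have hp : p = a * (1 + a ^+ 2 * (x * y))^-1 by rewrite {1}ha mulfK.
by rewrite hp; field.
Qed.

Let hmm : hol mm p0.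
Proof. by apply: holM (hol_cst _ _); do 2?apply: holD; exact: hol_coord. Qed.

Let hxi : hol xi p0.
Proof.
apply: holM (hol_cst _ _); do 2?apply: holD; do ?exact: hol_coord.
- by apply: holM; [exact: hol_cst|exact: hol_coord].
- by apply: holM; [exact: hol_cst|exact: hol_coord].
Qed.

Let heta : hol eta p0.
Proof.
apply: holM (hol_cst _ _); do 2?apply: holD; do ?exact: hol_coord.
- by apply: holM; [exact: hol_cst|exact: hol_coord].
- by apply: holM; [exact: hol_cst|exact: hol_coord].
Qed.

Let hfu : hol fu p0. Proof. exact: holM. Qed.

Let hfw : hol fw p0. Proof. by apply: holD; exact: holX. Qed.

Ltac solve_hol := lazymatch goal with
  | |- hol (fun=> ?c) _ => exact: hol_cst
  | |- hol (fun v => @?f v + @?g v) _ => apply: (@holD _ _ f g); solve_hol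
  | |- hol (fun v => - (@?f v)) _ => apply: (@holN _ _ f); solve_hol
  | |- hol (fun v => @?f v * @?g v) _ => apply: (@holM _ _ f g); solve_hol
  | |- hol (fun v => @?f v ^+ ?k) _ => apply: (@holX _ _ f k); solve_hol
  | |- _ => assumption
  end.

(** Each layer of the local equation is treated separately, so that [solve_hol] closes the inner
    ones by assumption. *)
Let hnD : hol (fun v => nD (mm v) (fu v) (fw v)) p0.
Proof. by rewrite /nD; solve_hol. Qed.
Let hnS : hol (fun v => nS (mm v) (fu v) (fw v)) p0.
Proof. by rewrite /nS; solve_hol. Qed.
Let hnA : hol (fun v => nA (mm v) (fu v) (fw v)) p0.
Proof. by rewrite /nA; solve_hol. Qed.
Let hnA0 : hol (fun v => nA (mm v) 0 0) p0.
Proof. by rewrite /nA; solve_hol. Qed.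
Let hnT : hol (fun v => nT (mm v) (fu v) (fw v)) p0.
Proof. by rewrite /nT; solve_hol. Qed.
Let hnB : hol (fun v => nB (mm v) (fu v) (fw v)) p0.
Proof. by rewrite /nB; solve_hol. Qed.
Let hnB0 : hol (fun v => nB (mm v) 0 0) p0.
Proof. by rewrite /nB /nT /nS /nD /nA; solve_hol. Qed.
Let hnT_u : hol (fun v => nT_u (mm v) (fu v) (fw v)) p0.
Proof. by rewrite /nT_u; solve_hol. Qed.
Let hnT_w : hol (fun v => nT_w (mm v) (fu v) (fw v)) p0.
Proof. by rewrite /nT_w; solve_hol. Qed.
Let hnQ : hol (fun v => nQ (mm v) (fu v) (fw v)) p0.
Proof. by rewrite /nQ; solve_hol. Qed.
Let hdA : hol (fun v => dPhiA r (mm v) (fu v) (fw v)) p0.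
Proof. by rewrite /dPhiA; solve_hol. Qed.
Let hdB : hol (fun v => dPhiB r (mm v) (fu v) (fw v)) p0.
Proof. by rewrite /dPhiB; solve_hol. Qed.
Let hdD : hol (fun v => dPhiD r (mm v) (fu v) (fw v)) p0.
Proof. by rewrite /dPhiD; solve_hol. Qed.
Let hg1 : hol g1 p0. Proof. by rewrite /g1 /locform_u; solve_hol. Qed.
Let hol_g2 : hol g2 p0. Proof. by rewrite /g2 /locform_w; solve_hol. Qed.
Let hee : hol ee p0. Proof. by rewrite /ee /loccofactor; solve_hol. Qed.
Let hrho : hol rho p0. Proof. by apply: holM => //; exact: holV. Qed.
Let hsq : hol sq p0.
Proof.
apply: hol_csqrt; first by rewrite fu0 mulr0 oppr0 addr0.
by solve_hol.
Qed.
Let haa : hol aa p0.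
Proof.
apply: holM; first by solve_hol.
by apply: holV; [rewrite addrC csqrt_add1_neq0|solve_hol].
Qed.
Let den_neq0 : 1 + aa p0 ^+ 2 * fu p0 != 0.
Proof. by rewrite fu0 mulr0 addr0 oner_neq0. Qed.
Let hden : hol (fun v => 1 + aa v ^+ 2 * fu v) p0. Proof. by solve_hol. Qed.
Let hhh : hol hh p0. Proof. by apply: holM => //; exact: holV. Qed.
Let hke : hol (fun v => hh v * (ee v)^-1) p0.
Proof. by apply: holM => //; exact: holV. Qed.

Let dm : 'rV[C]_3 := const_mx 3^-1.
Let dxi : 'rV[C]_3 := \row_j (nth 0 [:: 1; o ^+ 2; o] j * 3^-1).
Let deta : 'rV[C]_3 := \row_j (nth 0 [:: 1; o; o ^+ 2] j * 3^-1).

Let mmE : mm = fun v => (dm *m v) 0 0.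
Proof.
apply: funext => v; rewrite !mxE !big_ord_recl big_ord0 !mxE /mm /= addr0.
rewrite (_ : lift ord0 ord0 = 1); last exact: val_inj.
rewrite (_ : lift ord0 (lift ord0 ord0) = 2); last exact: val_inj.
by ring.
Qed.

Let xiE : xi = fun v => (dxi *m v) 0 0.
Proof.
apply: funext => v; rewrite !mxE !big_ord_recl big_ord0 !mxE /xi /= addr0.
rewrite (_ : lift ord0 ord0 = 1); last exact: val_inj.
rewrite (_ : lift ord0 (lift ord0 ord0) = 2); last exact: val_inj.
by ring.
Qed.

Let etaE : eta = fun v => (deta *m v) 0 0.
Proof.
apply: funext => v; rewrite !mxE !big_ord_recl big_ord0 !mxE /eta /= addr0.
rewrite (_ : lift ord0 ord0 = 1); last exact: val_inj.
rewrite (_ : lift ord0 (lift ord0 ord0) = 2); last exact: val_inj.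
by ring.
Qed.

Let dmm : holo mm p0 dm. Proof. by rewrite mmE; exact: holo_linear. Qed.
Let dxi' : holo xi p0 dxi. Proof. by rewrite xiE; exact: holo_linear. Qed.
Let deta' : holo eta p0 deta. Proof. by rewrite etaE; exact: holo_linear. Qed.

Let k0 := hh p0 * (ee p0)^-1.

Let k0_neq0 : k0 != 0.
Proof. by rewrite /k0 /hh !mulf_neq0 ?invr_eq0. Qed.

(** The term with eta^2 has zero differential at the cusp, and xi vanishes there, so the
    differentials of [aa] and of hh / ee drop out. *)
Let dalpha : holo alpha p0 (k0 *: dxi).
Proof.
have [da hda] := haa; have [dk hdk] := hke.
have := holoM (holoD dxi' (holoM hda (holoM deta' deta'))) hdk.
rewrite xi0 eta0 !(mulr0, mul0r, scale0r, scaler0, addr0).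
by rewrite /alpha; under [X in holo X]eq_fun do rewrite -expr2.
Qed.

Let dbeta : holo beta p0 deta.
Proof.
have [da hda] := haa.
have := holoD deta' (holoM hda (holoM dxi' dxi')).
rewrite xi0 !(mulr0, mul0r, scale0r, scaler0, addr0).
by rewrite /beta; under [X in holo X]eq_fun do rewrite -expr2.
Qed.

Let M0 : 'M[C]_3 := \matrix_k nth 0 [:: 2^-1 *: (k0 *: dxi + deta);
  (2 * 'i)^-1 *: (k0 *: dxi - deta); dm] k.

Let holo_phi k : holo (fun v => phi v k 0) p0 (row k M0).
Proof.
rewrite rowK.
have -> : (fun v => phi v k 0) = (fun v => nth 0 [:: (alpha v + beta v) * 2^-1;
  (alpha v + - beta v) * (2 * 'i)^-1; mm v + - gam] k).
  by apply: funext => v; rewrite mxE.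
have hN : holo (fun v => - beta v) p0 (- deta).
  have := holoM (holo_cst (-1) p0) dbeta.
  rewrite scaler0 add0r scaleN1r.
  by under [X in holo X]eq_fun do rewrite mulN1r.
case: k => [] [|[|[|//]]] Hk /=.
- have := holoM (holoD dalpha dbeta) (holo_cst 2^-1 p0).
  by rewrite scaler0 addr0.
- have := holoM (holoD dalpha hN) (holo_cst (2 * 'i)^-1 p0).
  by rewrite scaler0 addr0.
- by have := holoD dmm (holo_cst (- gam) p0); rewrite addr0.
Qed.

Let M0_unit : M0 \in unitmx.
Proof.
rewrite -unitmx_tr -row_free_unit; apply: inj_row_free => w wM.
have : M0 *m w^T = 0 by rewrite -[M0]trmxK -trmx_mul wM trmx0.
set h := w^T => Mh.
have row0 k : (row k M0 *m h) 0 0 = 0 by rewrite -row_mul Mh row0 mxE.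
have xih : (dxi *m h) 0 0 = xi h by rewrite xiE.
have etah : (deta *m h) 0 0 = eta h by rewrite etaE.
have e0 : k0 * xi h + eta h = 0.
  have := row0 0; rewrite rowK /= -scalemxAl mulmxDl -scalemxAl mxE [X in _ * X]mxE.
  rewrite [X in X + _]mxE xih etah => /eqP; rewrite mulf_eq0 invr_eq0 (negbTE n2).
  by move=> /eqP.
have e1 : k0 * xi h - eta h = 0.
  have := row0 1; rewrite rowK /= -scalemxAl mulmxBl -scalemxAl mxE [X in _ * X]mxE.
  rewrite [X in X + _]mxE [X in _ + X]mxE xih etah => /eqP.
  by rewrite mulf_eq0 invr_eq0 mulf_eq0 (negbTE n2) (negbTE (neq0Ci C)) => /eqP.
have e2 : mm h = 0 by have := row0 2; rewrite rowK /= mmE.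
have x0 : xi h = 0.
  apply: (mulfI (mulf_neq0 n2 k0_neq0)); rewrite mulr0.
  transitivity ((k0 * xi h + eta h) + (k0 * xi h - eta h)); first by ring.
  by rewrite e0 e1 addr0.
have y0 : eta h = 0 by move: e0; rewrite x0 mulr0 add0r.
apply: trmx_inj; rewrite trmx0 -/h; apply/colP => k; rewrite [RHS]mxE.
have [h0 h1 h2] := coordE h; rewrite x0 y0 e2 !mulr0 !addr0 in h0 h1 h2.
case: k => [] [|[|[|//]]] Hk.
- by rewrite (_ : Ordinal Hk = 0); [exact: h0|exact: val_inj].
- by rewrite (_ : Ordinal Hk = 1); [exact: h1|exact: val_inj].
- by rewrite (_ : Ordinal Hk = 2); [exact: h2|exact: val_inj].
Qed.

Theorem local_cusp : geometric_complete V ->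
  analytically_equivalent
    [set v : V | form12 r (v 0 0) (v 1 0) (v 2 0) 1 = 0]
    (const_mx ((c - 3 - r) * r / 3))
    (A2_surface C) 0.
Proof.
move=> gc.
pose good (v : V) := [/\ g1 v != 0, ee v != 0 & 1 + aa v ^+ 2 * fu v != 0].
have near_good : \forall v \near p0, good v /\ exists M, mdiff phi v M.
  have n1 := hol_neq0 hg1 g1_neq0.
  have n2' := hol_neq0 hee ee_neq0.
  have n3' := hol_neq0 hden den_neq0.
  have n4 : \forall v \near p0, forall k, exists d, carat (fun v => phi v k 0) v d.
    have h k := (holo_phi k).2.
    exact: (@filter_forall _ _ _ (nbhs p0) _ h).
  near=> v; split; last by apply: hol_mdiff; near: v.
  by split; near: v.
have strict := holo_strict (fun k => (holo_phi k).1).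
have [U [W [psi [[oU oW U0 W0] hU hW dU dW]]]] :=
  inverse_function gc M0_unit strict near_good.
have phi0 : phi p0 = 0.
  apply/colP => k; rewrite !mxE /alpha /beta mm0 xi0 eta0 subrr.
  by rewrite !expr0n /= !mulr0 !addr0 !mul0r oppr0 addr0 mul0r; case: k => [] [|[|[|//]]].
exists U, W, phi, psi; split=> //.
- by split=> //; rewrite -phi0.
- by move=> u /hU [].
move=> u Uu; have [[hg he hd'] _ _] := hU u Uu.
rewrite /A2_surface /= (normal_form hg he hd') !mxE /=.
split=> [/eqP|->]; last by rewrite mulr0.
by rewrite mulf_eq0 (negbTE he) => /eqP.
Unshelve. all: by end_near. Qed.

End LocalCusp.

(** * The cusps in the projective space *)

Section AnalyticEquivalence.
Variable C : numClosedFieldType.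
Local Notation V := 'cV[C]_3.

Lemma open_preimage (U W : set V) (f : V -> V) : open U -> open W ->
  (forall u, U u -> differentiable f u) -> open (U `&` f @^-1` W).
Proof.
move=> oU oW df; rewrite openE => u [Uu Wu]; rewrite /interior.
have h1 := open_nbhs_nbhs (conj oU Uu).
have fc : f x @[x --> u] --> f u by exact: differentiable_continuous (df u Uu).
have h2 := fc _ (open_nbhs_nbhs (conj oW Wu)).
exact: filterI h1 h2.
Qed.

Lemma analytically_equivalent_trans (X Y Z : set V) (a b c : V) :
  analytically_equivalent X a Y b -> analytically_equivalent Y b Z c ->
  analytically_equivalent X a Z c.
Proof.
move=> [U [W [f [g [[oU oW Ua Wb fa] fU gW [df dg] XY]]]]].
move=> [U' [W' [f' [g' [[oU' oW' Ua' Wb' fa'] fU' gW' [df' dg'] YZ]]]]].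
exists (U `&` f @^-1` U'), (W' `&` g' @^-1` W), (f' \o f), (g \o g'); split.
- split; [exact: open_preimage|exact: open_preimage| | |by rewrite /= fa].
    by split=> //=; rewrite fa.
  by split=> //=; have [_] := fU' _ Ua'; rewrite fa' => ->.
- move=> u [Uu U'u] /=; have [Wu gu] := fU _ Uu; have [W'u g'u] := fU' _ U'u.
  by rewrite g'u gu.
- move=> w [Ww W'w] /=; have [Uw fw] := gW' _ Ww; have [U'w f'w] := gW _ W'w.
  by rewrite f'w fw; split=> //; split=> //=; rewrite f'w.
- split=> [u [Uu U'u]|w [Ww W'w]].
    by apply: differentiable_comp; [exact: df|exact: df'].
  by apply: differentiable_comp; [exact: dg'|exact: dg].
- move=> u [Uu U'u] /=; split=> [/(XY _ Uu)/(YZ _ U'u)//|].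
  by move=> /(YZ _ U'u)/(XY _ Uu).
Qed.

End AnalyticEquivalence.

(** * Projective transformations in affine charts *)

Section Charts.
Variable C : numClosedFieldType.
Implicit Types (g : 'M[C]_4) (w : 'cV[C]_4) (a b : 'cV[C]_3) (i j : 'I_4).

Definition unchart i w : 'cV[C]_3 := \col_k (w (lift i k) 0 * (w i 0)^-1).

Lemma chart_unchart i w : w i 0 != 0 ->
  chart_vec i (unchart i w) = (w i 0)^-1 *: w.
Proof.
move=> w0; apply/colP => j; rewrite !mxE.
by case: unliftP => [k ->|->]; [rewrite mxE mulrC|rewrite mulVf].
Qed.

Lemma chart_vecii i a : chart_vec i a i 0 = 1.
Proof. by rewrite mxE unlift_none. Qed.

Lemma chart_vec_neq0 i a : chart_vec i a != 0.
Proof.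
by apply/eqP => /colP/(_ i); rewrite chart_vecii mxE => /eqP; rewrite oner_eq0.
Qed.

Lemma unchart_chart i a : unchart i (chart_vec i a) = a.
Proof.
by apply/colP => k; rewrite mxE chart_vecii mxE liftK invr1 mulr1.
Qed.

Lemma unchart_scale i l w : l != 0 -> unchart i (l *: w) = unchart i w.
Proof.
move=> l0; apply/colP => k; rewrite !mxE invfM mulrACA divff // mul1r //.
Qed.

Lemma hol_sum n (I : Type) (s : seq I) (f : I -> 'cV[C]_n -> C) x :
  (forall k, hol (f k) x) -> hol (fun v => \sum_(k <- s) f k v) x.
Proof.
move=> hf; elim: s => [|k s IHs].
  by under eq_fun do rewrite big_nil; exact: hol_cst.
by under eq_fun do rewrite big_cons; exact: holD.
Qed.

Lemma hol_act_chart g i k (a : 'cV[C]_3) :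
  hol (fun b => (g *m chart_vec i b) k 0) a.
Proof.
have -> : (fun b : 'cV[C]_3 => (g *m chart_vec i b) k 0) =
    (fun b : 'cV[C]_3 => \sum_(l <- index_enum 'I_4) (g k l * chart_vec i b l 0)).
  by apply: funext => b; rewrite mxE.
apply: hol_sum => l; apply: holM; first exact: hol_cst.
case: (unliftP i l) => [m ->|->].
  have -> : (fun v : 'cV[C]_3 => chart_vec i v (lift i m) 0) = (fun v => v m 0).
    by apply: funext => v; rewrite mxE liftK.
  exact: hol_coord.
have -> : (fun v : 'cV[C]_3 => chart_vec i v i 0) = (fun=> 1).
  by apply: funext => v; rewrite chart_vecii.
exact: hol_cst.
Qed.

Definition transition g i j a := unchart j (g *m chart_vec i a).

Definition transition_dom g i j := [set a | (g *m chart_vec i a) j 0 != 0].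

Lemma differentiable_transition g i j a : transition_dom g i j a ->
  differentiable (transition g i j) a.
Proof.
move=> dom; have [M] : exists M, mdiff (transition g i j) a M.
  apply: hol_mdiff => k.
  suff [d [hd _]] : hol (fun v => transition g i j v k 0) a by exists d.
  have -> : (fun v => transition g i j v k 0) = (fun v =>
      (g *m chart_vec i v) (lift j k) 0 * ((g *m chart_vec i v) j 0)^-1).
    by apply: funext => v; rewrite [LHS]mxE.
  by apply: holM; [|apply: holV => //]; exact: hol_act_chart.
exact: mdiff_differentiable.
Qed.

Lemma open_transition_dom g i j : open (transition_dom g i j).
Proof.
rewrite openE => a dom; rewrite /interior.
exact: hol_neq0 (hol_act_chart g i j a) dom.
Qed.

Lemma transitionK g i j a : g \in unitmx -> transition_dom g i j a ->
  transition_dom (invmx g) j i (transition g i j a) /\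
  transition (invmx g) j i (transition g i j a) = a.
Proof.
move=> ug dom; rewrite /transition_dom /transition /= chart_unchart //.
have l0 : ((g *m chart_vec i a) j 0)^-1 != 0 by rewrite invr_eq0.
rewrite -!scalemxAr mulmxA mulVmx // mul1mx unchart_scale // unchart_chart.
by rewrite mxE chart_vecii mulr1.
Qed.

Lemma transition_equivalent (X Y : set 'cV[C]_3) g i j a : g \in unitmx ->
  transition_dom g i j a ->
  (forall b, transition_dom g i j b -> X b <-> Y (transition g i j b)) ->
  analytically_equivalent Y (transition g i j a) X a.
Proof.
move=> ug dom XY; have uV : invmx g \in unitmx by rewrite unitmx_inv.
have K := @transitionK g i j _ ug; have K' := @transitionK (invmx g) j i _ uV.
rewrite invmxK in K'.
exists (transition_dom (invmx g) j i), (transition_dom g i j),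
  (transition (invmx g) j i), (transition g i j); split.
- split; [exact: open_transition_dom|exact: open_transition_dom| |exact: dom|].
    by have [] := K _ dom.
  by have [] := K _ dom.
- by move=> u /K'.
- by move=> w /K.
- by split=> u; exact: differentiable_transition.
- by move=> u du; have [d e] := K' _ du; rewrite {1}(esym e); split => /XY; exact.
Qed.

End Charts.

Section Cusps.
Variables (C : numClosedFieldType) (r c : C).
Hypothesis hr : r ^+ 2 = 3.
Hypothesis hc : c ^+ 2 = (3 + r) * c + r.
Implicit Types (g : 'M[C]_4) (v w : 'cV[C]_4) (L : {vspace 'cV[C]_4}).
Local Notation F := (form12_mpoly r).
Local Notation v0 := (vec 1 1 1 c).

Lemma vlineZ l v : l != 0 -> (<[l *: v]> = <[v]>)%VS.
Proof.
move=> l0; apply: subv_anti; rewrite -!memvE memvZ ?memv_line //=.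
by rewrite -{1}[v](scalerK l0) memvZ // memv_line.
Qed.

Lemma proj_spaceP L : proj_space C L <-> exists2 v, v != 0 & L = <[v]>%VS.
Proof.
split=> [/= dL|[v v0 ->]]; last by rewrite /proj_space /= dim_vline v0.
have L0 : L != 0%VS by rewrite -dimv_eq0 dL.
exists (vpick L); first by rewrite vpick0.
apply/esym/eqP; rewrite eqEdim -memvE memv_pick /= dL dim_vline vpick0.
by rewrite L0.
Qed.

Lemma proj_act_line g v : proj_act g <[v]>%VS = <[g *m v]>%VS.
Proof. by rewrite /proj_act limg_line lfunE. Qed.

Lemma evalp_scale l v : evalp F (l *: v) = l ^+ 12 * evalp F v.
Proof. by rewrite (vecE v) scale_vec !evalp_form12 form12_scale. Qed.

Lemma evalp_act g v : G29 C g -> evalp F (g *m v) = evalp F v.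
Proof.
move=> gG; have := evalp_poly_act F v (G29_unit gG).
by rewrite (form12_mpoly_invariant r gG).
Qed.

Lemma zero_locus_line v : v != 0 -> zero_locus F <[v]>%VS <-> evalp F v = 0.
Proof.
move=> vn0; split=> [[_ /= h]|e]; first by apply: h; exact: memv_line.
split; first by rewrite /proj_space /= dim_vline vn0.
by move=> w /vlineP [k ->]; rewrite evalp_scale e mulr0.
Qed.

Lemma chart_zero_locus i a :
  (chart i @^-1` zero_locus F) a <-> evalp F (chart_vec i a) = 0.
Proof. exact: zero_locus_line (chart_vec_neq0 i a). Qed.

Lemma singular_locus_line v : v != 0 ->
  singular_locus F <[v]>%VS <-> critical_vec r v.
Proof.
move=> vn0; split=> [[_ h] j|cv]; first by apply: h; exact: memv_line.
split; last by move=> w /vlineP [k ->] j; exact: critical_vec_scale.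
apply/(zero_locus_line vn0); move: cv; rewrite (vecE v) critical_vecP evalp_form12.
exact: critical_form12_eq0.
Qed.

Lemma cusps_act g L : G29 C g -> cusps F L -> cusps F (proj_act g L).
Proof.
move=> gG [sL [i [a [Lia ae]]]]; have ug := G29_unit gG.
have wn0 : g *m chart_vec i a != 0.
  apply/eqP => e; have := chart_vec_neq0 i a.
  by rewrite -[chart_vec i a](mulKmx ug) e mulmx0 eqxx.
split.
  rewrite Lia proj_act_line; apply/(singular_locus_line wn0).
  apply: critical_vec_pconj (pconj_act _ gG) _.
  by apply/(singular_locus_line (chart_vec_neq0 i a)); rewrite -[<[_]>%VS]/(chart i a) -Lia.
have [j wj] : exists j, (g *m chart_vec i a) j 0 != 0.
  apply/existsP; apply: contraNT wn0; rewrite negb_exists => /forallP h.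
  by apply/eqP/colP => j; rewrite [RHS]mxE; apply/eqP; rewrite -[_ == _]negbK h.
exists j, (transition g i j a); split.
  rewrite Lia /chart proj_act_line /transition chart_unchart // vlineZ //.
  by rewrite invr_eq0.
apply: analytically_equivalent_trans ae.
apply: transition_equivalent => // b db.
rewrite !chart_zero_locus /transition chart_unchart // evalp_scale evalp_act //.
split=> [->|/eqP]; first by rewrite mulr0.
by rewrite mulf_eq0 expf_eq0 /= invr_eq0 (negbTE db) => /eqP.
Qed.

Let v0_neq0 : v0 != 0.
Proof. by apply/eqP => /colP/(_ 0); rewrite !mxE => /eqP; rewrite oner_eq0. Qed.

(** The t-derivative vanishes at the triple root. The other three derivatives coincide by symmetry,
    and Euler's identity says that their sum is 0. *)
Lemma critical_cusp : critical_vec r v0.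
Proof.
have Q0 : c ^+ 2 - (3 + r) * c - r = 0 by rewrite hc; ring.
have dt : dform12 r c 1 1 1 = 0.
  rewrite dform12_111t // Q0; ring.
have f0 : form12 r 1 1 1 c = 0 by rewrite form12_111t // Q0; ring.
have dx : dform12 r 1 1 1 c = 0.
  have := form12_euler r 1 1 1 c; rewrite f0 dt mulr0 mulr0 !mul1r addr0.
  move=> e; apply: (mulfI (_ : 3 != 0 :> C)); first by rewrite pnatr_eq0.
  by rewrite mulr0 [RHS]e; ring.
by apply/critical_vecP; split.
Qed.

Lemma cusps_base : geometric_complete ('cV[C]_3 : normedModType C) ->
  cusps F <[v0]>%VS.
Proof.
move=> gc; split; first exact/(singular_locus_line v0_neq0)/critical_cusp.
pose gam := (c - 3 - r) * r / 3; have gc1 : gam * c = 1.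
  by rewrite /gam; field: hr hc.
have chart3 (a : 'cV[C]_3) : chart_vec ord_max a = vec (a 0 0) (a 1 0) (a 2 0) 1.
  apply/colP => j; rewrite !mxE; case: (unliftP ord_max j) => [k ->|->] //=.
  rewrite /bump; case: k => [] [|[|[|//]]] Hk /=; congr (a _ _); exact: val_inj.
exists ord_max, (const_mx gam); split.
  rewrite /chart chart3 !mxE -(vlineZ v0 (_ : gam != 0)) ?scale_vec ?mulr1 ?gc1 //.
  by apply: contra_eq_neq gc1 => ->; rewrite mul0r eq_sym oner_eq0.
rewrite (_ : _ @^-1` _ = [set v : 'cV[C]_3 | form12 r (v 0 0) (v 1 0) (v 2 0) 1 = 0]).
  exact: local_cusp.
apply/seteqP; split=> v; rewrite chart_zero_locus chart3 evalp_form12; exact.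
Qed.

Theorem cusps_orbit : geometric_complete ('cV[C]_3 : normedModType C) ->
  cusps F = proj_orbit (G29 C) <[v0]>%VS.
Proof.
move=> gc; apply/seteqP; split=> [L [sL _]|_ [g gG <-]]; last first.
  exact/cusps_act/cusps_base.
have [v vn0 LE] := (proj_spaceP L).1 sL.1.1; subst L.
have [g [l [gG l0 ->]]] := critical_pconj hr hc vn0 ((singular_locus_line vn0).1 sL).
by exists g => //; rewrite proj_act_line vlineZ.
Qed.

End Cusps.

(** * Counting the orbit *)

(* Pairs (a, b) stand for a + b X with X^2 = p X + q. *)
Section Quadratic.
Variables (K : Type) (add mul : K -> K -> K) (opp : K -> K) (p q : K).

Definition qadd (x y : K * K) := (add x.1 y.1, add x.2 y.2).
Definition qopp (x : K * K) := (opp x.1, opp x.2).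
Definition qmul (x y : K * K) :=
  let b := mul x.2 y.2 in
  (add (mul x.1 y.1) (mul q b), add (add (mul x.1 y.2) (mul x.2 y.1)) (mul p b)).
Definition qconj (x : K * K) := (add x.1 (mul p x.2), opp x.2).

Variable eqK : K -> K -> bool.
Definition qeq (x y : K * K) := if eqK x.1 y.1 then eqK x.2 y.2 else false.

Lemma qeqP : Equality.axiom eqK -> Equality.axiom qeq.
Proof.
move=> eqKP [a b] [c d]; rewrite /qeq /=.
case: (eqKP a c) => [->|ne]; last by apply: ReflectF => -[].
by case: (eqKP b d) => [->|ne]; [apply: ReflectT|apply: ReflectF => -[]].
Qed.

Variables (C : comNzRingType) (ev : K -> C) (X : C).
Hypothesis ev_add : forall x y, ev (add x y) = ev x + ev y.
Hypothesis ev_opp : forall x, ev (opp x) = - ev x.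
Hypothesis ev_mul : forall x y, ev (mul x y) = ev x * ev y.
Hypothesis hX : X ^+ 2 = ev p * X + ev q.

Definition qev (x : K * K) := ev x.1 + ev x.2 * X.

Lemma qev_add x y : qev (qadd x y) = qev x + qev y.
Proof. by rewrite /qev /= !ev_add; ring. Qed.

Lemma qev_opp x : qev (qopp x) = - qev x.
Proof. by rewrite /qev /= !ev_opp; ring. Qed.

Lemma qev_mul x y : qev (qmul x y) = qev x * qev y.
Proof. by rewrite /qev /= !(ev_add, ev_mul); ring: hX. Qed.

End Quadratic.

Local Notation zn n := (Z.of_nat n%N).

Definition Zr := (Z * Z)%type.
Definition addr3 := qadd Z.add.
Definition oppr3 := qopp Z.opp.
Definition mulr3 := qmul Z.add Z.mul (zn 0) (zn 3).

Definition Zrc := (Zr * Zr)%type.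
Definition addc := qadd addr3.
Definition oppc := qopp oppr3.
Definition mulc := qmul addr3 mulr3 (zn 3, zn 1) (zn 0, zn 1).

Definition Zrci := (Zrc * Zrc)%type.
Definition addi : Zrci -> Zrci -> Zrci := qadd addc.
Definition oppi : Zrci -> Zrci := qopp oppc.
Definition zeroc : Zrc := ((zn 0, zn 0), (zn 0, zn 0)).
Definition muli : Zrci -> Zrci -> Zrci :=
  qmul addc mulc zeroc ((Z.opp (zn 1), zn 0), (zn 0, zn 0)).
Definition subi x y := addi x (oppi y).

Definition zeroi : Zrci := (zeroc, zeroc).
Definition ofZi (n : Z) : Zrci := (((n, zn 0), (zn 0, zn 0)), zeroc).
Definition ci : Zrci := (((zn 0, zn 0), (zn 1, zn 0)), zeroc).
Definition ii : Zrci := (zeroc, ((zn 1, zn 0), (zn 0, zn 0))).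

Definition eqi : Zrci -> Zrci -> bool := qeq (qeq (qeq Z.eqb)).

Lemma eqiP : Equality.axiom eqi.
Proof. by do 3!apply: qeqP; exact: Z.eqb_spec. Qed.

Definition vec4 := (Zrci * Zrci * Zrci * Zrci)%type.

(* Conditionals rather than &&, whose arguments vm_compute would all evaluate. *)
Definition eqv (v w : vec4) :=
  let: (x, y, z, t) := v in let: (x', y', z', t') := w in
  if eqi t t' then if eqi z z' then if eqi y y' then eqi x x' else false
  else false else false.

Lemma eqvP : Equality.axiom eqv.
Proof.
move=> [[[x y] z] t] [[[x' y'] z'] t']; rewrite /eqv.
case: eqiP => [->|ne]; last by apply: ReflectF => -[].
case: eqiP => [->|ne]; last by apply: ReflectF => -[].
case: eqiP => [->|ne]; last by apply: ReflectF => -[].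
by case: eqiP => [->|ne]; [apply: ReflectT|apply: ReflectF => -[]].
Qed.

Fixpoint memv (v : vec4) (S : seq vec4) :=
  if S is w :: S' then if eqv v w then true else memv v S' else false.

Lemma mem_vec4E v S : memv v S = (v \in S).
Proof.
by elim: S => //= w S ->; rewrite inE; case: eqvP => [->|/eqP/negbTE->]; rewrite ?eqxx.
Qed.

Fixpoint uniqv (S : seq vec4) :=
  if S is w :: S' then if memv w S' then false else uniqv S' else true.

Lemma uniqvE S : uniqv S = uniq S.
Proof. by elim: S => //= w S ->; rewrite mem_vec4E; case: (w \in S). Qed.

(* The matrix s4 is replaced with 2 s4, to stay in the ring. *)
Definition act4 (k : nat) (v : vec4) : vec4 :=
  let: (x, y, z, t) := v in
  match k with
  | 0 => (y, x, z, t)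
  | 1 => (x, z, y, t)
  | 2 => (oppi (muli ii y), muli ii x, z, t)
  | _ => let s := addi (addi x y) (addi z t) in
         (subi (addi x x) s, subi (addi y y) s, subi (addi z z) s, subi (addi t t) s)
  end%N.

Definition parallel (v w : vec4) :=
  let: (x, y, z, t) := v in let: (x', y', z', t') := w in
  [&& ~~ eqi x zeroi, ~~ eqi x' zeroi, eqi (muli x y') (muli x' y),
    eqi (muli x z') (muli x' z) & eqi (muli x t') (muli x' t)].

(** The quotient is rounded; [parallel] tests every value of [normalize], and the correctness of the
    enumeration rests on this test. *)
Definition divZ (d : Z) (x : Zrci) : Zrci :=
  let f u := Z.div u d in let g u := (f u.1, f u.2) in let h u := (g u.1, g u.2) in
  (h x.1, h x.2).

(* The multiple of v with first coordinate 66, computed by means of the norm of the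
   first coordinate. All points of the orbit have a multiple of this form with
   integral coordinates. *)
Definition normalize (v : vec4) : vec4 :=
  let: (x, y, z, t) := v in if eqi x (ofZi (zn 66)) then v else
  let xi := (x.1, oppc x.2) in let n := (muli x xi).1 in
  let nc := qconj addr3 mulr3 oppr3 (zn 3, zn 1) n in let m := (mulc n nc).1 in
  let mr := (m.1, Z.opp m.2) in let d := (mulr3 m mr).1 in
  let f := muli xi (mulc nc (mr, (zn 0, zn 0)), zeroc) in
  let g u := divZ d (muli (ofZi (zn 66)) (muli f u)) in
  (g x, g y, g z, g t).

Definition orbit_step (k : nat) (S : seq vec4 * seq vec4) (v : vec4) :=
  let u := act4 k v in let w := normalize u in
  if parallel u w && ~~ memv w S.1 then (w :: S.1, w :: S.2) else S.

Fixpoint orbit_loop (n : nat) (found front : seq vec4) : seq vec4 :=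
  if n is n'.+1 then
    let S := foldl (fun S v => foldl (fun S k => orbit_step k S v) S [:: 0; 1; 2; 3]%N)
               (found, [::]) front in
    orbit_loop n' S.1 S.2
  else found.

Definition base4 : vec4 := (ofZi (zn 66), ofZi (zn 66), ofZi (zn 66), muli (ofZi (zn 66)) ci).
(** Thirteen rounds of breadth-first search exhaust the orbit, as [closed4] confirms. *)
Definition orbit4 := orbit_loop 13 [:: base4] [:: base4].

Definition closed4 (S : seq vec4) :=
  all (fun v => all (fun k => let u := act4 k v in let w := normalize u in
    parallel u w && memv w S) [:: 0; 1; 2; 3]%N) S.

Definition orbit4_spec (S : seq vec4) :=
  [&& size S == 320%N, uniqv S, all (fun v => eqi v.1.1.1 (ofZi (zn 66))) S,
      memv base4 S & closed4 S].

Lemma orbit4_ok : orbit4_spec orbit4.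
Proof. by vm_compute. Qed.

#[local] Arguments Z.of_nat : simpl never.
#[local] Arguments Z.opp : simpl never.
#[local] Arguments Z.add : simpl never.
#[local] Arguments Z.mul : simpl never.

(** For nonzero integers the exponent of 3 would be even on the left and odd on the right. *)
Lemma sqrt3_irrational (a b : Z) : Z.mul a a = Z.mul (zn 3) (Z.mul b b) -> a = Z0 /\ b = Z0.
Proof.
move=> e; have [n na] : exists n : nat, Z.abs a = zn n by exists (Z.abs_nat a); lia.
have [m mb] : exists m : nat, Z.abs b = zn m by exists (Z.abs_nat b); lia.
have nm : (n * n = 3 * (m * m))%N by nia.
have [m0|m0] := posnP m; first by subst m; split; nia.
have n0 : (0 < n)%N by nia.
have := congr1 (logn 3) nm; rewrite !lognM ?muln_gt0 ?m0 // (_ : logn 3 3 = 1)%N //.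
lia.
Qed.

(* Over Z[sqrt 3], (a + b sqrt 3)^2 = (12 + 10 sqrt 3) (v + w sqrt 3)^2 is impossible
   unless both sides are 0, since 12 + 10 sqrt 3 has negative norm. *)
Section Discriminant.
Local Open Scope Z_scope.

Lemma norm_discriminant (a b v w : Z) :
  (a * a + 3 * (b * b) = 12 * (v * v + 3 * (w * w)) + 60 * (v * w)) ->
  (2 * (a * b) = 24 * (v * w) + 10 * (v * v + 3 * (w * w))) ->
  (v * v = 3 * (w * w)).
Proof.
move=> e1 e2; set M := (v * v - 3 * (w * w)).
have : ((a * a - 3 * (b * b)) * (a * a - 3 * (b * b)) = - 156 * (M * M)).
  transitivity ((a * a + 3 * (b * b)) * (a * a + 3 * (b * b)) -
                3 * ((2 * (a * b)) * (2 * (a * b)))); first lia.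
  by rewrite e1 e2 /M; lia.
have := Z.square_nonneg (a * a - 3 * (b * b)); have := Z.square_nonneg M.
have M0 : (M * M = 0 -> M = 0) by nia.
by rewrite /M in M0 *; lia.
Qed.

End Discriminant.

(** * From exact arithmetic to complex vectors *)

Section Evaluation.
Variables (C : numClosedFieldType) (r c : C).
Hypotheses (hr : r ^+ 2 = 3) (hc : c ^+ 2 = (3 + r) * c + r).
Hypotheses (r_real : r \is Num.real) (c_real : c \is Num.real).

Definition evZ (n : Z) : C := (int_of_Z n)%:~R.

Let evZ_add x y : evZ (Z.add x y) = evZ x + evZ y.
Proof. by rewrite /evZ -intrD -(rmorphD int_of_Z). Qed.

Let evZ_opp x : evZ (Z.opp x) = - evZ x.
Proof. by rewrite /evZ -mulrNz -(rmorphN int_of_Z). Qed.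

Let evZ_mul x y : evZ (Z.mul x y) = evZ x * evZ y.
Proof. by rewrite /evZ -intrM -(rmorphM int_of_Z). Qed.

Lemma evZ_nat n : evZ (zn n) = n%:R.
Proof. by rewrite /evZ (_ : int_of_Z (zn n) = n%:Z) //; lia. Qed.

Lemma evZ_real n : evZ n \is Num.real.
Proof. exact: realz. Qed.

Lemma evZ_inj0 n : evZ n = 0 -> n = Z0.
Proof. by move/eqP; rewrite intr_eq0 => /eqP; lia. Qed.

Let hX1 : r ^+ 2 = evZ (zn 0) * r + evZ (zn 3).
Proof. by rewrite !evZ_nat hr; ring. Qed.

Definition evr := qev evZ r.
Definition evc := qev evr c.
Definition evi := qev evc 'i.

Let evr_add x y : evr (addr3 x y) = evr x + evr y. Proof. exact: qev_add. Qed.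
Let evr_opp x : evr (oppr3 x) = - evr x. Proof. exact: qev_opp. Qed.
Let evr_mul x y : evr (mulr3 x y) = evr x * evr y. Proof. exact: qev_mul hX1 _ _. Qed.

Let hX2 : c ^+ 2 = evr (zn 3, zn 1) * c + evr (zn 0, zn 1).
Proof. by rewrite /evr /qev /= !evZ_nat hc; ring. Qed.

Let evc_add x y : evc (addc x y) = evc x + evc y. Proof. exact: qev_add. Qed.
Let evc_opp x : evc (oppc x) = - evc x. Proof. exact: qev_opp. Qed.
Let evc_mul x y : evc (mulc x y) = evc x * evc y. Proof. exact: qev_mul hX2 _ _. Qed.

Let evc_zero : evc zeroc = 0.
Proof. by rewrite /evc /qev /evr /qev /= !evZ_nat; ring. Qed.

Let hX3 : 'i ^+ 2 = evc zeroc * 'i + evc ((Z.opp (zn 1), zn 0), (zn 0, zn 0)).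
Proof.
by rewrite evc_zero /evc /qev /evr /qev /= evZ_opp !evZ_nat sqrCi; ring.
Qed.

Lemma evi_add x y : evi (addi x y) = evi x + evi y. Proof. exact: qev_add. Qed.
Lemma evi_opp x : evi (oppi x) = - evi x. Proof. exact: qev_opp. Qed.
Lemma evi_mul x y : evi (muli x y) = evi x * evi y. Proof. exact: qev_mul hX3 _ _. Qed.
Lemma evi_sub x y : evi (subi x y) = evi x - evi y.
Proof. by rewrite evi_add evi_opp. Qed.

Let evr_real x : evr x \is Num.real.
Proof. by rewrite rpredD ?rpredM ?evZ_real. Qed.

Let evc_real x : evc x \is Num.real.
Proof. by rewrite rpredD ?rpredM ?evr_real. Qed.

Let evr_inj0 x : evr x = 0 -> x = (Z0, Z0).
Proof.
case: x => a b e; have [|-> -> //] := @sqrt3_irrational a b.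
apply/Z.sub_move_0_r/evZ_inj0; rewrite /Z.sub evZ_add evZ_opp !evZ_mul evZ_nat.
move: e; rewrite /evr /qev /= => e.
rewrite (_ : _ - _ = (evZ a - evZ b * r) * (evZ a + evZ b * r)); last by ring: hr.
by rewrite e mulr0.
Qed.

Let evc_inj0 x : evc x = 0 -> x = zeroc.
Proof.
case: x => [u v]; rewrite /evc /qev /= => e.
pose two : Zr := (zn 2, zn 0); pose w : Zr := (zn 3, zn 1); pose d : Zr := (zn 12, zn 10).
(* Completing the square: u + v c = 0 gives 2 u + (3 + r) v = - v (2 c - 3 - r), and (2 c - 3 - r)^2
   = 12 + 10 r. *)
pose A := addr3 (mulr3 two u) (mulr3 w v).
have : addr3 (mulr3 A A) (oppr3 (mulr3 d (mulr3 v v))) = (Z0, Z0).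
  apply: evr_inj0; rewrite evr_add evr_opp !evr_mul evr_add !evr_mul.
  have -> : evr u = - (evr v * c) by apply/eqP; rewrite -addr_eq0 e.
  have -> : evr two = 2 by rewrite /evr /qev /= !evZ_nat; ring.
  have -> : evr w = 3 + r by rewrite /evr /qev /= !evZ_nat; ring.
  have -> : evr d = 12 + 10 * r by rewrite /evr /qev /= !evZ_nat; ring.
  by ring: hr hc.
case: u v @A {e} => [u0 u1] [v0 v1] /= => -[e1 e2].
have [v00 v10] : v0 = Z0 /\ v1 = Z0.
  apply: sqrt3_irrational.
  by apply: (@norm_discriminant (2 * u0 + 3 * v0 + 3 * v1) (2 * u1 + v0 + 3 * v1)); lia.
move: e1 e2; rewrite v00 v10 => e1 e2.
have [u00 u10] : u0 = Z0 /\ u1 = Z0 by apply: sqrt3_irrational; nia.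
by rewrite u00 u10.
Qed.

(** As [r] and [c] are real, the two components are the real and imaginary parts. *)
Let evi_inj0 x : evi x = 0 -> x = zeroi.
Proof.
case: x => [a b]; rewrite /evi /qev /= (mulrC _ 'i) => e.
have ea : evc a = 0 by rewrite -[LHS](Re_rect (evc_real a) (evc_real b)) e raddf0.
have eb : evc b = 0 by rewrite -[LHS](Im_rect (evc_real a) (evc_real b)) e raddf0.
by rewrite (evc_inj0 ea) (evc_inj0 eb).
Qed.

Lemma evi_inj x y : evi x = evi y -> x = y.
Proof.
move=> e; have : subi x y = zeroi by apply: evi_inj0; rewrite evi_sub e subrr.
case: x y {e} => [[[x1 x2] [x3 x4]] [[x5 x6] [x7 x8]]] [[[y1 y2] [y3 y4]] [[y5 y6] [y7 y8]]].
by case=> *; do !congr pair; lia.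
Qed.

Lemma eviZ n : evi (ofZi (zn n)) = n%:R.
Proof. by rewrite /evi /qev evc_zero /evc /qev /evr /qev /= !evZ_nat; ring. Qed.

Lemma evi_c : evi ci = c.
Proof. by rewrite /evi /qev evc_zero /evc /qev /evr /qev /= !evZ_nat; ring. Qed.

Lemma evi_i : evi ii = 'i.
Proof. by rewrite /evi /qev evc_zero /evc /qev /evr /qev /= !evZ_nat; ring. Qed.

Lemma evi0 : evi zeroi = 0.
Proof. exact: eviZ 0. Qed.

Definition ev4 (v : vec4) : 'cV[C]_4 :=
  let: (x, y, z, t) := v in vec (evi x) (evi y) (evi z) (evi t).

Lemma ev4_base : ev4 base4 = 66 *: vec 1 1 1 c.
Proof. by rewrite /ev4 /base4 evi_mul evi_c !eviZ scale_vec mulr1. Qed.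

Definition gen4 (k : nat) : 'M[C]_4 := nth (s4 C) [:: s1 C; s2 C; s3 C] k.

Lemma G29_gen4 k : G29 C (gen4 k).
Proof.
case: k => [|[|[|k]]]; [exact: G29_s1|exact: G29_s2|exact: G29_s3|].
by rewrite /gen4 nth_default //; exact: G29_s4.
Qed.

Lemma ev4_act k v : exists2 l, l != 0 & ev4 (act4 k v) = l *: (gen4 k *m ev4 v).
Proof.
have one : (1 : C) != 0 by exact: oner_neq0.
case: v => [[[x y] z] t]; rewrite /ev4 /gen4; case: k => [|[|[|k]]] /=.
- by exists 1; rewrite // s1_vec scale1r.
- by exists 1; rewrite // s2_vec scale1r.
- by exists 1; rewrite // s3_vec scale1r evi_opp !evi_mul evi_i mulNr.
exists 2; rewrite ?pnatr_eq0 // nth_nil s4_vec scale_vec !(evi_sub, evi_add).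
by congr vec; field.
Qed.

Lemma parallel_ev4 v w : parallel v w -> exists2 l, l != 0 & ev4 w = l *: ev4 v.
Proof.
case: v w => [[[x y] z] t] [[[x' y'] z'] t'] /and5P[/eqiP xn /eqiP xn'].
move=> /eqiP/(congr1 evi); rewrite !evi_mul => ey.
move=> /eqiP/(congr1 evi); rewrite !evi_mul => ez.
move=> /eqiP/(congr1 evi); rewrite !evi_mul => et.
have x0 : evi x != 0 by apply/eqP => e; apply/xn/evi_inj; rewrite e evi0.
have x0' : evi x' != 0 by apply/eqP => e; apply/xn'/evi_inj; rewrite e evi0.
exists (evi x' / evi x); first by rewrite mulf_neq0 ?invr_eq0.
rewrite /ev4 scale_vec; congr vec; apply: (mulfI x0); rewrite ?ey ?ez ?et; by field.
Qed.

Definition line4 v : {vspace 'cV[C]_4} := <[ev4 v]>%VS.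

Lemma line4_inj v w : eqi v.1.1.1 (ofZi (zn 66)) -> eqi w.1.1.1 (ofZi (zn 66)) ->
  line4 v = line4 w -> v = w.
Proof.
case: v w => [[[x y] z] t] [[[x' y'] z'] t'] /= /eqiP-> /eqiP-> e.
have /vlineP[l] : ev4 (ofZi (zn 66), y, z, t) \in line4 (ofZi (zn 66), y', z', t').
  by rewrite -e memv_line.
rewrite /ev4 scale_vec => /vec_inj[]; rewrite !eviZ => e66.
have -> : l = 1 by apply: (mulIf (_ : 66 != 0)); rewrite ?pnatr_eq0 // -e66 mul1r.
by rewrite !mul1r => /evi_inj-> /evi_inj-> /evi_inj->.
Qed.

Let reached v := pconj (ev4 base4) (ev4 v).

Let step_reached k S v : reached v ->
  {in S.1, forall u, reached u} /\ {in S.2, forall u, reached u} ->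
  {in (orbit_step k S v).1, forall u, reached u} /\ {in (orbit_step k S v).2, forall u, reached u}.
Proof.
rewrite /orbit_step => rv rS; case: ifP => // /andP[/parallel_ev4[l l0 ew] _].
have rw : reached (normalize (act4 k v)).
  apply: (pconj_trans rv); rewrite /pconj ew.
  have [m m0 ->] := ev4_act k v; exists (gen4 k), (l * m); rewrite scalerA mulf_neq0 //.
  by split=> //; exact: G29_gen4.
by case: rS => r1 r2; split=> u; rewrite inE => /predU1P[->|]; [|exact: r1| |exact: r2].
Qed.

Lemma orbit_loop_reached n found front :
  {in found, forall v, reached v} -> {in front, forall v, reached v} ->
  {in orbit_loop n found front, forall v, reached v}.
Proof.
elim: n found front => //= n IHn found front rfound rfront.
set S := foldl _ _ front.
suff [r1 r2] : {in S.1, forall u, reached u} /\ {in S.2, forall u, reached u} by exact: IHn.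
have : {in (found, [::] : seq vec4).1, forall u, reached u} /\
       {in (found, [::] : seq vec4).2, forall u, reached u} by [].
rewrite {}/S; move: (found, [::]) => S; move: {IHn rfound} (rfront).
elim: front S {rfront} => [S _ rS|v front IHf S rfront rS] /=; [exact: rS|apply: IHf].
  by move=> u uf; apply: rfront; rewrite inE uf orbT.
have rv : reached v by apply: rfront; exact: mem_head.
by do 4!apply: (step_reached _ rv).
Qed.

Lemma reached_orbit4 : {in orbit4, forall v, reached v}.
Proof.
by apply: orbit_loop_reached => v; rewrite inE => /eqP->; exact: pconj_refl.
Qed.

Lemma closed4P S k v : closed4 S -> v \in S -> (k < 4)%N ->
  exists2 w, w \in S & proj_act (gen4 k) (line4 v) = line4 w.
Proof.
move=> /allP clS vS k4.
have /(_ k)/(_ _)/andP[] := allP (clS _ vS); first by case: k k4 => [|[|[|[|//]]]].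
rewrite mem_vec4E => /parallel_ev4[l l0 ew] wS; exists (normalize (act4 k v)) => //.
have [m m0 ea] := ev4_act k v.
by rewrite proj_act_line /line4 ew ea scalerA vlineZ // mulf_neq0.
Qed.

Let stable (S : seq vec4) (g : 'M[C]_4) :=
  {in S, forall v, exists2 w, w \in S & proj_act g (line4 v) = line4 w}.

Lemma proj_actM (g h : 'M[C]_4) v :
  proj_act (g *m h) <[v]>%VS = proj_act g (proj_act h <[v]>%VS).
Proof. by rewrite !proj_act_line mulmxA. Qed.

(** Stability under g and under its inverse are proved together, to pass through inverses; the
    generators are involutions, so the enumeration needs to test them only. *)
Lemma closed4_stable S g : closed4 S -> G29 C g -> stable S g.
Proof.
move=> clS gG; pose P g := stable S g /\ stable S (invmx g).
have gens k : (k < 4)%N -> gen4 k *m gen4 k = 1%:M -> P (gen4 k).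
  by move=> k4 kk; split; rewrite ?(invmx_invol kk) // => v vS; exact: closed4P.
have stM h1 h2 : stable S h1 -> stable S h2 -> stable S (h1 *m h2).
  move=> st1 st2 v /st2[w wS e2]; have [u uS e1] := st1 w wS; exists u => //.
  by rewrite proj_actM e2 e1.
suff [_ []] : g \in unitmx /\ P g by [].
apply: (G29_ind _ _ _ _ _ _ _ gG).
- by split; rewrite ?invmx1 // => v vS; exists v; rewrite // proj_act_line mul1mx.
- move=> h1 h2 u1 u2 [p1 p1'] [p2 p2']; split; first exact: stM.
  by rewrite invmx_mul //; exact: stM.
- by move=> h _ [p p']; split; rewrite ?invmxK.
- exact: (gens 0%N) (s1_invol C).
- exact: (gens 1%N) (s2_invol C).
- exact: (gens 2) (s3_invol C).
- exact: (gens 3) (s4_invol C).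
Qed.

(** Closure puts the orbit inside the list, and reachability puts the list inside the orbit. With
    first coordinate 66 throughout, distinct vectors span distinct lines. *)
Theorem card_orbit : (proj_orbit (G29 C) <[vec 1 1 1 c]>%VS #= `I_320)%card.
Proof.
(* The list is made a variable, so that no later conversion unfolds the enumeration. *)
have := orbit4_ok; have := reached_orbit4; move: orbit4 => S reachedS.
case/and5P => /eqP sz + /allP first66 + cl; rewrite uniqvE mem_vec4E => un base.
have l0 : <[vec 1 1 1 c]>%VS = line4 base4.
  by rewrite /line4 ev4_base vlineZ // pnatr_eq0.
pose f k := line4 (nth base4 S k).
have -> : proj_orbit (G29 C) <[vec 1 1 1 c]>%VS = f @` `I_320.
  apply/seteqP; split=> [_ [g gG <-]|_ [k k320 <-]].
    have [w wS ew] := closed4_stable cl gG base; exists (index w S).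
      by rewrite /= -sz index_mem.
    by rewrite /f nth_index // -ew l0.
  have kS : nth base4 S k \in S by rewrite mem_nth // sz.
  have [g [l [gG ln0 e]]] := reachedS _ kS; exists g => //.
  by rewrite l0 proj_act_line /f /line4 e vlineZ.
apply: inj_card_eq => k k'; rewrite !inE => kI kI' e.
have k320 : (k < size S)%N by rewrite sz.
have k320' : (k' < size S)%N by rewrite sz.
apply/eqP; rewrite -(nth_uniq base4 k320 k320' un); apply/eqP.
by apply: line4_inj e; exact/first66/mem_nth.
Qed.

End Evaluation.

(** The nonnegative square root of 3 makes the discriminant 12 + 10 r positive and hence [c] real;
    with the other sign it would be negative. *)
Lemma exists_real_parameters (C : numClosedFieldType) : exists r c : C,
  [/\ r ^+ 2 = 3, c ^+ 2 = (3 + r) * c + r, r \is Num.real & c \is Num.real].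
Proof.
pose r : C := sqrtC 3; pose d := sqrtC (12 + 10 * r).
have r0 : 0 <= r by rewrite sqrtC_ge0 ler0n.
have d0 : 0 <= d by rewrite sqrtC_ge0 addr_ge0 ?mulr_ge0 ?ler0n.
have hr : r ^+ 2 = 3 by rewrite sqrtCK.
have hd : d ^+ 2 = 12 + 10 * r by rewrite sqrtCK.
exists r, ((3 + r + d) / 2); split=> //; first by field: hr hd.
  exact: ger0_real.
by rewrite ger0_real // mulr_ge0 ?invr_ge0 ?addr_ge0 ?ler0n.
Qed.

Theorem mainTheorem1 (R : realType) :
  exists F : mpoly 4 R[i],
    [/\ F != 0,
        F \is ishomog1 12 mdeg,
        poly_invariant (G29 R[i]) F,
        (cusps F #= `I_320)%card &
        exists2 L, proj_space R[i] L & cusps F = proj_orbit (G29 R[i]) L].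
Proof.
have [r [c [hr hc r_real c_real]]] := exists_real_parameters R[i].
have cuspsE := cusps_orbit hr hc (@geometric_complete_cV R 3).
exists (form12_mpoly r); split.
- apply: form12_mpoly_neq0; rewrite -mulNr; apply: (r_lin_neq0 hr).
  by rewrite (_ : _ - _ = - 2) ?oppr_eq0 ?pnatr_eq0 //; ring.
- exact: form12_mpoly_homog.
- exact: form12_mpoly_invariant.
- by rewrite cuspsE; exact: card_orbit hr hc r_real c_real.
- exists <[vec 1 1 1 c]>%VS; last exact: cuspsE.
  apply/proj_spaceP; exists (vec 1 1 1 c); last by [].
  by apply/eqP => /colP/(_ ord0)/eqP; rewrite !mxE /= oner_eq0.
Qed.
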